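(* Let $\mathcal M$ be any von Neumann algebra. Then its predual $\mathcal M_*$ is $1$-Plichko. Moreover, $\mathcal M_*$ is weakly Lindelöf determined if and only if $\mathcal M$ is $\sigma$-finite. In this case (i.e., if $\mathcal M$ is $\sigma$-finite) $\mathcal M_*$ is even weakly compactly generated.
   Context: A von Neumann algebra is a $*$-subalgebra $\mathcal M\subset \mathcal B(H)$ of bounded operators on a complex Hilbert space $H$ (a linear subspace closed under composition and adjoints) equal to its double commutant $\mathcal M''$. Its (unique) predual is denoted $\mathcal M_*$; it is a complex Banach space with $(\mathcal M_* )^*=\mathcal M$. A projection in $\mathcal M$ is an element $p$ with $p=p^*=p^2$. $\mathcal M$ is $\sigma$-finite if any orthogonal family of nonzero projections in $\mathcal M$ is countable. ''Countable'' means finite or countably infinite. Let $X$ be a (real or complex) Banach space. A linear subspace $D\subset X^*$ is norming if $\|x\|_D=\sup\{|x^*(x)|: x^*\in D,\ \|x^*\|\le 1\}$ defines an equivalent norm on $X$; it is $1$-norming if $\|x\|_D=\|x\|$ for all $x\in X$. A norming linear subspace $D\subset X^*$ is a $\Sigma$-subspace of $X^*$ if there is a linearly dense set $M\subset X$ (i.e., a set whose linear span is dense in $X$) such that $D=\{x^*\in X^*: \{m\in M: x^*(m)\neq 0\}\text{ is countable}\}$. $X$ is $1$-Plichko if $X^*$ admits a $1$-norming $\Sigma$-subspace. $X$ is weakly Lindelöf determined (WLD) if $X^*$ itself is a $\Sigma$-subspace of $X^*$. $X$ is weakly compactly generated (WCG) if there is a weakly compact subset of $X$ whose linear span is dense in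 $X$. *)

(* Defs.v *)
From HB Require Import structures.
From mathcomp Require Import all_boot all_order all_algebra.
From mathcomp Require Import all_classical all_reals all_analysis.
From mathcomp Require Export complex.
Set Implicit Arguments.
Unset Strict Implicit.
Unset Printing Implicit Defensive.
Import Order.TTheory GRing.Theory Num.Theory Num.Def.
Import numFieldNormedType.Exports.

Local Open Scope classical_set_scope.
Local Open Scope ring_scope.
Local Open Scope complex_scope.

Section LinearSpans.
Variables (K : pzRingType) (V : lmodType K).

Definition linear_subspace (A : set V) : Prop :=
  A 0 /\ forall (a : K) (u v : V), A u -> A v -> A (a *: u + v).

Definition linear_span (A : set V) : set V := smallest linear_subspace A.

End LinearSpans.

Section BanachSpaces.
Variable R : realType.
Local Notation C := R[i].

(* The norm of a normedModType over R[i] takes its values in R[i], where it is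
   a nonnegative real number; rnorm is that number as an element of R. *)
Definition rnorm (V : normedModType C) (v : V) : R := complex.Re `|v|.

Definition bounded_operators (V W : normedModType C) : set (V -> W) :=
  [set f | linear f /\ continuous f].

Definition opnorm (V W : normedModType C) (f : V -> W) : R :=
  sup [set rnorm (f x) | x in [set x : V | rnorm x <= 1]].

Variable X : normedModType C.

Definition dual : set (X -> C^o) := @bounded_operators X C^o.

Definition linearly_dense (M : set X) : Prop := closure (linear_span M) = setT.

Definition norm_from (D : set (X -> C^o)) (x : X) : R :=
  sup [set rnorm (f x) | f in [set f | D f /\ opnorm f <= 1]].

(* norm_from D is always a seminorm when D is a subset of the dual, so being an
   equivalent norm amounts to the two-sided estimate. *)
Definition norming (D : set (X -> C^o)) : Prop :=
  exists c1 c2 : R, [/\ 0 < c1, 0 < c2 &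
    forall x, c1 * rnorm x <= norm_from D x <= c2 * rnorm x].

Definition one_norming (D : set (X -> C^o)) : Prop :=
  forall x, norm_from D x = rnorm x.

Definition Sigma_subspace (D : set (X -> C^o)) : Prop :=
  [/\ D `<=` dual, linear_subspace D, norming D &
    exists M : set X, linearly_dense M /\
      D = [set f | dual f /\ countable [set m | M m /\ f m <> 0]]].

Definition one_Plichko : Prop :=
  exists D : set (X -> C^o), Sigma_subspace D /\ one_norming D.

Definition weakly_Lindelof_determined : Prop := Sigma_subspace dual.

Definition evaluation (x : X) : {ptws {f | dual f} -> C^o} :=
  fun f => sval f x.

(* initial_topology evaluation is X with its weak topology: the topology of
   pointwise convergence on the dual. *)
Definition weakly_compact (K : set X) : Prop :=
  compact (K : set (initial_topology evaluation)).

Definition weakly_compactly_generated : Prop :=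
  exists K : set X, weakly_compact K /\ linearly_dense K.

End BanachSpaces.

Section VonNeumannAlgebras.
Variables (R : realType) (H : completeNormedModType R[i]).

(* H is a Hilbert space whose inner product is ip (linear in the first
   variable): positive definiteness and conjugate symmetry are part of the type
   of ip, completeness is part of the type of H. *)
Definition hilbert_inner_product (ip : {dot H for conjC}) : Prop :=
  forall x : H, ip x x = `|x| ^+ 2.

Variable ip : {dot H for conjC}.

Definition adjoint_pair (a b : H -> H) : Prop :=
  forall x y : H, ip (a x) y = ip x (b y).

Definition commutant (S : set (H -> H)) : set (H -> H) :=
  [set b | bounded_operators b /\ forall a, S a -> a \o b = b \o a].

Definition von_Neumann_algebra (M : set (H -> H)) : Prop :=
  [/\ M `<=` @bounded_operators R H H,
      linear_subspace M,
      forall a b, M a -> M b -> M (a \o b),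
      forall a b, M a -> bounded_operators b -> adjoint_pair a b -> M b &
      M = commutant (commutant M)].

Definition projection_in (M : set (H -> H)) (p : H -> H) : Prop :=
  [/\ M p, adjoint_pair p p & p \o p = p].

Definition sigma_finite_algebra (M : set (H -> H)) : Prop :=
  forall P : set (H -> H),
    (forall p, P p -> projection_in M p /\ p <> 0) ->
    (forall p q, P p -> P q -> p <> q -> p \o q = 0) ->
    countable P.

(* X is a predual of M: the dual of the Banach space X is linearly isometric
   to M. By Sakai's theorem such an X is unique up to isometric isomorphism. *)
Definition predual (M : set (H -> H)) (X : completeNormedModType R[i]) : Prop :=
  exists Phi : (X -> R[i]^o) -> (H -> H),
    [/\ set_bij (@dual R X) M Phi,
        forall (c : R[i]) f g, dual f -> dual g ->
          Phi (c *: f + g) = c *: Phi f + Phi g &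
        forall f, dual f -> opnorm (Phi f) = opnorm f].

End VonNeumannAlgebras.

(* Main.v *)
From HB Require Import structures.
Require Import Defs.
From mathcomp Require Import all_boot all_order all_algebra.
From mathcomp Require Import all_classical all_reals all_analysis.
From mathcomp Require Import ring lra.

(** Write [pr b x] for the value at [x] in the predual of the functional that an
    operator [b] of M represents, and M' for the commutant of M.

    Suppose first that every vector functional [b |-> <b h, k>] is given by an element
    of the predual. Let [S] be a maximal family of unit vectors whose orbits under M'
    are mutually orthogonal, let [B] be an orthonormal basis of H, and consider the
    elements of the predual given by [b |-> <b e, s>], with [e] in [B] and [s] in [S].
    They are linearly dense: an operator at which they all vanish has an adjoint that
    kills [S], hence its orbits, which span H. By Bessel's inequality a given [s]
    counts for countably many [e] only, so [b] has a countable support on these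
    elements as soon as the adjoint of [b] kills all but countably many [s]. This is
    the case for [q b] when [q] projects onto the span of finitely many orbits, and
    such operators suffice to compute norms in the predual ([predual_proj_approx]);
    so we have a 1-norming Sigma-subspace ([cyclic_one_Plichko]). If M is
    sigma-finite, [S] is countable, because cyclic projections are mutually orthogonal
    ([cyclic_countable]). Then all operators have countable support, and the same
    elements, divided by [n + 1] when they come from the [n]-th vector of [S], tend
    weakly to 0: this gives WLD and WCG ([cyclic_WLD], [cyclic_WCG]).

    Conversely, let the predual be WLD, let [N] be the corresponding dense set and [P]
    an orthogonal family of nonzero projections. An element of [N] is nonzero at
    countably many members of [P], and an operator is nonzero at countably many
    elements of [N]. A closing-off argument yields a countable [J] such that the
    supremum of [P] minus [J] vanishes on [N]; hence [P = J] ([WLD_countable]).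

    It remains to compare an arbitrary predual with the vector functionals. Order
    intervals of M are intersections of balls ([op_interval_normP]), hence compact for
    the topology of any predual, and the elements of the predual are continuous along
    decreasing families ([vanishing_pr]). If [x] attains its norm at the contraction
    [u], then [b |-> pr (u b) x] is positive and normal ([norming_normal_positive]),
    and it determines [x] ([norming_range]). Normal positive functionals are limits of
    vector functionals, by a maximality argument combined with the Riesz lemma
    ([normal_positive_vector_limit]); so the elements of the predual are such limits
    ([predual_vector_limit]), and a Hahn-Banach argument shows that no vector
    functional is missing ([vector_functional_in_predual]). *)

Set Implicit Arguments.
Unset Strict Implicit.
Unset Printing Implicit Defensive.
Import Order.TTheory GRing.Theory Num.Theory Num.Def.
Import numFieldNormedType.Exports.

Local Open Scope classical_set_scope.
Local Open Scope ring_scope.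
Local Open Scope complex_scope.

(** * Norms over the complex numbers *)

(** The modulus of a complex number is an instance of the norm, [C^o] being [C] as
    a normed space over itself. *)
Notation cabs := (@rnorm _ (_^o : normedModType _)).

Section Norms.
Variable R : realType.
Local Notation C := R[i].

Lemma rnormE (V : normedModType C) (x : V) : (rnorm x)%:C = `|x|.
Proof. by rewrite /rnorm RRe_real // ger0_real. Qed.

Lemma rnorm_ge0 (V : normedModType C) (x : V) : 0 <= rnorm x.
Proof. by rewrite -ler0c rnormE. Qed.

Lemma rnorm0 (V : normedModType C) : rnorm (0 : V) = 0.
Proof. by apply: complexI; rewrite rnormE normr0. Qed.

Lemma rnorm_eq0 (V : normedModType C) (x : V) : rnorm x = 0 -> x = 0.
Proof.
by move=> x0; apply/eqP; rewrite -normr_eq0 -rnormE x0.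
Qed.

Lemma rnorm_gt0 (V : normedModType C) (x : V) : x <> 0 -> 0 < rnorm x.
Proof.
move=> x0; rewrite lt_def rnorm_ge0 andbT; apply/eqP => x1.
by apply: x0; apply: rnorm_eq0.
Qed.

Lemma rnormN (V : normedModType C) (x : V) : rnorm (- x) = rnorm x.
Proof. by apply: complexI; rewrite !rnormE normrN. Qed.

Lemma rnormBC (V : normedModType C) (x y : V) : rnorm (x - y) = rnorm (y - x).
Proof. by rewrite -rnormN opprB. Qed.

Lemma rnormD (V : normedModType C) (x y : V) :
  rnorm (x + y) <= rnorm x + rnorm y.
Proof. by rewrite -lecR rmorphD /= !rnormE ler_normD. Qed.

Lemma rnormB (V : normedModType C) (x y : V) :
  rnorm (x - y) <= rnorm x + rnorm y.
Proof. by rewrite (le_trans (rnormD _ _)) // rnormN. Qed.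

Lemma rnormZ (V : normedModType C) (a : C) (x : V) :
  rnorm (a *: x) = cabs a * rnorm x.
Proof. by apply: complexI; rewrite rmorphM /= !rnormE normrZ. Qed.

Lemma cabsM (a b : C) : cabs (a * b) = cabs a * cabs b.
Proof. exact: (@rnormZ C^o). Qed.

Lemma cabs_sqr (a : C) : cabs a ^+ 2 = complex.Re a ^+ 2 + complex.Im a ^+ 2.
Proof. by apply: complexI; rewrite rmorphXn /= rnormE -add_Re2_Im2. Qed.

Lemma cabs_mulJ (a : C) : (cabs a ^+ 2)%:C = a * (a^*)%C.
Proof. by rewrite rmorphXn /= rnormE -sqr_normc. Qed.

Lemma cabsR (x : R) : cabs x%:C = `|x|.
Proof.
by apply: complexI; rewrite rnormE normc_def /= expr0n addr0 sqrtr_sqr.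
Qed.

Lemma cabs1 : cabs (1 : C) = 1.
Proof. by rewrite (cabsR 1) normr1. Qed.

Lemma cabs_i : cabs ('i : C) = 1.
Proof.
apply/eqP; rewrite -(@eqrXn2 _ 2) ?rnorm_ge0 // cabs_sqr /=.
by rewrite expr0n add0r.
Qed.

Lemma cabs_conj (a : C) : cabs (a^*)%C = cabs a.
Proof. by apply: complexI; rewrite !rnormE normcJ. Qed.

Lemma Re_le_cabs (a : C) : `|complex.Re a| <= cabs a.
Proof. by rewrite -lecR rnormE normc_ge_Re. Qed.

Lemma Re_cabs (a : C) : complex.Re a <= cabs a.
Proof. exact: le_trans (ler_norm _) (Re_le_cabs a). Qed.

Lemma ReD (a b : C) : complex.Re (a + b) = complex.Re a + complex.Re b.
Proof. by case: a; case: b. Qed.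

Lemma ImD (a b : C) : complex.Im (a + b) = complex.Im a + complex.Im b.
Proof. by case: a; case: b. Qed.

Lemma ReM (a b : C) : complex.Re (a * b) =
  complex.Re a * complex.Re b - complex.Im a * complex.Im b.
Proof. by case: a; case: b. Qed.

Lemma ImM (a b : C) : complex.Im (a * b) =
  complex.Re a * complex.Im b + complex.Im a * complex.Re b.
Proof. by case: a; case: b. Qed.

Lemma ReN (a : C) : complex.Re (- a) = - complex.Re a.
Proof. by case: a. Qed.

Lemma ImN (a : C) : complex.Im (- a) = - complex.Im a.
Proof. by case: a. Qed.

Lemma ReJ (a : C) : complex.Re (a^*)%C = complex.Re a.
Proof. by case: a. Qed.

Lemma ImJ (a : C) : complex.Im (a^*)%C = - complex.Im a.
Proof. by case: a. Qed.

Lemma complex_ext (a b : C) :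
  complex.Re a = complex.Re b -> complex.Im a = complex.Im b -> a = b.
Proof. by case: a => a1 a2; case: b => b1 b2 /= -> ->. Qed.

Definition ReImE := (ReD, ImD, ReM, ImM, ReN, ImN, ReJ, ImJ).

(** The radii of balls are complex numbers, but only their real parts matter. *)
Lemma complete_filter (V : completeNormedModType C) (T : Type)
    (F : set_system T) (g : T -> V) : ProperFilter F ->
  (forall e : R, 0 < e -> exists A, F A /\
     forall s t, A s -> A t -> rnorm (g s - g t) < e) ->
  exists l, forall e : R, 0 < e -> F [set t | rnorm (g t - l) < e].
Proof.
move=> PF H.
have : cauchy (g @ F).
  apply/cauchy_ballP => e e0.
  have re0 : 0 < complex.Re e by move: e0; rewrite ltcE => /andP[_].
  have ee : e = (complex.Re e)%:C by rewrite RRe_real // gtr0_real.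
  have [A [FA HA]] := H _ re0.
  exists (g @` A, g @` A).
    split; rewrite /= /nbhs /=; apply: filterS FA => t At; exists t => //.
  move=> [x y] /= [[s As <-] [t At <-]].
  by rewrite -ball_normE /ball_ /= ee -rnormE ltcR; exact: HA.
move=> /(@cauchy_cvg V _ _) /cvg_ex[l /cvgrPdist_lt gl].
exists l => e e0.
have /gl : (0 : C) < e%:C by rewrite ltcR.
apply: filterS => t /=.
by rewrite distrC -rnormE ltcR.
Qed.

Section LinearFacts.
Variables (K : nzRingType) (V W : lmodType K) (f : V -> W).
Hypothesis lf : linear f.

Lemma lin0 : f 0 = 0.
Proof. by have := lf (-1) 0 0; rewrite scaler0 addr0 scaleN1r addNr. Qed.

Lemma linZ a x : f (a *: x) = a *: f x.
Proof. by have := lf a x 0; rewrite !addr0 lin0 addr0. Qed.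

Lemma linD x y : f (x + y) = f x + f y.
Proof. by have := lf 1 x y; rewrite !scale1r. Qed.

Lemma linN x : f (- x) = - f x.
Proof. by rewrite -!scaleN1r linZ. Qed.

Lemma linB x y : f (x - y) = f x - f y.
Proof. by rewrite linD linN. Qed.

End LinearFacts.

Definition bounded_by (V W : normedModType C) (f : V -> W) (k : R) :=
  forall x, rnorm (f x) <= k * rnorm x.

Lemma bounded_operatorsP (V W : normedModType C) (f : V -> W) :
  bounded_operators f <-> linear f /\ exists2 k, 0 <= k & bounded_by f k.
Proof.
split=> -[lf].
  pose f' : {linear V -> W} :=
    HB.pack f (GRing.isLinear.Build C V W *:%R f lf).
  move=> cf; split => //.
  have /linear_boundedP/pinfty_ex_gt0[r r0 Hr] :
    bounded_near f' (nbhs 0) by apply/linear_bounded_continuous.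
  have ee : r = (complex.Re r)%:C by rewrite RRe_real // gtr0_real.
  exists (complex.Re r); first by rewrite -ler0c -ee ltW.
  by move=> x; rewrite -lecR rmorphM /= !rnormE -ee; exact: Hr.
move=> [k k0 fk]; split => //.
pose f' : {linear V -> W} :=
    HB.pack f (GRing.isLinear.Build C V W *:%R f lf).
apply: (@bounded_linear_continuous _ _ _ f').
apply/linear_boundedP; exists k%:C; split.
  by apply/complex_realP; exists k.
move=> r kr x; apply: (@le_trans _ _ (k%:C * `|x|)).
  by rewrite -!rnormE -rmorphM /= lecR fk.
by apply: ler_wpM2r => //; exact: ltW.
Qed.

Lemma bounded_by_opnorm (V W : normedModType C) (f : V -> W) :
  bounded_operators f -> bounded_by f (opnorm f).
Proof.
move=> /bounded_operatorsP[lf [k k0 fk]] x.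
have f0 := lin0 lf; have fZ := linZ lf.
have [->|x0] := pselect (x = 0); first by rewrite f0 !rnorm0 mulr0.
have nx := rnorm_gt0 x0.
rewrite -ler_pdivrMr // mulrC.
have -> : (rnorm x)^-1 * rnorm (f x) = rnorm (f ((rnorm x)^-1%:C *: x)).
  by rewrite fZ rnormZ cabsR ger0_norm // invr_ge0 ltW.
apply: ub_le_sup.
  exists k => _ [y /= y1 <-]; apply: le_trans (fk y) _.
  by rewrite ler_piMr.
exists ((rnorm x)^-1%:C *: x) => //=.
by rewrite rnormZ cabsR ger0_norm ?invr_ge0 ?(ltW nx) // mulVf ?gt_eqF.
Qed.

Lemma opnorm_le (V W : normedModType C) (f : V -> W) (k : R) : 0 <= k ->
  bounded_by f k -> opnorm f <= k.
Proof.
move=> k0 fk; apply: ge_sup.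
  by exists (rnorm (f 0)); exists 0 => //=; rewrite rnorm0 ler01.
move=> _ [x /= x1 <-]; apply: le_trans (fk x) _.
by rewrite ler_piMr.
Qed.

Lemma opnorm_leP (V W : normedModType C) (f : V -> W) (k : R) : 0 <= k ->
  bounded_operators f -> (opnorm f <= k) <-> bounded_by f k.
Proof.
move=> k0 bf; split; last exact: opnorm_le.
move=> fk x; apply: le_trans (bounded_by_opnorm bf x) _.
by rewrite ler_wpM2r // rnorm_ge0.
Qed.

Lemma closure_rnormP (V : normedModType C) (A : set V) (x : V) :
  closure A x <-> forall e : R, 0 < e -> exists2 y, A y & rnorm (x - y) < e.
Proof.
split=> [Ax e e0|H B].
  have /Ax[y [Ay yx]] : nbhs x (ball x e%:C).
    by apply: nbhsx_ballx; rewrite ltcR.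
  exists y => //; move: yx.
  by rewrite -ball_normE /ball_ /= -rnormE ltcR.
move=> /nbhs_ballP[e /= e0 xe].
have re0 : 0 < complex.Re e by move: e0; rewrite ltcE => /andP[_].
have ee : e = (complex.Re e)%:C by rewrite RRe_real // gtr0_real.
have [y Ay yx] := H _ re0.
exists y; split => //; apply: xe.
by rewrite -ball_normE /ball_ /= ee -rnormE ltcR.
Qed.

End Norms.

(** * The Hahn-Banach theorem *)

Section HahnBanach.
Variables (R : realType) (V : lmodType R[i]) (D : set V) (p : V -> R).
Local Notation C := R[i].
Hypothesis subD : linear_subspace D.
Hypothesis pD : forall u v, D u -> D v -> p (u + v) <= p u + p v.
Hypothesis pZ : forall (a : C) u, D u -> p (a *: u) = cabs a * p u.

Lemma subspaceZ (E : set V) a u : linear_subspace E -> E u -> E (a *: u).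
Proof. by move=> [E0 EP] Eu; have := EP a u 0 Eu E0; rewrite addr0. Qed.

Lemma subspaceD (E : set V) u v : linear_subspace E -> E u -> E v -> E (u + v).
Proof. by move=> [E0 EP] Eu Ev; have := EP 1 u v Eu Ev; rewrite scale1r. Qed.

Lemma subspaceB (E : set V) u v : linear_subspace E -> E u -> E v -> E (u - v).
Proof.
move=> sE Eu Ev; rewrite -scaleN1r addrC; case: sE => E0; exact.
Qed.

(** A real linear functional on a subspace of D, dominated by p, encoded as its
    graph so that the union of a chain of them is again one. *)
Definition dominated_graph (G : set (V * R)) := [/\ G (0, 0),
  forall (r : R) u s v t, G (u, s) -> G (v, t) -> G (r%:C *: u + v, r * s + t) &
  forall v t, G (v, t) -> D v /\ t <= p v].

Lemma seminorm0 : p 0 = 0.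
Proof.
by have := pZ 0 subD.1; rewrite scale0r rnorm0 mul0r.
Qed.

Lemma seminorm_ge0 u : D u -> 0 <= p u.
Proof.
move=> Du; have DNu := subspaceZ (-1) subD Du.
have := pD Du DNu; rewrite pZ // scaleN1r subrr seminorm0 rnormN cabs1.
by lra.
Qed.

Lemma dominated_graphZ G (r : R) u s :
  dominated_graph G -> G (u, s) -> G (r%:C *: u, r * s).
Proof.
by move=> [G0 GL _] Gu; have := GL r _ _ _ _ Gu G0; rewrite !addr0.
Qed.

(** The value at [v0] may be any number between the bounds [s - p (u - v0)] and
    [p (u + v0) - s], which the triangle inequality separates. *)
Lemma dominated_graph_extend G v0 : dominated_graph G -> D v0 ->
  exists G', [/\ dominated_graph G', G `<=` G' & exists t, G' (v0, t)].
Proof.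
move=> gG Dv0; have [G0 GL Gp] := gG.
pose E := [set x : R | exists u s, G (u, s) /\ x = s - p (u - v0)].
have Eub w t : G (w, t) -> ubound E (p (w + v0) - t).
  move=> Gw _ [u [s [Gu ->]]].
  have [Du _] := Gp _ _ Gu; have [Dw _] := Gp _ _ Gw.
  have := GL 1 _ _ _ _ Gu Gw; rewrite scale1r mul1r => /Gp[_].
  have -> : u + w = (u - v0) + (w + v0) by rewrite addrACA addNr addr0.
  move=> h.
  have := le_trans h (pD (subspaceB subD Du Dv0) (subspaceD subD Dw Dv0)).
  lra.
pose al := sup E.
have E0 : E !=set0 by exists (0 - p (0 - v0)), 0, 0.
have al1 u s : G (u, s) -> s - p (u - v0) <= al.
  move=> Gu; apply: ub_le_sup; last by exists u, s.
  by exists (p (0 + v0) - 0); exact: Eub.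
have al2 u s : G (u, s) -> al <= p (u + v0) - s.
  by move=> Gu; apply: ge_sup => //; exact: Eub.
pose G' := [set z : V * R | exists u s (c : R),
  G (u, s) /\ z = (u + c%:C *: v0, s + c * al)].
exists G'; split; [split|..].
- by exists 0, 0, 0; rewrite scale0r mul0r !addr0.
- move=> r u s v t [u1 [s1 [c1 [G1 [-> ->]]]]] [u2 [s2 [c2 [G2 [-> ->]]]]].
  exists (r%:C *: u1 + u2), (r * s1 + s2), (r * c1 + c2); split; first exact: GL.
  congr pair; last by ring.
  by rewrite rmorphD rmorphM /= scalerDr scalerDl scalerA addrACA.
- move=> v t [u [s [c [Gu [-> ->]]]]].
  have [Du us] := Gp _ _ Gu.
  split; first by rewrite addrC; exact: subD.2.
  have [c0|c0|->] := ltrgtP c 0; last by rewrite scale0r mul0r !addr0.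
  + have := al1 _ _ (dominated_graphZ (- c)^-1 gG Gu).
    have Nc0 : 0 < - c by rewrite oppr_gt0.
    have -> : p (u + c%:C *: v0) = (- c) * p ((- c)^-1%:C *: u - v0).
      rewrite -[X in X * _](gtr0_norm Nc0) -cabsR -pZ; last first.
        by apply: subspaceB => //; exact: subspaceZ.
      rewrite scalerBr scalerA -rmorphM /= mulfV ?gt_eqF // scale1r.
      by rewrite rmorphN scaleNr opprK.
    move=> h; have := ler_wpM2l (ltW Nc0) h.
    by rewrite mulrBr mulrA mulfV ?gt_eqF // mul1r; lra.
  + have := al2 _ _ (dominated_graphZ c^-1 gG Gu).
    have -> : p (u + c%:C *: v0) = c * p (c^-1%:C *: u + v0).
      rewrite -[X in X * _](gtr0_norm c0) -cabsR -pZ; last first.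
        by apply: subspaceD => //; exact: subspaceZ.
      by rewrite scalerDr scalerA -rmorphM /= mulfV ?gt_eqF // scale1r.
    move=> h; have := ler_wpM2l (ltW c0) h.
    by rewrite mulrBr mulrA mulfV ?gt_eqF // mul1r; lra.
- by move=> [u s] Gu; exists u, s, 0; rewrite scale0r mul0r !addr0.
- by exists al, 0, 0, 1; rewrite scale1r mul1r !add0r.
Qed.

Lemma dominated_graph_total G0 : dominated_graph G0 ->
  exists G, [/\ dominated_graph G, G0 `<=` G &
                forall v, D v -> exists t, G (v, t)].
Proof.
move=> gG0.
pose P (G : set (V * R)) := G = set0 \/ (dominated_graph G /\ G0 `<=` G).
have [|G [[->|[gG G0G]] Gmax]] := @Zorn_bigcup _ P.
- move=> F FP Ftot.
  have [F0|/existsNP[G1 /not_implyP[FG1 G1n0]]] :=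
    pselect (forall X, F X -> X = set0).
    by left; apply/seteqP; split=> // x [X /F0 ->].
  have gF X x : F X -> X x -> dominated_graph X /\ G0 `<=` X.
    by move=> FX Xx; have [X0|//] := FP _ FX; move: Xx; rewrite X0.
  have [x0 Gx0] : G1 !=set0 by apply/set0P/eqP.
  have [gG1 G01] := gF _ _ FG1 Gx0.
  right; split; last by move=> x /G01; exists G1.
  split; first by exists G1 => //; case: gG1.
    move=> r u s v t [X FX Xu] [Y FY Yv].
    have [XY|YX] := Ftot _ _ FX FY.
      have [[_ YL _] _] := gF _ _ FY Yv.
      by exists Y => //; apply: YL => //; exact: XY.
    have [[_ XL _] _] := gF _ _ FX Xu.
    by exists X => //; apply: XL => //; exact: YX.
  by move=> v t [X FX Xv]; have [[_ _ Xp] _] := gF _ _ FX Xv; exact: Xp.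
- exfalso; apply: (Gmax G0); last by right; split.
  by split => // /(_ (0, 0)) h; case: gG0 => /h.
- exists G; split => // v Dv.
  have [G' [gG' GG' [t G't]]] := dominated_graph_extend gG Dv.
  exists t; apply: contrapT => nGt.
  apply: (Gmax G'); last by right; split => //; exact: subset_trans GG'.
  by split => // /(_ (v, t)) /(_ G't).
Qed.

(** The functional is the complexification of a dominated extension of
    [y + l w |-> Re l * d]. For [Y = 0] and [d = p w] it is norming at [w]. *)
Theorem hahn_banach_separation (Y : set V) (w : V) (d : R) :
  linear_subspace Y -> Y `<=` D -> D w -> 0 < d ->
  (forall y, Y y -> d <= p (w - y)) ->
  exists g : V -> C, [/\
    forall a u v, D u -> D v -> g (a *: u + v) = a * g u + g v,
    forall u, D u -> d * cabs (g u) <= p u,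
    forall y, Y y -> g y = 0 & g w = 1].
Proof.
move=> subY YD Dw d0 dY.
pose G0 := [set z : V * R | exists y (l : C),
  Y y /\ z = (y + l *: w, complex.Re l * d)].
have gG0 : dominated_graph G0.
  split.
  - by exists 0, 0; rewrite scale0r addr0 mul0r; split => //; case: subY.
  - move=> r u s v t [y1 [l1 [Y1 [-> ->]]]] [y2 [l2 [Y2 [-> ->]]]].
    exists (r%:C *: y1 + y2), (r%:C * l1 + l2); split; first exact: subY.2.
    congr pair; last by rewrite !ReImE /=; ring.
    by rewrite scalerDr scalerDl scalerA addrACA.
  - move=> v t [y [l [Yy [-> ->]]]]; have Dy := YD _ Yy.
    split; first by rewrite addrC; apply: subD.2.
    have [->|l0] := eqVneq l 0.
      by rewrite mul0r scale0r addr0; exact: seminorm_ge0.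
    have -> : y + l *: w = l *: (w - (- l^-1 *: y)).
      by rewrite scalerBr scalerA mulrN mulfV // scaleN1r opprK addrC.
    have Yly := subspaceZ (- l^-1) subY Yy.
    rewrite pZ; last by apply: subspaceB => //; exact: YD.
    apply: le_trans (_ : cabs l * d <= _).
      by rewrite ler_wpM2r ?(ltW d0) // Re_cabs.
    by rewrite ler_wpM2l ?rnorm_ge0 // dY.
have [G [gG G0G Gtot]] := dominated_graph_total gG0.
have [G00 GL Gp] := gG.
have Guniq v s t : G (v, s) -> G (v, t) -> s = t.
  suff h a b : G (v, a) -> G (v, b) -> a <= b.
    by move=> Gs Gt; apply/eqP; rewrite eq_le !h.
  move=> Ga Gb; have := GL (-1) _ _ _ _ Gb Ga.
  rewrite rmorphN /= scaleN1r addNr => /Gp[_]; rewrite seminorm0; lra.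
pose h v := xget 0 [set t | G (v, t)].
have hP v : D v -> G (v, h v).
  by move=> /Gtot[t Gt]; rewrite /h; apply: (@xgetPex _ 0 [set t | G (v, t)]); exists t.
have hL r u v : D u -> D v -> h (r%:C *: u + v) = r * h u + h v.
  move=> Du Dv; apply: Guniq (hP _ _) _; first by apply: subD.2.
  by apply: GL; exact: hP.
have hp u : D u -> h u <= p u by move=> Du; case: (Gp _ _ (hP _ Du)).
have h0E y l : Y y -> h (y + l *: w) = complex.Re l * d.
  move=> Yy; apply: Guniq (hP _ _) _.
    by rewrite addrC; apply: subD.2 => //; exact: YD.
  by apply: G0G; exists y, l.
have hD u v : D u -> D v -> h (u + v) = h u + h v.
  by move=> Du Dv; have := hL 1 _ _ Du Dv; rewrite scale1r mul1r.
have hZ r u : D u -> h (r%:C *: u) = r * h u.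
  move=> Du; have := hL r _ _ Du subD.1; rewrite !addr0.
  suff -> : h 0 = 0 by rewrite addr0.
  by apply: Guniq G00; exact/hP/subD.1.
have DZ a u : D u -> D (a *: u) by exact: subspaceZ.
pose g0 v : C := (h v)%:C - 'i * (h ('i *: v))%:C.
have g0D u v : D u -> D v -> g0 (u + v) = g0 u + g0 v.
  move=> Du Dv; rewrite /g0 scalerDr !hD; try by [|exact: DZ].
  by rewrite !rmorphD /=; ring.
have g0R (r : R) u : D u -> g0 (r%:C *: u) = r%:C * g0 u.
  move=> Du; rewrite /g0 scalerA ['i * r%:C]mulrC -scalerA !hZ; try by [|exact: DZ].
  by rewrite !rmorphM /=; ring.
have hN u : D u -> h (- u) = - h u.
  by move=> Du; have := hZ (-1) _ Du; rewrite rmorphN scaleN1r mulN1r.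
have g0i u : D u -> g0 ('i *: u) = 'i * g0 u.
  move=> Du; rewrite /g0 scalerA -expr2 sqr_i scaleN1r hN // rmorphN /=.
  by rewrite mulrBr mulrA -expr2 sqr_i mulN1r mulrN !opprK addrC.
have g0Z a u : D u -> g0 (a *: u) = a * g0 u.
  move=> Du; have Diu := DZ 'i u Du.
  rewrite [a]complexE scalerDl ['i * _]mulrC -scalerA.
  rewrite g0D; try by [|exact: DZ].
  by rewrite !g0R // g0i //; ring.
(* After multiplication by a unit scalar the value at [u] is real, hence a value
   of [h]. *)
have g0p u : D u -> cabs (g0 u) <= p u.
  move=> Du; have [->|z0] := eqVneq (g0 u) 0; first by rewrite rnorm0 seminorm_ge0.
  pose th := (cabs (g0 u))^-1%:C * (g0 u)^*%C.
  have az0 : 0 < cabs (g0 u) by apply: rnorm_gt0; apply/eqP.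
  have cth : cabs th = 1.
    rewrite cabsM cabs_conj cabsR gtr0_norm ?invr_gt0 // mulVf //.
    by rewrite gt_eqF.
  rewrite -[p u]mul1r -cth -pZ //.
  suff -> : cabs (g0 u) = h (th *: u) by apply: hp; exact: DZ.
  have -> : h (th *: u) = complex.Re (g0 (th *: u)).
    by rewrite /g0 !ReImE /=; ring.
  rewrite g0Z // /th -mulrA [_^*%C * _]mulrC -cabs_mulJ.
  by rewrite -rmorphM /= expr2 mulKf // gt_eqF.
have YZ a y : Y y -> Y (a *: y) by exact: subspaceZ.
have hY y : Y y -> h y = 0.
  by move=> Yy; have := h0E y 0 Yy; rewrite scale0r addr0 mul0r.
have hw l : h (l *: w) = complex.Re l * d.
  by rewrite -[_ *: w]add0r h0E //; case: subY.
exists (fun v => d^-1%:C * g0 v); split.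
- move=> a u v Du Dv; have Dau := DZ a u Du.
  by rewrite g0D // g0Z //; ring.
- move=> u Du; rewrite cabsM cabsR gtr0_norm ?invr_gt0 // mulrA mulfV ?gt_eqF //.
  by rewrite mul1r g0p.
- by move=> y Yy; have Yiy := YZ 'i y Yy; rewrite /g0 !hY // mulr0 subr0 mulr0.
- rewrite /g0 hw -[h w]/(h w) -[X in h X]scale1r hw /= mul0r mulr0 subr0 mul1r.
  by rewrite -rmorphM /= mulVf // gt_eqF.
Qed.

End HahnBanach.

Section DualSpace.
Variables (R : realType) (X : normedModType R[i]).
Local Notation C := R[i].

Lemma dual_subspace : linear_subspace (@dual R X).
Proof.
split.
  apply/bounded_operatorsP; split.
    move=> a u v; rewrite -[LHS]/(0 : C^o) -[RHS]/(a *: (0 : C^o) + 0).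
    by rewrite scaler0 addr0.
  by exists 0 => // x; rewrite mul0r rnorm0.
move=> c f g /bounded_operatorsP[lf [k k0 fk]] /bounded_operatorsP[lg [l l0 gl]].
apply/bounded_operatorsP; split.
  move=> a u v; rewrite -[LHS]/(c *: f (a *: u + v) + g (a *: u + v)).
  rewrite -[RHS]/(a *: (c *: f u + g u) + (c *: f v + g v)).
  rewrite lf lg !scalerDr !scalerA [a * c]mulrC -!addrA; congr (_ + _).
  by rewrite addrCA.
exists (cabs c * k + l); first by rewrite addr_ge0 ?mulr_ge0 ?rnorm_ge0.
move=> x; apply: le_trans (rnormD _ _) _; rewrite mulrDl lerD //.
by rewrite rnormZ -mulrA ler_wpM2l ?rnorm_ge0.
Qed.

Lemma dual_separation (Y : set X) (w : X) (d : R) :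
  linear_subspace Y -> 0 < d -> (forall y, Y y -> d <= rnorm (w - y)) ->
  exists f : X -> C^o, [/\ dual f, forall x, d * cabs (f x) <= rnorm x,
    forall y, Y y -> f y = 0 & f w = 1].
Proof.
move=> sY d0 dY.
have sT : linear_subspace [set: X] by split.
have nD (u v : X) : setT u -> setT v -> rnorm (u + v) <= rnorm u + rnorm v.
  by move=> _ _; exact: rnormD.
have nZ a (u : X) : setT u -> rnorm (a *: u) = cabs a * rnorm u.
  by move=> _; exact: rnormZ.
have [//|//|//|//|g [gL gp gY gw]] :=
    @hahn_banach_separation R X setT (@rnorm R X) sT nD nZ Y w d sY.
exists g; split => //; last by move=> x; exact: gp.
apply/bounded_operatorsP; split; first by move=> a u v; rewrite gL.
exists d^-1; first by rewrite invr_ge0 ltW.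
by move=> x; rewrite mulrC ler_pdivlMr // mulrC; exact: gp.
Qed.

End DualSpace.

(** * Semidefinite forms and the Riesz lemma *)

Lemma complex_ge0P (R : realType) (z : R[i]) :
  (0 <= z) <-> (complex.Im z = 0 /\ 0 <= complex.Re z).
Proof.
by rewrite lecE /=; split => [/andP[/eqP -> ->]|[-> ->]]; rewrite ?eqxx.
Qed.

(** At [s = 1 / be] the hypothesis is the conclusion; for [be = 0] a large [s]
    violates it unless [n = 0]. *)
Lemma quadratic_ge0 (R : realType) (al be n : R) : 0 <= n -> 0 <= be ->
  (forall s : R, 0 <= n * be * s ^+ 2 - 2 * n * s + al) -> n <= al * be.
Proof.
move=> n0; rewrite le_eqVlt => /predU1P[<-|be0] H.
  rewrite mulr0; apply: contrapT => /negP; rewrite -ltNge => n1.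
  have := H ((al + 1) / n).
  have -> : n * 0 * ((al + 1) / n) ^+ 2 - 2 * n * ((al + 1) / n) + al
     = - al - 2 by field; rewrite gt_eqF.
  have := H 0; rewrite expr0n mulr0 mulr0; lra.
have := H be^-1.
have -> : n * be * be^-1 ^+ 2 - 2 * n * be^-1 + al
     = (al * be - n) / be by field; rewrite gt_eqF.
by rewrite pmulr_lge0 ?invr_gt0 // subr_ge0.
Qed.

Section SemidefiniteForms.
Variables (R : realType) (V : lmodType R[i]) (D : set V) (B : V -> V -> R[i]).
Local Notation C := R[i].
Hypothesis subD : linear_subspace D.
Hypothesis Bl : forall a u v w, D u -> D v -> D w ->
  B (a *: u + v) w = a * B u w + B v w.
Hypothesis Br : forall a u v w, D u -> D v -> D w ->
  B w (a *: u + v) = (a^*)%C * B w u + B w v.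
Hypothesis B0 : forall u, D u -> 0 <= B u u.

(** Polarisation: the values of the form at [u + v] and [i u + v] are real. *)
Lemma semidefiniteJ u v : D u -> D v -> B v u = (B u v)^*%C.
Proof.
move=> Du Dv.
have DP a : D (a *: u + v) by apply: subD.2.
have E a : B (a *: u + v) (a *: u + v) =
   a * (a^*)%C * B u u + a * B u v + (a^*)%C * B v u + B v v.
  by rewrite Bl // !Br //; ring.
have /complex_ge0P[+ _] := B0 (DP 1); rewrite E; have /complex_ge0P[+ _] := B0 (DP 'i); rewrite E.
have /complex_ge0P[iu _] := B0 Du; have /complex_ge0P[iv _] := B0 Dv.
rewrite !ReImE /=. move=> h1 h2; apply: complex_ext; rewrite !ReImE; lra.
Qed.

(** The form may be degenerate, and defined on a subspace only: besides inner
    products, this is meant for [(x, y) |-> <a x, y>] with [a] a positive operator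
    and for [(a, b) |-> phi (adj b a)] with [phi] a positive functional. *)
Lemma semidefinite_CS u v : D u -> D v ->
  cabs (B u v) ^+ 2 <= complex.Re (B u u) * complex.Re (B v v).
Proof.
move=> Du Dv.
have /complex_ge0P[iu ru] := B0 Du; have /complex_ge0P[iv rv] := B0 Dv.
apply: quadratic_ge0 => //; first by rewrite sqr_ge0.
move=> s; pose a : C := - s%:C * B u v.
have Da : D (a *: v + u) by apply: subD.2.
have /complex_ge0P[_] := B0 Da.
rewrite Bl // !Br // (semidefiniteJ Du Dv) cabs_sqr /a !ReImE /= iv => h.
by apply: le_trans h _; rewrite le_eqVlt; apply/orP; left; apply/eqP; ring.
Qed.

End SemidefiniteForms.

Section Hilbert.
Variables (R : realType) (H : completeNormedModType R[i]).
Local Notation C := R[i].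
Variable ip : {dot H for conjC}.
Hypothesis hip : hilbert_inner_product ip.

Lemma ipDl x y z : ip (x + y) z = ip x z + ip y z.
Proof. by rewrite linearDl. Qed.
Lemma ipDr x y z : ip z (x + y) = ip z x + ip z y.
Proof. by rewrite linearDr. Qed.
Lemma ipZl a x z : ip (a *: x) z = a * ip x z.
Proof. by rewrite linearZl_LR. Qed.
Lemma ipZr a x z : ip z (a *: x) = (a^*)%C * ip z x.
Proof. by rewrite linearZr_LR. Qed.
Lemma ipNl x z : ip (- x) z = - ip x z.
Proof. by rewrite linearNl. Qed.
Lemma ipNr x z : ip z (- x) = - ip z x.
Proof. by rewrite linearNr. Qed.
Lemma ipBl x y z : ip (x - y) z = ip x z - ip y z.
Proof. by rewrite ipDl ipNl. Qed.
Lemma ipBr x y z : ip z (x - y) = ip z x - ip z y.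
Proof. by rewrite ipDr ipNr. Qed.
Lemma ip0l z : ip 0 z = 0.
Proof. by rewrite linear0l. Qed.
Lemma ip0r z : ip z 0 = 0.
Proof. by rewrite linear0r. Qed.
Lemma ipC x y : ip x y = (ip y x)^*%C.
Proof. by rewrite hermC /= expr0 mul1r. Qed.
Lemma ipxx x : ip x x = (rnorm x ^+ 2)%:C.
Proof. by rewrite hip rmorphXn /= rnormE. Qed.

Lemma ip_ge0 x : 0 <= ip x x.
Proof. by rewrite ipxx ler0c sqr_ge0. Qed.

Definition ipE := (ipDl, ipDr, ipZl, ipZr, ipNl, ipNr).

Lemma rnormD2 x y :
  rnorm (x + y) ^+ 2 = rnorm x ^+ 2 + rnorm y ^+ 2 + 2 * complex.Re (ip x y).
Proof.
have := ipxx (x + y); rewrite !ipE !ipxx (ipC y x) => /(congr1 (@complex.Re _)).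
by rewrite !ReImE /= => <-; ring.
Qed.

Lemma rnormB2 x y :
  rnorm (x - y) ^+ 2 = rnorm x ^+ 2 + rnorm y ^+ 2 - 2 * complex.Re (ip x y).
Proof. by rewrite rnormD2 rnormN ipNr ReN mulrN. Qed.

Lemma rnorm2E x : rnorm x ^+ 2 = complex.Re (ip x x).
Proof. by rewrite ipxx. Qed.

Lemma cauchy_schwarz x y : cabs (ip x y) <= rnorm x * rnorm y.
Proof.
rewrite -(@ler_pXn2r _ 2) ?nnegrE ?mulr_ge0 ?rnorm_ge0 // exprMn !rnorm2E.
apply: (@semidefinite_CS _ _ setT) => // *; first [exact: ip_ge0|by rewrite !ipE].
Qed.

Lemma ip_eq0 x : (forall y, ip x y = 0) -> x = 0.
Proof.
move=> /(_ x)/eqP; rewrite hip expf_eq0 /= normr_eq0; exact/eqP.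
Qed.

(** [eta] is the limit of [T u] along the near minimisers of
    [|T u|^2 - 2 Re (L u)], which form a Cauchy filter by the parallelogram law.
    With [T = id] this is both the projection theorem and the representation of
    bounded functionals; for other [T], [L] need not be read as a functional on
    the range of [T]. *)
Theorem riesz_variational (V : lmodType C) (D : set V) (T : V -> H)
    (L : V -> C) (k : R) :
  linear_subspace D ->
  (forall a u v, D u -> D v -> T (a *: u + v) = a *: T u + T v) ->
  (forall a u v, D u -> D v -> L (a *: u + v) = a * L u + L v) ->
  (forall u, D u -> cabs (L u) <= k * rnorm (T u)) ->
  exists eta, (forall e : R, 0 < e -> exists2 u, D u & rnorm (T u - eta) < e) /\
    forall u, D u -> L u = ip (T u) eta.
Proof.
move=> subD TL LL Lk.
pose q u := rnorm (T u) ^+ 2 - 2 * complex.Re (L u).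
pose E := [set x : R | exists2 u, D u & x = - q u].
have supE : has_sup E.
  split; first by exists (- q 0), 0 => //; case: subD.
  exists (k ^+ 2) => _ [u Du ->].
  have h : complex.Re (L u) <= k * rnorm (T u) := le_trans (Re_cabs _) (Lk _ Du).
  have := sqr_ge0 (rnorm (T u) - k); rewrite /q; lra.
pose S := sup E.
have qS u : D u -> - q u <= S.
  by move=> Du; apply: sup_upper_bound => //; exists u.
pose F := filter_from [set e : R | 0 < e] (fun e => [set u | D u /\ S - e < - q u]).
have PF : ProperFilter F.
  apply: filter_from_proper.
    apply: filter_from_filter; first by exists 1 => /=.
    move=> e1 e2 /= e10 e20; exists (Num.min e1 e2).
      by rewrite /= lt_min e10.
    move=> u [Du Su]; have m1 := ge_min e1 e1 e2; have m2 := ge_min e2 e1 e2.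
    rewrite !lexx orbT /= in m1 m2.
    by split; split => //; apply: le_lt_trans Su; rewrite lerB.
  move=> e /= e0; have [x [u Du ->] Sx] := sup_adherent e0 supE.
  by exists u.
have [eta Heta] : exists eta, forall e : R, 0 < e -> F [set u | rnorm (T u - eta) < e].
  apply: complete_filter => e e0.
  have d0 : 0 < e ^+ 2 / 8 by rewrite divr_gt0 ?exprn_gt0.
  exists [set u | D u /\ S - e ^+ 2 / 8 < - q u]; split.
    by exists (e ^+ 2 / 8).
  move=> u v [Du Su] [Dv Sv].
  rewrite -(@ltr_pXn2r _ 2) ?nnegrE ?rnorm_ge0 ?ltW //.
  pose w := (2^-1)%:C *: u + (2^-1)%:C *: v.
  have Dw : D w by apply: subD.2 => //; exact: subspaceZ.
  have := qS _ Dw; move: Su Sv; rewrite /q /w.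
  have TZ a x : D x -> T (a *: x) = a *: T x.
    move=> Dx; have := TL a _ _ Dx subD.1; rewrite addr0 => ->.
    have := TL (-1) _ _ subD.1 subD.1; rewrite scaler0 addr0 scaleN1r addNr => ->.
    by rewrite addr0.
  have LZ a x : D x -> L (a *: x) = a * L x.
    move=> Dx; have := LL a _ _ Dx subD.1; rewrite addr0 => ->.
    have := LL (-1) _ _ subD.1 subD.1; rewrite scaler0 addr0 mulN1r addNr => ->.
    by rewrite addr0.
  have Dv' := subspaceZ (2^-1)%:C subD Dv.
  rewrite TL // LL // TZ // LZ // rnormD2 rnormB2 !rnormZ !ipE !ReImE /= !cabsR.
  rewrite gtr0_norm ?invr_gt0 //; lra.
exists eta; split.
  have FD : F D by exists 1 => //= u [].
  by move=> e e0; have [u [? Du]] := filter_ex (filterI (Heta e e0) FD); exists u.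
move=> c Dc; pose z := ip (T c) eta - L c.
suff z0 : cabs z ^+ 2 <= 0 * rnorm (T c) ^+ 2.
  apply/eqP; rewrite eq_sym -subr_eq0; apply/eqP; apply: (@rnorm_eq0 _ C^o).
  by apply/eqP; rewrite -sqrf_eq0 eq_le sqr_ge0 andbT; move: z0; rewrite mul0r.
apply: quadratic_ge0; rewrite ?sqr_ge0 // => s; rewrite addr0.
apply/ler_addgt0Pr => d d0.
pose K := `|s| * cabs z * rnorm (T c) + 1.
have K0 : 0 < K by rewrite ltr_wpDl // !mulr_ge0 ?rnorm_ge0.
have e0 : 0 < d / (4 * K) by rewrite divr_gt0 // mulr_gt0.
have d20 : 0 < d / 2 by rewrite divr_gt0.
have FS : F [set u | D u /\ S - d / 2 < - q u] by exists (d / 2).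
have [b [/= be [Db bS]]] := filter_ex (filterI (Heta _ e0) FS).
pose a : C := - s%:C * (z^*)%C.
have Dab : D (a *: c + b) by apply: subD.2.
have := qS _ Dab; move: bS; rewrite /q TL // LL // rnormD2 rnormZ exprMn !ipE !ReD.
have -> : ip (T c) (T b) = z + L c + ip (T c) (T b - eta).
  rewrite ipBr /z; ring.
have -> : cabs a ^+ 2 = s ^+ 2 * cabs z ^+ 2.
  by rewrite cabsM cabs_conj exprMn -rmorphN cabsR normrN real_normK ?num_real.
rewrite (mulrDr a (z + L c)) (mulrDr a z) !ReD.
have -> : complex.Re (a * z) = - s * cabs z ^+ 2.
  rewrite /a -mulrA [_^*%C * _]mulrC -cabs_mulJ -rmorphN -rmorphM //=.
have : complex.Re (a * ip (T c) (T b - eta)) <= d / 4.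
  apply: le_trans (Re_cabs _) _; rewrite cabsM.
  apply: le_trans (_ : cabs a * (rnorm (T c) * (d / (4 * K))) <= _).
    rewrite ler_wpM2l ?rnorm_ge0 //; apply: le_trans (cauchy_schwarz _ _) _.
    by rewrite ler_wpM2l ?rnorm_ge0 // ltW.
  rewrite cabsM cabs_conj -rmorphN cabsR normrN.
  have -> : `|s| * cabs z * (rnorm (T c) * (d / (4 * K))) =
      (`|s| * cabs z * rnorm (T c)) / K * (d / 4) by field; rewrite gt_eqF.
  rewrite ler_piMl ?divr_ge0 ?(ltW d0) // ler_pdivrMr // mul1r /K; lra.
lra.
Qed.

End Hilbert.

(** * Projections, adjoints and order intervals *)

Section Spans.
Variables (K : pzRingType) (V : lmodType K).

Lemma linear_span_subspace (A : set V) : linear_subspace (linear_span A).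
Proof.
split; first by move=> B [[]].
by move=> a u v Au Av B [sB AB]; apply: sB.2; [apply: Au|apply: Av].
Qed.

Lemma sub_linear_span (A : set V) : A `<=` linear_span A.
Proof. by move=> x Ax B [_]; apply. Qed.

Lemma linear_span_min (A B : set V) :
  linear_subspace B -> A `<=` B -> linear_span A `<=` B.
Proof. by move=> sB AB x; apply. Qed.

Lemma linear_span_mono (A B : set V) :
  A `<=` B -> linear_span A `<=` linear_span B.
Proof.
move=> AB; apply: linear_span_min; first exact: linear_span_subspace.
exact: subset_trans (@sub_linear_span B).
Qed.

End Spans.

Lemma ler_of_sqr (R : realType) (a b k : R) : 0 <= a -> 0 <= k ->
  a ^+ 2 <= k * a * b -> 0 <= b -> a <= k * b.
Proof.
rewrite le_eqVlt => /predU1P[<-|a0] k0 + b0; first by rewrite mulr_ge0.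
by rewrite expr2 mulrAC ler_pM2r.
Qed.

Section HilbertGeometry.
Variables (R : realType) (H : completeNormedModType R[i]).
Local Notation C := R[i].
Variable ip : {dot H for conjC}.
Hypothesis hip : hilbert_inner_product ip.
Let ipE := (ipE ip).

Lemma subspace_setT : linear_subspace [set: H].
Proof. by split. Qed.

Lemma closure_subspace (E : set H) :
  linear_subspace E -> linear_subspace (closure E).
Proof.
move=> sE; split; first by apply: subset_closure; case: sE.
move=> a u v /closure_rnormP Eu /closure_rnormP Ev; apply/closure_rnormP => e e0.
have a1 : 0 < cabs a + 1 by rewrite ltr_wpDl // rnorm_ge0.
have [u' Eu' u'e] := Eu (e / 2 / (cabs a + 1)) ltac:(by rewrite !divr_gt0).
have [v' Ev' v'e] := Ev (e / 2) ltac:(by rewrite divr_gt0).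
exists (a *: u' + v'); first by apply: sE.2.
rewrite opprD addrACA -scalerBr; apply: le_lt_trans (rnormD _ _) _.
rewrite rnormZ [X in _ < X](_ : e = e / 2 + e / 2); last by field.
apply: ler_ltD => //; apply: le_trans (_ : (cabs a + 1) * rnorm (u - u') <= _).
  by rewrite ler_wpM2r ?rnorm_ge0 // lerDl.
by rewrite mulrC -ler_pdivlMr // ltW.
Qed.

Lemma orth_closure_span (E : set H) x : (forall z, E z -> ip x z = 0) ->
  forall y, closure (linear_span E) y -> ip x y = 0.
Proof.
move=> xE y /closure_rnormP Ey.
have xS z : linear_span E z -> ip x z = 0.
  apply: (linear_span_min (B := [set z | ip x z = 0])) => //; split; first by rewrite /= ip0r.
  by move=> a u v /= xu xv; rewrite !ipE xu xv mulr0 addr0.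
apply: (@rnorm_eq0 _ C^o); apply/eqP; rewrite eq_le rnorm_ge0 andbT.
apply/ler_addgt0Pr => e e0; rewrite add0r.
have x1 : 0 < rnorm x + 1 by rewrite ltr_wpDl // rnorm_ge0.
have [z Ez ze] := Ey (e / (rnorm x + 1)) ltac:(by rewrite divr_gt0).
rewrite -[ip x y]subr0 -(xS _ Ez) -ipBr.
apply: le_trans (cauchy_schwarz hip _ _) _.
apply: le_trans (_ : (rnorm x + 1) * rnorm (y - z) <= _).
  by rewrite ler_wpM2r ?rnorm_ge0 // lerDl.
by rewrite mulrC -ler_pdivlMr // ltW.
Qed.

(** [E] need not be a subspace: this is the projection onto its closed linear
    span. *)
Definition proj (E : set H) (x : H) : H :=
  xget 0 [set y | closure (linear_span E) y /\ forall z, E z -> ip (x - y) z = 0].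

Lemma projP E x : closure (linear_span E) (proj E x) /\
  forall z, E z -> ip (x - proj E x) z = 0.
Proof.
rewrite /proj; apply: (@xgetPex _ 0 [set y | closure (linear_span E) y /\
  forall z, E z -> ip (x - y) z = 0]).
have sE := linear_span_subspace E.
have [||u Eu|y [yE yip]] := @riesz_variational _ _ ip hip H (linear_span E) id
  (fun z => ip z x) (rnorm x) sE.
- by [].
- by move=> a u v _ _; rewrite !ipE.
- by rewrite mulrC cauchy_schwarz.
exists y; split.
  apply/closure_rnormP => e /yE[u Eu ue]; exists u => //.
  by rewrite rnormBC.
move=> z /sub_linear_span Ez; rewrite ipC ipBr -yip // subrr.
exact: conjc0.
Qed.

Lemma proj_in E x : closure (linear_span E) (proj E x).
Proof. by case: (projP E x). Qed.

Lemma proj_orth E x z : closure (linear_span E) z -> ip (x - proj E x) z = 0.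
Proof. by apply: orth_closure_span; case: (projP E x). Qed.

Lemma proj_uniq E x y : closure (linear_span E) y ->
  (forall z, E z -> ip (x - y) z = 0) -> proj E x = y.
Proof.
move=> Ey yE; apply/eqP; rewrite -subr_eq0; apply/eqP.
have sE := closure_subspace (linear_span_subspace E).
have Ed : closure (linear_span E) (proj E x - y).
  exact: (subspaceB sE (@proj_in E x) Ey).
apply: rnorm_eq0; apply/eqP; rewrite -sqrf_eq0 (rnorm2E hip).
suff -> : ip (proj E x - y) (proj E x - y) = 0 by [].
have h1 := proj_orth x Ed; have h2 := orth_closure_span yE Ed.
transitivity (ip (x - y) (proj E x - y) - ip (x - proj E x) (proj E x - y)).
  by rewrite -ipBl; congr (ip _ _); rewrite opprB [RHS]addrC subrKA.
by rewrite h1 h2 subrr.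
Qed.

Lemma proj_id E x : closure (linear_span E) x -> proj E x = x.
Proof. by move=> Ex; apply: proj_uniq => // z _; rewrite subrr ip0l. Qed.

Lemma proj_eq0 E x : (forall z, E z -> ip x z = 0) -> proj E x = 0.
Proof.
move=> xE; apply: proj_uniq => [|z Ez]; last by rewrite subr0 xE.
by apply: subset_closure; exact: (linear_span_subspace E).1.
Qed.

Lemma proj_linear E : linear (proj E).
Proof.
move=> a u v; apply: proj_uniq.
  have cE := closure_subspace (linear_span_subspace E).
  by apply: cE.2; exact: proj_in.
move=> z Ez; have -> : a *: u + v - (a *: proj E u + proj E v) =
    a *: (u - proj E u) + (v - proj E v).
  by rewrite scalerBr opprD addrACA.
by rewrite ipDl ipZl (projP E u).2 // (projP E v).2 // mulr0 addr0.
Qed.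

Lemma proj_selfadjoint E : adjoint_pair ip (proj E) (proj E).
Proof.
move=> x y.
have h1 := proj_orth y (@proj_in E x); have h2 := proj_orth x (@proj_in E y).
move: h2; rewrite ipBl => /eqP; rewrite subr_eq0 => /eqP ->.
move: h1; rewrite ipBl => /eqP; rewrite subr_eq0 => /eqP h1.
by rewrite ipC h1 -ipC.
Qed.

Lemma proj_pythagoras E x y : closure (linear_span E) y ->
  rnorm (x - y) ^+ 2 = rnorm (x - proj E x) ^+ 2 + rnorm (proj E x - y) ^+ 2.
Proof.
move=> Ey; rewrite -[x - y](subrKA (proj E x)) (rnormD2 hip) proj_orth ?mulr0 ?addr0 //.
exact: (subspaceB (closure_subspace (linear_span_subspace E)) (@proj_in E x) Ey).
Qed.

Lemma proj_best E x y : closure (linear_span E) y ->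
  rnorm (x - proj E x) <= rnorm (x - y).
Proof.
move=> /proj_pythagoras h; rewrite -(@ler_pXn2r _ 2) ?nnegrE ?rnorm_ge0 // h.
by rewrite lerDl sqr_ge0.
Qed.

Lemma proj_contraction E : bounded_by (proj E) 1.
Proof.
move=> x; rewrite mul1r -(@ler_pXn2r _ 2) ?nnegrE ?rnorm_ge0 //.
have := @proj_pythagoras E x 0; rewrite !subr0 => ->; last first.
  by apply: subset_closure; exact: (linear_span_subspace E).1.
by rewrite lerDr sqr_ge0.
Qed.

Lemma proj_bounded_operator E : bounded_operators (proj E).
Proof.
apply/bounded_operatorsP; split; first exact: proj_linear.
by exists 1 => //; exact: proj_contraction.
Qed.

Lemma bounded_operator_closure (a : H -> H) (E F : set H) :
  bounded_operators a -> (forall x, E x -> F (a x)) ->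
  forall x, closure E x -> closure F (a x).
Proof.
move=> /bounded_operatorsP[la [k k0 ak]] aE x /closure_rnormP Ex.
apply/closure_rnormP => e e0.
have k1 : 0 < k + 1 by rewrite ltr_wpDl.
have [y Ey ye] := Ex (e / (k + 1)) ltac:(by rewrite divr_gt0).
exists (a y); first exact: aE.
rewrite -(linB la); apply: le_lt_trans (ak _) _.
apply: le_lt_trans (_ : (k + 1) * rnorm (x - y) < _).
  by rewrite ler_wpM2r ?rnorm_ge0 // lerDl.
by rewrite mulrC -ltr_pdivlMr.
Qed.

Lemma linear_span_image (a : H -> H) (E F : set H) : linear a ->
  (forall x, E x -> linear_span F (a x)) ->
  forall x, linear_span E x -> linear_span F (a x).
Proof.
move=> la aE; apply: linear_span_min aE.
have [F0 FP] := linear_span_subspace F.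
split; first by rewrite /= lin0.
by move=> c u v /= Fu Fv; rewrite la; exact: FP.
Qed.

(** The closed span of [E] and its orthogonal complement are invariant under [a]. *)
Lemma proj_commute (a b : H -> H) (E : set H) : bounded_operators a ->
  adjoint_pair ip a b -> (forall x, E x -> linear_span E (a x)) ->
  (forall x, E x -> linear_span E (b x)) -> a \o proj E = proj E \o a.
Proof.
move=> ba ab aE bE; apply/funext => x /=; apply/esym/proj_uniq.
  apply: (bounded_operator_closure ba _ (@proj_in E x)).
  by apply: linear_span_image => //; exact: ba.1.
move=> z Ez; rewrite -(linB ba.1) ab; apply: proj_orth.
by apply: subset_closure; exact: bE.
Qed.

Lemma adjoint_exists (a : H -> H) : bounded_operators a ->
  exists b, bounded_operators b /\ adjoint_pair ip a b.
Proof.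
move=> /bounded_operatorsP[la [k k0 ak]].
have riesz y : exists z, forall x, ip (a x) y = ip x z.
  have [||u _|z [_ zE]] := @riesz_variational _ _ ip hip H setT id
    (fun x => ip (a x) y) (k * rnorm y) subspace_setT.
  - by [].
  - by move=> c u v _ _ /=; rewrite la !ipE.
  - apply: le_trans (cauchy_schwarz hip _ _) _.
    by rewrite mulrAC ler_wpM2r ?rnorm_ge0.
  by exists z => x; rewrite zE.
have [b ab] := choice riesz.
exists b; split; last by move=> x y; rewrite ab.
apply/bounded_operatorsP; split.
  move=> c u v; apply/eqP; rewrite -subr_eq0; apply/eqP; apply: (ip_eq0 hip) => y.
  rewrite ipC ipBr ipDr ipZr -!ab ipDr ipZr subrr; exact: conjc0.
exists k => // y; apply: (@ler_of_sqr _ _ _ k) => //; rewrite ?rnorm_ge0 //.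
rewrite (rnorm2E hip) -ab; apply: le_trans (Re_cabs _) _.
apply: le_trans (cauchy_schwarz hip _ _) _.
by rewrite ler_wpM2r ?rnorm_ge0.
Qed.

Lemma adjoint_pairC (a b : H -> H) : adjoint_pair ip a b -> adjoint_pair ip b a.
Proof. by move=> ab x y; rewrite ipC -ab -ipC. Qed.

Definition adj (a : H -> H) : H -> H :=
  xget a [set b | bounded_operators b /\ adjoint_pair ip a b].

Lemma adjP a : bounded_operators a ->
  bounded_operators (adj a) /\ adjoint_pair ip a (adj a).
Proof.
by move=> /adjoint_exists[b hb]; rewrite /adj;
  apply: (@xgetPex _ a [set b | bounded_operators b /\ adjoint_pair ip a b]); exists b.
Qed.

Lemma adj_bounded_by a k : bounded_operators a -> 0 <= k -> bounded_by a k ->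
  bounded_by (adj a) k.
Proof.
move=> ba k0 ak y; have [_ ab] := adjP ba.
apply: (@ler_of_sqr _ _ _ k) => //; rewrite ?rnorm_ge0 //.
rewrite (rnorm2E hip) -ab; apply: le_trans (Re_cabs _) _.
apply: le_trans (cauchy_schwarz hip _ _) _.
by rewrite ler_wpM2r ?rnorm_ge0.
Qed.

(** The operators between 0 and [k] times the identity, as quadratic forms; the
    linear ones are self-adjoint. *)
Definition op_interval (k : R) (a : H -> H) :=
  forall x, 0 <= ip (a x) x /\ complex.Re (ip (a x) x) <= k * rnorm x ^+ 2.

Lemma op_interval_CS k a x y : linear a -> op_interval k a ->
  ip (a y) x = (ip (a x) y)^*%C /\ cabs (ip (a x) y) ^+ 2 <=
    complex.Re (ip (a x) x) * complex.Re (ip (a y) y).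
Proof.
move=> la ia.
have Bl c u v w : setT u -> setT v -> setT w ->
    ip (a (c *: u + v)) w = c * ip (a u) w + ip (a v) w.
  by rewrite la !ipE.
have Br c u v w : setT u -> setT v -> setT w ->
    ip (a w) (c *: u + v) = (c^*)%C * ip (a w) u + ip (a w) v.
  by rewrite !ipE.
have B0 u : setT u -> 0 <= ip (a u) u by case: (ia u).
split; first exact: (semidefiniteJ subspace_setT Bl Br B0).
exact: (semidefinite_CS subspace_setT Bl Br B0).
Qed.

Lemma op_interval_selfadjoint k a : linear a -> op_interval k a ->
  adjoint_pair ip a a.
Proof.
by move=> la ia x y; rewrite (ipC _ x); case: (op_interval_CS y x la ia).
Qed.

(** Cauchy-Schwarz for the form of [a], at [x] and [a x]. *)
Lemma op_interval_sqr k a x : linear a -> op_interval k a ->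
  rnorm (a x) ^+ 2 <= k * complex.Re (ip (a x) x).
Proof.
move=> la ia; have [ax0|ax0] := pselect (a x = 0).
  by rewrite ax0 rnorm0 expr0n ip0l mulr0.
have [_ h] := op_interval_CS x (a x) la ia.
have [_ h2] := ia (a x); have [/complex_ge0P[_ h1] _] := ia x.
have n0 : 0 < rnorm (a x) ^+ 2 by rewrite exprn_gt0 // rnorm_gt0.
move: h; rewrite (ipxx hip) cabsR ger0_norm ?sqr_ge0 // => h.
rewrite -(ler_pM2r n0) -expr2; apply: le_trans h _.
by rewrite -mulrA mulrCA ler_wpM2l.
Qed.

Lemma op_interval_bounded k a : 0 <= k -> linear a -> op_interval k a ->
  bounded_by a k.
Proof.
move=> k0 la ia x; rewrite -(@ler_pXn2r _ 2) ?nnegrE ?mulr_ge0 ?rnorm_ge0 //.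
apply: le_trans (op_interval_sqr x la ia) _; rewrite exprMn expr2 -mulrA.
by rewrite ler_wpM2l //; case: (ia x).
Qed.

(** Up to sign, the centres of the balls whose intersection is the order interval
    from 0 to [k]. *)
Definition shift (k n : R) : C := (- (k / 2)) +i* n.

Lemma cabs_shift (k n : R) : cabs (shift k n) ^+ 2 = k ^+ 2 / 4 + n ^+ 2.
Proof. by rewrite cabs_sqr /=; field. Qed.

Lemma rnorm_shift k n (a : H -> H) x :
  rnorm (a x + shift k n *: x) ^+ 2 = cabs (shift k n) ^+ 2 * rnorm x ^+ 2 +
   (rnorm (a x) ^+ 2 - k * complex.Re (ip (a x) x) + 2 * n * complex.Im (ip (a x) x)).
Proof. by rewrite (rnormD2 hip) rnormZ exprMn ipZr !ReImE /shift /=; field. Qed.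

Lemma affine_le0 (c d : R) : (forall n, c + n * d <= 0) -> d = 0 /\ c <= 0.
Proof.
move=> h; have d0 : d = 0.
  apply/eqP; apply: contrapT => /negP d0.
  have := h ((1 - c) / d); rewrite divfK //; lra.
by split => //; have := h 0; rewrite mul0r addr0.
Qed.

(** Expanding the square, the inequality for all [n] says that [<a x, x>] is real
    and that [|a x|^2 <= k <a x, x>]. Order intervals are thus intersections of
    balls, a property that any isometry with a dual space transports. *)
Lemma op_interval_normP k a : 0 <= k -> linear a -> op_interval k a <->
  forall n, bounded_by (fun x => a x + shift k n *: x) (cabs (shift k n)).
Proof.
move=> k0 la; split.
  move=> ia n x; rewrite -(@ler_pXn2r _ 2) ?nnegrE ?mulr_ge0 ?rnorm_ge0 //.
  rewrite rnorm_shift exprMn gerDl; have [/complex_ge0P[-> _] _] := ia x.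
  have := op_interval_sqr x la ia; lra.
move=> h x; have : forall n, rnorm (a x) ^+ 2 - k * complex.Re (ip (a x) x) +
    n * (2 * complex.Im (ip (a x) x)) <= 0.
  move=> n; have := h n x; rewrite -(@ler_pXn2r _ 2) ?nnegrE ?mulr_ge0 ?rnorm_ge0 //.
  by rewrite rnorm_shift exprMn gerDl; lra.
move=> /affine_le0[im0 h1].
have wax : `|complex.Re (ip (a x) x)| <= rnorm (a x) * rnorm x.
  by apply: le_trans (Re_le_cabs _) _; exact: cauchy_schwarz.
have [w0|w0] := leP 0 (complex.Re (ip (a x) x)); last first.
  have := sqr_ge0 (rnorm (a x)); have : k * complex.Re (ip (a x) x) <= 0.
    by rewrite mulr_ge0_le0 // ltW.
  move=> h2 h3; have ax0 : rnorm (a x) ^+ 2 = 0 by lra.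
  move: wax w0; have -> : rnorm (a x) = 0 by apply/eqP; rewrite -sqrf_eq0 ax0.
  by rewrite mul0r normr_le0 => /eqP ->; rewrite ltxx.
split; first by apply/complex_ge0P; split => //; lra.
have axk : rnorm (a x) <= k * rnorm x.
  apply: (@ler_of_sqr _ _ _ k) => //; rewrite ?rnorm_ge0 //.
  have : k * complex.Re (ip (a x) x) <= k * (rnorm (a x) * rnorm x).
    by rewrite ler_wpM2l // (le_trans (ler_norm _)).
  rewrite -mulrA; lra.
apply: le_trans (ler_norm _) _; apply: le_trans wax _.
by rewrite expr2 mulrA ler_wpM2r // rnorm_ge0.
Qed.

End HilbertGeometry.

(** * Bessel's inequality and orthogonal families *)

Lemma countable_subset (T : Type) (A B : set T) :
  A `<=` B -> countable B -> countable A.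
Proof. by move=> /subset_card_le; exact: sub_countable. Qed.

Lemma countable_image (T U : Type) (f : T -> U) (A : set T) :
  countable A -> countable (f @` A).
Proof. exact/sub_countable/card_image_le. Qed.

Lemma countable_bigcup_nat (T : Type) (F : nat -> set T) :
  (forall n, countable (F n)) -> countable (\bigcup_n F n).
Proof. by move=> cF; apply: bigcup_countable. Qed.

Lemma inv_succ_small (R : realType) (e : R) : 0 < e -> exists n, (n.+1%:R)^-1 < e :> R.
Proof.
move=> e0; exists (archi_bound e^-1).
rewrite -[X in _ < X]invrK ltf_pV2 ?posrE ?invr_gt0 //.
apply: lt_trans (archi_boundP _) _; first by rewrite invr_ge0 ltW.
by rewrite ltr_nat ltnS.
Qed.

Lemma inv_succ_gt0 (R : realType) (n : nat) : 0 < (n.+1%:R)^-1 :> R.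
Proof. by rewrite invr_gt0. Qed.

Section Families.
Variables (R : realType) (H : completeNormedModType R[i]).
Local Notation C := R[i].
Variable ip : {dot H for conjC}.
Hypothesis hip : hilbert_inner_product ip.
Let ipE := (ipE ip).

Section Bessel.
Variables (I : choiceType) (A : set I) (v : I -> H).
Hypothesis v1 : forall i, A i -> rnorm (v i) = 1.
Hypothesis vo : forall i j, A i -> A j -> i <> j -> ip (v i) (v j) = 0.

(** Subtracting the components one after the other lowers the squared norm by their
    squares. *)
Lemma bessel_seq (s : seq I) x : uniq s -> (forall i, i \in s -> A i) ->
  \sum_(i <- s) cabs (ip (v i) x) ^+ 2 <= rnorm x ^+ 2.
Proof.
suff h y : uniq s -> (forall i, i \in s -> A i) -> exists z,
    [/\ forall i, A i -> i \notin s -> ip z (v i) = ip y (v i) &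
    rnorm z ^+ 2 = rnorm y ^+ 2 - \sum_(i <- s) cabs (ip (v i) y) ^+ 2].
  move=> us sA; have [z [_ zE]] := h x us sA.
  by rewrite -subr_ge0 -zE sqr_ge0.
elim: s => [|i s IHs] /=; first by exists y; rewrite big_nil subr0.
move=> /andP[i_s us] sA.
have Ai : A i by apply: sA; rewrite mem_head.
have sA' j : j \in s -> A j by move=> js; apply: sA; rewrite inE js orbT.
have [z [zs zE]] := IHs us sA'.
exists (z - ip y (v i) *: v i); split.
  move=> j Aj; rewrite inE negb_or => /andP[/eqP ji js].
  rewrite ipBl ipZl zs // vo // ?mulr0 ?subr0 // => ij; exact: ji.
rewrite (rnormB2 hip) zE rnormZ v1 // mulr1 big_cons ipZr zs //.
rewrite [_^*%C * _]mulrC -cabs_mulJ /= [ip (v i) y]ipC cabs_conj; ring.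
Qed.

Lemma bessel_finite x (e : R) : 0 < e ->
  finite_set [set i | A i /\ e <= cabs (ip (v i) x)].
Proof.
move=> e0; apply: contrapT => infA.
pose n := archi_bound (rnorm x ^+ 2 / e ^+ 2).
have [B BA nB] := infinite_set_fset n infA.
have e20 : 0 < e ^+ 2 by rewrite exprn_gt0.
have := @bessel_seq (finmap.enum_fset B) x (finmap.fset_uniq B)
  (fun i iB => (BA i iB).1).
apply/negP; rewrite -ltNge.
apply: lt_le_trans (_ : n%:R * e ^+ 2 <= _).
  by rewrite -ltr_pdivrMr // archi_boundP // divr_ge0 // ?sqr_ge0 // ltW.
apply: le_trans (_ : \sum_(i <- finmap.enum_fset B) e ^+ 2 <= _).
  rewrite big_const_seq iter_addr addr0 count_predT.
  by rewrite -[leRHS]mulr_natl ler_wpM2r ?(ltW e20) // ler_nat.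
rewrite big_seq [leRHS]big_seq; apply: ler_sum => i iB.
rewrite ler_pXn2r ?nnegrE ?rnorm_ge0 ?(ltW e0) //.
by case: (BA i iB).
Qed.

Lemma bessel_countable x : countable [set i | A i /\ ip (v i) x <> 0].
Proof.
apply: (@countable_subset _ _
  (\bigcup_n [set i | A i /\ (n.+1%:R)^-1 <= cabs (ip (v i) x)])).
  move=> i [Ai ix]; have [n nx] := inv_succ_small (@rnorm_gt0 _ C^o _ ix).
  by exists n => //; split => //; exact: ltW.
apply: countable_bigcup_nat => n.
by apply/finite_set_countable/bessel_finite/inv_succ_gt0.
Qed.

End Bessel.

(** For [K] reduced to the identity this is orthonormality; for [K] the commutant of
    a von Neumann algebra it says that the cyclic projections of the members of [S]
    are mutually orthogonal. *)
Definition orbit_orthogonal (K : set (H -> H)) (S : set H) :=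
  (forall x, S x -> rnorm x = 1) /\
  (forall x y a, S x -> S y -> x <> y -> K a -> ip (a x) y = 0).

Definition orbit_total (K : set (H -> H)) (S : set H) :=
  forall y, (forall x a, S x -> K a -> ip (a x) y = 0) -> y = 0.

(** A unit vector orthogonal to all orbits could be added to a maximal family: its
    orbit is orthogonal to the others because [K] is stable under adjoints. *)
Lemma maximal_family (K : set (H -> H)) : K id ->
  (forall a, K a -> exists2 b, K b & adjoint_pair ip a b) ->
  exists S, orbit_orthogonal K S /\ orbit_total K S.
Proof.
move=> K1 Kadj.
have [|S [[S1 So] Smax]] := @Zorn_bigcup _ (orbit_orthogonal K).
  move=> F FP Ftot; split=> [x [X /FP[X1 _] Xx]|x y a [X FX Xx] [Y FY Yy]].
    exact: X1.
  have [XY|YX] := Ftot _ _ FX FY.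
    by have [_] := FP _ FY; apply => //; exact: XY.
  by have [_] := FP _ FX; apply => //; exact: YX.
exists S; split => // y yS; apply: contrapT => y0.
have ny := rnorm_gt0 y0.
pose z := (rnorm y)^-1%:C *: y.
have z1 : rnorm z = 1.
  by rewrite rnormZ cabsR gtr0_norm ?invr_gt0 // mulVf // gt_eqF.
have zS x a : S x -> K a -> ip (a x) z = 0.
  by move=> Sx Ka; rewrite ipZr yS // mulr0.
apply: (Smax (S `|` [set z])).
  split; first by move=> x Sx; left.
  move=> /(_ z (or_intror erefl)) Sz; have := zS z id Sz K1.
  rewrite (ipxx hip) z1 expr1n => /eqP; rewrite (_ : 1%:C = 1) // oner_eq0 //.
split=> [x [/S1 //|->] //|x x' a [Sx|->] [Sx'|->] xx' Ka] //.
- exact: So.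
- exact: zS.
- have [b Kb ab] := Kadj a Ka.
  by rewrite ab ipC zS // conjc0.
Qed.

(** The spans of the finite subfamilies are directed, so their union is a subspace. *)
Lemma closure_span_finite (I : Type) (S : set I) (E : I -> set H) v (e : R) :
  closure (linear_span (\bigcup_(i in S) E i)) v -> 0 < e ->
  exists J, [/\ finite_set J, J `<=` S &
    exists2 y, linear_span (\bigcup_(i in J) E i) y & rnorm (v - y) < e].
Proof.
move=> /closure_rnormP vE /vE[y Ey ye].
suff [J [fJ JS Jy]] : exists J, [/\ finite_set J, J `<=` S &
    linear_span (\bigcup_(i in J) E i) y] by exists J; split => //; exists y.
move: y Ey {ye}; apply: linear_span_min.
  split.
    by exists set0; split => //; exact: (linear_span_subspace _).1.
  move=> a u u' [J [fJ JS Ju]] [J' [fJ' JS' Ju']].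
  exists (J `|` J'); split.
  - by rewrite finite_setU.
  - by rewrite subUset.
  - have sJ := linear_span_subspace (\bigcup_(i in J `|` J') E i).
    rewrite bigcup_setU in sJ *; apply: sJ.2.
      by apply: linear_span_mono Ju; exact: subsetUl.
    by apply: linear_span_mono Ju'; exact: subsetUr.
move=> x [i Si Ex]; exists [set i]; split => //.
  by move=> _ ->.
by apply: sub_linear_span; rewrite bigcup_set1.
Qed.

End Families.

(** * Limits along ultrafilters *)

Section UltrafilterLimits.
Variables (R : realType) (T : Type) (U : set_system T).
Hypothesis UU : UltraFilter U.
Local Notation C := R[i].

Lemma ultra_lim_real (g : T -> R) (k : R) : U [set t | `|g t| <= k] ->
  exists l, forall e : R, 0 < e -> U [set t | `|g t - l| < e].
Proof.
move=> Uk.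
have PU : ProperFilter (g @ U) by apply: fmap_proper_filter.
have [|l [_ lcl]] := @segment_compact R (- k) k (g @ U) PU.
  suff : U (g @^-1` `[- k, k]) by [].
  by apply: filterS Uk => t /=; rewrite ler_norml in_itv.
exists l => e e0.
have [//|Un] := in_ultra_setVsetC [set t | `|g t - l| < e] UU.
have An : (g @ U) (g @` (~` [set t | `|g t - l| < e])).
  suff : U (g @^-1` (g @` (~` [set t | `|g t - l| < e]))) by [].
  by apply: filterS Un => t nt; exists t.
have [_ [[t nt <-]]] := lcl _ _ An (nbhsx_ballx l e e0).
by rewrite /ball /= distrC.
Qed.

Lemma cabs_le_ReIm (z : C) : cabs z <= `|complex.Re z| + `|complex.Im z|.
Proof.
rewrite -(@ler_pXn2r _ 2) ?nnegrE ?addr_ge0 ?rnorm_ge0 //.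
rewrite cabs_sqr sqrrD !real_normK ?num_real //.
have : 0 <= `|complex.Re z| * `|complex.Im z| by rewrite mulr_ge0.
rewrite -mulr_natl; lra.
Qed.

Lemma Im_le_cabs (z : C) : `|complex.Im z| <= cabs z.
Proof.
rewrite -(@ler_pXn2r _ 2) ?nnegrE ?rnorm_ge0 //.
by rewrite cabs_sqr real_normK ?num_real // lerDr sqr_ge0.
Qed.

Lemma ultra_lim (g : T -> C) (k : R) : U [set t | cabs (g t) <= k] ->
  exists l, forall e : R, 0 < e -> U [set t | cabs (g t - l) < e].
Proof.
move=> Uk.
have [|l1 h1] := @ultra_lim_real (fun t => complex.Re (g t)) k.
  by apply: (filterS _ Uk) => t /=; apply: le_trans; exact: Re_le_cabs.
have [|l2 h2] := @ultra_lim_real (fun t => complex.Im (g t)) k.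
  by apply: (filterS _ Uk) => t /=; apply: le_trans; exact: Im_le_cabs.
exists (l1 +i* l2) => e e0; have e20 : 0 < e / 2 by rewrite divr_gt0.
apply: (filterS _ (filterI (h1 _ e20) (h2 _ e20))) => t /= [a1 a2].
apply: le_lt_trans (cabs_le_ReIm _) _; rewrite !ReImE /=; lra.
Qed.

Lemma ultra_lim_le (V : normedModType C) (g : T -> V) (l c : V) (k : R) :
  (forall e : R, 0 < e -> U [set t | rnorm (g t - l) < e]) ->
  U [set t | rnorm (g t + c) <= k] -> rnorm (l + c) <= k.
Proof.
move=> gl gk; apply/ler_addgt0Pr => e e0.
have [t [/= t1 t2]] := filter_ex (filterI (gl e e0) gk).
have -> : l + c = (g t + c) - (g t - l) by rewrite opprB [RHS]addrC addrA subrK.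
by apply: le_trans (rnormB _ _) _; lra.
Qed.

Lemma ultra_lim_uniq (V : normedModType C) (g : T -> V) (l l' : V) :
  (forall e : R, 0 < e -> U [set t | rnorm (g t - l) < e]) ->
  (forall e : R, 0 < e -> U [set t | rnorm (g t - l') < e]) -> l = l'.
Proof.
move=> gl gl'; apply/eqP; rewrite -subr_eq0; apply/eqP; apply: rnorm_eq0.
apply/eqP; rewrite eq_le rnorm_ge0 andbT; apply/ler_addgt0Pr => e e0.
rewrite add0r; apply: ultra_lim_le gl _.
by apply: (filterS _ (gl' e e0)) => t /= /ltW.
Qed.

Lemma ultra_lim_linear (V : normedModType C) (g g' : T -> V) (l l' : V) (a : C) :
  (forall e : R, 0 < e -> U [set t | rnorm (g t - l) < e]) ->
  (forall e : R, 0 < e -> U [set t | rnorm (g' t - l') < e]) ->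
  forall e : R, 0 < e -> U [set t | rnorm (a *: g t + g' t - (a *: l + l')) < e].
Proof.
move=> gl gl' e e0.
have a0 : 0 < cabs a + 1 by rewrite ltr_wpDl // rnorm_ge0.
have e1 : 0 < e / 2 / (cabs a + 1) by rewrite !divr_gt0.
have e2 : 0 < e / 2 by rewrite divr_gt0.
apply: (filterS _ (filterI (gl _ e1) (gl' _ e2))) => t /= [h1 h2].
have -> : a *: g t + g' t - (a *: l + l') = a *: (g t - l) + (g' t - l').
  by rewrite scalerBr opprD addrACA.
apply: le_lt_trans (rnormD _ _) _; rewrite rnormZ.
have : cabs a * rnorm (g t - l) <= e / 2; last by lra.
move: h1; rewrite ltr_pdivlMr // => h1.
apply: le_trans _ (ltW h1); rewrite mulrC ler_wpM2l ?rnorm_ge0 //.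
by rewrite lerDl.
Qed.

End UltrafilterLimits.

(** * Von Neumann algebras *)

Section VonNeumann.
Variables (R : realType) (H : completeNormedModType R[i]).
Local Notation C := R[i].
Variable ip : {dot H for conjC}.
Hypothesis hip : hilbert_inner_product ip.
Variable M : set (H -> H).
Hypothesis hM : von_Neumann_algebra ip M.

Lemma op_subE (a b : H -> H) x : (a - b) x = a x - b x.
Proof. by []. Qed.

Lemma vn_bounded a : M a -> bounded_operators a.
Proof. by case: hM => h _ _ _ _; exact: h. Qed.

Lemma vn_linear a : M a -> linear a.
Proof. by move=> /vn_bounded[]. Qed.

Lemma vn_subspace : linear_subspace M.
Proof. by case: hM. Qed.

Lemma vn0 : M 0.
Proof. exact: vn_subspace.1. Qed.

Lemma vnD a b : M a -> M b -> M (a + b).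
Proof. exact: subspaceD vn_subspace. Qed.

Lemma vnB a b : M a -> M b -> M (a - b).
Proof. exact: subspaceB vn_subspace. Qed.

Lemma vnZ c a : M a -> M (c *: a).
Proof. exact: subspaceZ vn_subspace. Qed.

Lemma vn_comp a b : M a -> M b -> M (a \o b).
Proof. by case: hM => _ _ + _ _; exact. Qed.

Lemma vn_adj a : M a -> M (adj ip a).
Proof.
move=> Ma; have [h1 h2] := adjP hip (vn_bounded Ma).
by case: hM => _ _ _ h _; exact: h h2.
Qed.

Lemma adj_vnE a x y : M a -> ip (a x) y = ip x (adj ip a y).
Proof. by move=> Ma; have [_] := adjP hip (vn_bounded Ma); exact. Qed.

Lemma adj_vnE' a x y : M a -> ip x (a y) = ip (adj ip a x) y.
Proof. by move=> Ma; rewrite ipC (adj_vnE _ _ Ma) -ipC. Qed.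

Lemma bounded_operator_id : bounded_operators (@id H).
Proof.
apply/bounded_operatorsP; split; first by [].
by exists 1 => // x; rewrite mul1r.
Qed.

Lemma vn_bicommutant a : bounded_operators a ->
  (forall b, commutant M b -> b \o a = a \o b) -> M a.
Proof. by move=> ba aK; case: hM => _ _ _ _ ->; split. Qed.

Lemma vn_id : M id.
Proof. by apply: vn_bicommutant => //; exact: bounded_operator_id. Qed.

Lemma commutant_id : commutant M id.
Proof. by split => //; exact: bounded_operator_id. Qed.

Lemma commutant_adj a : commutant M a ->
  exists2 b, commutant M b & adjoint_pair ip a b.
Proof.
move=> [ba aM]; have [bb ab] := adjP hip ba; exists (adj ip a) => //.
split => // m Mm; apply/funext => x /=.
have ma := adjoint_pairC ab.
apply/eqP; rewrite -subr_eq0; apply/eqP; apply: (ip_eq0 hip) => y.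
rewrite ipBl (adj_vnE _ _ Mm) !ma (adj_vnE _ _ Mm).
have /(congr1 (fun f => f y)) /= -> := aM _ (vn_adj Mm).
by rewrite subrr.
Qed.

(** Such a projection commutes with the commutant, and M is its own bicommutant. *)
Lemma vn_proj (E : set H) :
  (forall a x, commutant M a -> E x -> linear_span E (a x)) -> M (proj ip E).
Proof.
move=> EK; apply: vn_bicommutant; first exact: proj_bounded_operator.
move=> a Ka; have [b Kb ab] := commutant_adj Ka.
apply: (proj_commute hip Ka.1 ab) => x Ex; exact: EK.
Qed.

Lemma proj_projection_in (E : set H) :
  M (proj ip E) -> projection_in ip M (proj ip E).
Proof.
move=> ME; split => //; first exact: proj_selfadjoint.
by apply/funext => x /=; apply: proj_id => //; exact: proj_in.
Qed.

Lemma op_interval_conj k (a b : H -> H) c : linear a -> M b -> 0 <= k ->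
  bounded_by (adj ip b) c -> op_interval ip k a ->
  op_interval ip (k * c ^+ 2) (b \o a \o adj ip b).
Proof.
move=> la Mb k0 bc ia x /=; rewrite (adj_vnE _ _ Mb).
have [h1 h2] := ia (adj ip b x); split => //.
apply: le_trans h2 _; rewrite -mulrA -exprMn ler_wpM2l //.
rewrite ler_pXn2r ?nnegrE ?rnorm_ge0 //.
by apply: le_trans (rnorm_ge0 _) (bc x).
Qed.

Definition opos (a : H -> H) := forall x, 0 <= ip (a x) x.

Lemma op_interval_pos k a : op_interval ip k a -> opos a.
Proof. by move=> ia x; case: (ia x). Qed.

Lemma opos_trans a b c : opos (b - a) -> opos (c - b) -> opos (c - a).
Proof.
move=> h1 h2 x.
have -> : (c - a) x = (c - b) x + (b - a) x.
  by rewrite !op_subE addrA subrK.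
by rewrite ipDl addr_ge0.
Qed.

Lemma op_interval_sub k a b : op_interval ip k b -> opos a -> opos (b - a) ->
  op_interval ip k (b - a).
Proof.
move=> ib pa pba x; split; first exact: pba.
have [_] := ib x; apply: le_trans.
have /complex_ge0P[_] := pa x; rewrite !op_subE !ipBl !ReImE; lra.
Qed.

Lemma op_interval_eq0 k a x : linear a -> op_interval ip k a ->
  complex.Re (ip (a x) x) <= 0 -> a x = 0.
Proof.
move=> la ia re0; have [/complex_ge0P[_ h1] _] := ia x.
have re : complex.Re (ip (a x) x) = 0 by apply/eqP; rewrite eq_le re0.
apply: rnorm_eq0; apply/eqP; rewrite -sqrf_eq0 eq_le sqr_ge0 andbT.
by have := op_interval_sqr hip x la ia; rewrite re mulr0.
Qed.

Lemma op_interval_strong_lim (T : Type) (U : set_system T) (UU : UltraFilter U)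
    (g : T -> H -> H) (a : H -> H) k :
  U [set t | op_interval ip k (g t)] ->
  (forall x (e : R), 0 < e -> U [set t | rnorm (g t x - a x) < e]) ->
  op_interval ip k a.
Proof.
move=> gk ga x.
have h e : 0 < e -> exists t, op_interval ip k (g t) /\
    cabs (ip (g t x) x - ip (a x) x) <= e.
  move=> e0; have x1 : 0 < rnorm x + 1 by rewrite ltr_wpDl ?rnorm_ge0.
  have e1 : 0 < e / (rnorm x + 1) by rewrite divr_gt0.
  have [t [/= t1 t2]] := filter_ex (filterI gk (ga x _ e1)).
  exists t; split => //; rewrite -ipBl; apply: le_trans (cauchy_schwarz hip _ _) _.
  apply: le_trans (_ : rnorm (g t x - a x) * (rnorm x + 1) <= _).
    by rewrite ler_wpM2l ?rnorm_ge0 // lerDl.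
  by rewrite -ler_pdivlMr // ltW.
split.
  apply/complex_ge0P; split.
    apply/eqP; rewrite -normr_eq0 eq_le normr_ge0 andbT.
    apply/ler_addgt0Pr => e /h[t [it te]]; rewrite add0r.
    have [/complex_ge0P[i0 _] _] := it x.
    have := le_trans (Im_le_cabs _) te; rewrite !ReImE i0 add0r normrN //.
  apply/ler_addgt0Pr => e /h[t [it te]].
  have [/complex_ge0P[_ r0] _] := it x.
  by have := le_trans (Re_cabs _) te; rewrite !ReImE; lra.
apply/ler_addgt0Pr => e /h[t [it te]].
have [_ r0] := it x.
have := le_trans (Re_le_cabs _) te; rewrite !ReImE ler_norml => /andP[+ _]; lra.
Qed.

(** Decrease to 0 along [U]: the last condition says that almost every [d s] is above
    almost every [d t]. *)
Definition vanishing (T : Type) (U : set_system T) (d : T -> H -> H) (k : R) :=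
  [/\ U [set t | M (d t) /\ op_interval ip k (d t)],
      forall x e, 0 < e -> U [set t | complex.Re (ip (d t x) x) < e] &
      U [set s | U [set t | op_interval ip k (d s - d t)]]].

Lemma vanishing_conj (T : Type) (U : set_system T) (UU : UltraFilter U)
    (d : T -> H -> H) k c b : M b -> 0 <= k -> bounded_by (adj ip b) c ->
  vanishing U d k -> vanishing U (fun t => b \o d t \o adj ip b) (k * c ^+ 2).
Proof.
move=> Mb k0 bc [d1 d2 d3]; split.
- apply: filterS d1 => t [Md id]; split.
    by apply: vn_comp; [exact: vn_comp|exact: vn_adj].
  by apply: op_interval_conj => //; exact: vn_linear.
- move=> x e /(d2 (adj ip b x)); apply: filterS => t /=.
  by rewrite (adj_vnE _ _ Mb).
- apply: filterS (filterI d1 d3) => s [[Ms _] ds].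
  apply: filterS (filterI d1 ds) => t [[Mt _] dst] /=.
  have -> : (b \o d s \o adj ip b) - (b \o d t \o adj ip b) =
      b \o (d s - d t) \o adj ip b.
    by apply/funext => x /=; rewrite !op_subE /= (linB (vn_linear Mb)).
  by apply: op_interval_conj => //; apply/vn_linear/vnB.
Qed.

(** Since [|(b - a) x|^2 <= <(b - a) x, x>] for [a] below [b], the chain converges
    strongly along every ultrafilter that contains its tails. *)
Lemma chain_sup (A : set (H -> H)) : A !=set0 ->
  (forall a, A a -> M a /\ op_interval ip 1 a) ->
  (forall a b, A a -> A b -> opos (b - a) \/ opos (a - b)) ->
  exists (U : set_system (H -> H)) (a : H -> H), [/\ UltraFilter U, U A,
    M a /\ op_interval ip 1 a, forall b, A b -> opos (a - b) &
    vanishing U (fun b => a - b) 1].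
Proof.
move=> [a0 Aa0] AM Atot.
have pp0 a : opos (a - a) by move=> x; rewrite op_subE subrr ip0l.
pose Sa a := [set b | A b /\ opos (b - a)].
pose F := filter_from A Sa.
have PF : ProperFilter F.
  apply: filter_from_proper; last by move=> a Aa; exists a.
  apply: filter_from_filter; first by exists a0.
  move=> a b Aa Ab; have [ab|ba] := Atot _ _ Aa Ab.
    by exists b => // c [Ac bc]; split; split => //; exact: opos_trans bc.
  by exists a => // c [Ac bc]; split; split => //; exact: opos_trans bc.
have [U [UU FU]] := ultraFilterLemma PF.
have US a : A a -> U (Sa a) by move=> Aa; apply: FU; exists a.
have UA : U A by apply: filterS (US _ Aa0) => b [].
have Asub a b : A a -> A b -> opos (b - a) -> op_interval ip 1 (b - a).
  move=> Aa Ab; apply: op_interval_sub; first exact: (AM _ Ab).2.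
  exact: (op_interval_pos (AM _ Aa).2).
have Ubounded x : U [set b | rnorm (b x + 0) <= 1 * rnorm x].
  apply: filterS UA => b /AM[Mb ib] /=; rewrite addr0.
  exact: (op_interval_bounded hip ler01 (vn_linear Mb) ib).
have lim x : exists l, forall e : R, 0 < e -> U [set b | rnorm (b x - l) < e].
  apply: complete_filter => e e0.
  pose q (b : H -> H) := complex.Re (ip (b x) x).
  have e20 : 0 < (e / 2) ^+ 2 by rewrite exprn_gt0 // divr_gt0.
  have supq : has_sup (q @` A).
    split; first by exists (q a0), a0.
    by exists (1 * rnorm x ^+ 2) => _ [b /AM[_ ib] <-]; case: (ib x).
  have [_ [a Aa <-] qa] := sup_adherent e20 supq.
  exists (Sa a); split; first exact: US.
  have small b : Sa a b -> rnorm (b x - a x) < e / 2.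
    move=> [Ab ab]; have iab := Asub _ _ Aa Ab ab.
    rewrite -(@ltr_pXn2r _ 2) ?nnegrE ?rnorm_ge0 // ?divr_ge0 ?(ltW e0) //.
    have lab := vn_linear (vnB (AM _ Ab).1 (AM _ Aa).1).
    apply: le_lt_trans (op_interval_sqr hip x lab iab) _.
    rewrite mul1r (op_subE b a) ipBl !ReImE -/(q a) -/(q b).
    have : q b <= sup (q @` A) by apply: sup_upper_bound => //; exists b.
    lra.
  move=> b c /small hb /small hc.
  have -> : b x - c x = (b x - a x) - (c x - a x).
    by rewrite opprB subrKA.
  apply: le_lt_trans (rnormB _ _) _; lra.
have [a ha] := choice lim.
have la : linear a.
  move=> c u v; apply: (ultra_lim_uniq UU (ha _)) => e e0.
  have := ultra_lim_linear UU c (ha u) (ha v) e0.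
  by apply: filterS2 UA => b Ab /=; rewrite (vn_linear (AM _ Ab).1).
have ba : bounded_operators a.
  apply/bounded_operatorsP; split => //; exists 1 => // x.
  by rewrite -[a x]addr0; exact: (ultra_lim_le UU (ha x) (Ubounded x)).
have Ma : M a.
  apply: vn_bicommutant => // b [bb bM]; apply/funext => x /=.
  apply: (ultra_lim_uniq UU _ (ha (b x))) => e e0.
  have [lb [k k0 bk]] := (bounded_operatorsP b).1 bb.
  have k1 : 0 < k + 1 by rewrite ltr_wpDl.
  have e1 : 0 < e / (k + 1) by rewrite divr_gt0.
  apply: filterS2 UA (ha x _ e1) => c /AM[Mc _] /= hc.
  have /(congr1 (fun f => f x)) /= -> := bM _ Mc.
  rewrite -(linB lb); apply: le_lt_trans (bk _) _.
  move: hc; rewrite ltr_pdivlMr // mulrC; apply: le_lt_trans.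
  by rewrite ler_wpM2r ?rnorm_ge0 // lerDl.
have ia : op_interval ip 1 a.
  by apply: op_interval_strong_lim ha; apply: filterS UA => b /AM[].
have iab b : A b -> op_interval ip 1 (a - b).
  move=> Ab; apply: (@op_interval_strong_lim _ U UU (fun c => c - b)).
    by apply: filterS (US _ Ab) => c [Ac bc]; exact: Asub.
  move=> x e /(ha x); apply: filterS => c /=.
  by rewrite !op_subE opprB addrA subrK.
exists U, a; split => //; first by move=> b /iab/op_interval_pos.
split.
- by apply: filterS UA => b Ab; split; [apply: vnB => //; exact: (AM _ Ab).1|exact: iab].
- move=> x e e0; have x1 : 0 < rnorm x + 1 by rewrite ltr_wpDl ?rnorm_ge0.
  have e1 : 0 < e / (rnorm x + 1) by rewrite divr_gt0.
  apply: filterS (ha x _ e1) => b /=; rewrite ltr_pdivlMr // => h.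
  apply: le_lt_trans (Re_cabs _) _; apply: le_lt_trans (cauchy_schwarz hip _ _) _.
  rewrite (op_subE a b) rnormBC; apply: le_lt_trans h.
  by rewrite ler_wpM2l ?rnorm_ge0 // lerDl.
- apply: filterS UA => b Ab; apply: filterS (US _ Ab) => c [Ac bc] /=.
  have -> : a - b - (a - c) = c - b by rewrite opprB addrC addrA subrK.
  exact: Asub.
Qed.

Lemma opos_anti k a b : M a -> M b -> op_interval ip k a -> op_interval ip k b ->
  opos (b - a) -> opos (a - b) -> a = b.
Proof.
move=> Ma Mb ia ib ab ba; apply/funext => x.
have iab := op_interval_sub ib (op_interval_pos ia) ab.
suff : (b - a) x = 0 by rewrite op_subE => /eqP; rewrite subr_eq0 => /eqP.
apply: (op_interval_eq0 _ iab); first exact/vn_linear/vnB.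
have /complex_ge0P[_] := ba x; rewrite !op_subE !ipBl !ReImE; lra.
Qed.

(** Zorn's lemma, the upper bound of a chain being its strong limit along an
    ultrafilter. *)
Lemma maximal_contraction (E : set (H -> H)) : E !=set0 ->
  (forall a, E a -> M a /\ op_interval ip 1 a) ->
  (forall U a, UltraFilter U -> U E -> M a -> op_interval ip 1 a ->
     vanishing U (fun b => a - b) 1 -> E a) ->
  exists2 m, E m & forall b, E b -> opos (b - m) -> b = m.
Proof.
move=> [e0 Ee0] EM Esup.
pose T := {a | E a}; pose le (a b : T) := `[< opos (sval b - sval a) >].
have [||a b ab ba|A Atot|m mmax] := @Zorn T le.
- by move=> a; apply/asboolP => x; rewrite op_subE subrr ip0l.
- move=> a b c /asboolP ab /asboolP bc; apply/asboolP; exact: opos_trans bc.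
- case: a ab ba => a Ea; case: b => b Eb /asboolP /= ab /asboolP /= ba.
  apply: eq_exist; have [Ma ia] := EM _ Ea; have [Mb ib] := EM _ Eb.
  exact: opos_anti ia ib ab ba.
- have [A0|/set0P/negP/negbNE/eqP A0] := pselect (A !=set0); last first.
    by exists (exist _ e0 Ee0) => s; rewrite A0.
  have [|a [b _ <-]|_ _ [a Aa <-] [b Ab <-]|U [a [UU US [Ma ia] ub va]]] :=
      @chain_sup [set sval a | a in A].
  + by case: A0 => a Aa; exists (sval a), a.
  + exact: EM (svalP b).
  + by have [/asboolP ab|/asboolP ba] := Atot _ _ Aa Ab; [left|right].
  have Ea : E a.
    apply: (Esup U) => //; apply: filterS US => _ [b _ <-]; exact: svalP.
  exists (exist _ a Ea) => b Ab; apply/asboolP => /=; apply: ub.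
  by exists b.
- exists (sval m) => [|b Eb mb]; first exact: svalP.
  suff -> : m = exist _ b Eb by [].
  by apply/esym/mmax/asboolP.
Qed.

End VonNeumann.

(** * Normal positive functionals *)

Section NormalFunctionals.
Variables (R : realType) (H : completeNormedModType R[i]).
Local Notation C := R[i].
Variable ip : {dot H for conjC}.
Hypothesis hip : hilbert_inner_product ip.
Variable M : set (H -> H).
Hypothesis hM : von_Neumann_algebra ip M.
Let vn_lin := vn_linear hM.
Let adjE := adj_vnE hip hM.
Let vnA := vn_adj hip hM.
Let vnC := vn_comp hM.
Let vnBB := vnB hM.
Let vnI := vn_id hM.
Implicit Types (a b : H -> H).

Lemma vn_boundedP a : M a -> exists2 k, 0 <= k & bounded_by a k.
Proof. by move=> /(vn_bounded hM)/bounded_operatorsP[]. Qed.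

Lemma adj_uniq a b : M a -> adjoint_pair ip a b -> adj ip a = b.
Proof.
move=> Ma ab; apply/funext => y; apply/eqP; rewrite -subr_eq0; apply/eqP.
by apply: (ip_eq0 hip) => z; rewrite ipC ipBr -adjE // -ab subrr conjc0.
Qed.

Lemma adjK a : M a -> adj ip (adj ip a) = a.
Proof.
move=> Ma; apply: adj_uniq; first exact: vnA.
by move=> y z; rewrite ipC -adjE // -ipC.
Qed.

Lemma adj_comp a b : M a -> M b -> adj ip (a \o b) = adj ip b \o adj ip a.
Proof.
by move=> Ma Mb; apply: adj_uniq; [exact: vnC|move=> y z /=; rewrite !adjE].
Qed.

Lemma adj_interval k a : M a -> op_interval ip k a -> adj ip a = a.
Proof.
by move=> Ma ia; apply: adj_uniq => //; exact: (op_interval_selfadjoint (vn_lin Ma) ia).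
Qed.

Lemma adj_lin c a b : M a -> M b ->
  adj ip (c *: a + b) = (c^*)%C *: adj ip a + adj ip b.
Proof.
move=> Ma Mb; apply: adj_uniq; first exact: (vn_subspace hM).2.
move=> y z; rewrite -[LHS]/(ip (c *: a y + b y) z).
rewrite -[RHS]/(ip y ((c^*)%C *: adj ip a z + adj ip b z)).
by rewrite !ipDl !ipDr !ipZl !ipZr conjcK !adjE.
Qed.

(** In the concrete description of the predual, as a quotient of the trace class,
    the elements are the norm limits of these finite sums. *)
Definition vector_sum (s : seq (H * H)) (b : H -> H) : C :=
  \sum_(z <- s) ip (b z.1) z.2.

Definition vector_limit (F : (H -> H) -> C) := forall e : R, 0 < e ->
  exists s, forall b k, M b -> 0 <= k -> bounded_by b k ->
    cabs (F b - vector_sum s b) <= e * k.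

Lemma vector_limit_closed (F : (H -> H) -> C) :
  (forall e : R, 0 < e -> exists2 G, vector_limit G &
     forall b k, M b -> 0 <= k -> bounded_by b k -> cabs (F b - G b) <= e * k) ->
  vector_limit F.
Proof.
move=> FG e e0; have e20 : 0 < e / 2 by rewrite divr_gt0.
have [G /(_ _ e20)[s Gs] h] := FG _ e20.
exists s => b k Mb k0 bk.
rewrite -[F b - _](subrKA (G b)) (le_trans (rnormD _ _)) //.
have := h b k Mb k0 bk; have := Gs b k Mb k0 bk; lra.
Qed.

Lemma vector_limitD F G : vector_limit F -> vector_limit G ->
  vector_limit (fun b => F b + G b).
Proof.
move=> vF vG e e0; have e20 : 0 < e / 2 by rewrite divr_gt0.
have [s Fs] := vF _ e20; have [t Gt] := vG _ e20.
exists (s ++ t) => b k Mb k0 bk.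
rewrite /vector_sum big_cat /= opprD addrACA (le_trans (rnormD _ _)) //.
have := Fs b k Mb k0 bk; have := Gt b k Mb k0 bk; rewrite /vector_sum; lra.
Qed.

Lemma vector_limit_lmul F a : M a -> vector_limit F ->
  vector_limit (fun b => F (a \o b)).
Proof.
move=> Ma vF e e0; have [l l0 al] := vn_boundedP Ma.
have l1 : 0 < l + 1 by rewrite ltr_wpDl.
have [s Fs] := vF (e / (l + 1)) ltac:(by rewrite divr_gt0).
exists [seq (z.1, adj ip a z.2) | z <- s] => b k Mb k0 bk.
have -> : vector_sum [seq (z.1, adj ip a z.2) | z <- s] b = vector_sum s (a \o b).
  by rewrite /vector_sum big_map; apply: eq_bigr => z _ /=; rewrite (adjE _ _ Ma).
apply: le_trans (Fs _ ((l + 1) * k) _ _ _) _.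
- exact: vnC.
- by rewrite mulr_ge0 // ltW.
- move=> z /=; apply: le_trans (al _) _; rewrite -mulrA.
  by apply: ler_pM; rewrite ?rnorm_ge0 ?lerDl //; exact: bk.
- by rewrite mulrA divfK // gt_eqF.
Qed.

Lemma vector_limit_rmul F a : M a -> vector_limit F ->
  vector_limit (fun b => F (b \o a)).
Proof.
move=> Ma vF e e0; have [l l0 al] := vn_boundedP Ma.
have l1 : 0 < l + 1 by rewrite ltr_wpDl.
have [s Fs] := vF (e / (l + 1)) ltac:(by rewrite divr_gt0).
exists [seq (a z.1, z.2) | z <- s] => b k Mb k0 bk.
have -> : vector_sum [seq (a z.1, z.2) | z <- s] b = vector_sum s (b \o a).
  by rewrite /vector_sum big_map.
apply: le_trans (Fs _ (k * (l + 1)) _ _ _) _.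
- exact: vnC.
- by rewrite mulr_ge0 // ltW.
- move=> z /=; apply: le_trans (bk _) _; rewrite -mulrA ler_wpM2l //.
  by apply: le_trans (al _) _; rewrite ler_wpM2r ?rnorm_ge0 // lerDl.
- by rewrite [k * _]mulrC mulrA divfK // gt_eqF.
Qed.

(** Normality is continuity along decreasing families; families indexed by operators
    are enough to cover chains. *)
Definition normal_positive (phi : (H -> H) -> C) :=
  [/\ forall c a b, M a -> M b -> phi (c *: a + b) = c * phi a + phi b,
      forall a k, M a -> 0 <= k -> op_interval ip k a -> 0 <= phi a &
      forall (U : set_system (H -> H)) (d : (H -> H) -> H -> H) k,
        UltraFilter U -> 0 <= k -> vanishing ip M U d k ->
        forall e, 0 < e -> U [set t | cabs (phi (d t)) < e]].

Lemma square_interval a k : M a -> 0 <= k -> bounded_by a k ->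
  op_interval ip (k ^+ 2) (adj ip a \o a).
Proof.
move=> Ma k0 ak x /=; rewrite ipC -adjE // -ipC; split; first exact: ip_ge0.
rewrite -(rnorm2E hip) -exprMn ler_pXn2r ?nnegrE ?mulr_ge0 ?rnorm_ge0 //.
Qed.

Section PositiveFunctional.
Variable phi : (H -> H) -> C.
Hypothesis nphi : normal_positive phi.

Let phiL c a b : M a -> M b -> phi (c *: a + b) = c * phi a + phi b.
Proof. by case: nphi => h _ _; exact: h. Qed.

Let phi0 : phi 0 = 0.
Proof.
have M0 := vn0 hM.
by have := phiL (-1) M0 M0; rewrite scaler0 addr0 mulN1r addNr.
Qed.

Let phiZ c a : M a -> phi (c *: a) = c * phi a.
Proof. by move=> Ma; have := phiL c Ma (vn0 hM); rewrite !addr0 phi0 addr0. Qed.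

Let phiD a b : M a -> M b -> phi (a + b) = phi a + phi b.
Proof. by move=> Ma Mb; have := phiL 1 Ma Mb; rewrite scale1r mul1r. Qed.

Let phiB a b : M a -> M b -> phi (a - b) = phi a - phi b.
Proof.
by move=> Ma Mb; rewrite -scaleN1r addrC phiL // mulN1r addrC.
Qed.

Let phi_le k a b : M a -> M b -> 0 <= k -> op_interval ip k (b - a) ->
  complex.Re (phi a) <= complex.Re (phi b).
Proof.
move=> Ma Mb k0 iab; case: nphi => _ /(_ _ _ (vnBB Mb Ma) k0 iab) + _.
by rewrite phiB // => /complex_ge0P[_]; rewrite !ReImE subr_ge0.
Qed.

Let phi_ge0 k a : M a -> 0 <= k -> op_interval ip k a ->
  0 <= complex.Re (phi a).
Proof. by move=> Ma k0 ia; case: nphi => _ /(_ _ _ Ma k0 ia)/complex_ge0P[]. Qed.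

Let phi_form a b : M a -> M b ->
  cabs (phi (adj ip b \o a)) ^+ 2 <=
    complex.Re (phi (adj ip a \o a)) * complex.Re (phi (adj ip b \o b)).
Proof.
apply: (@semidefinite_CS _ _ M (fun a b => phi (adj ip b \o a)) (vn_subspace hM)).
- move=> c u v w Mu Mv Mw; rewrite -phiL; try by apply: vnC => //; exact: vnA.
  congr phi; apply/funext => z /=; exact: (vn_lin (vnA Mw)).
- move=> c u v w Mu Mv Mw; rewrite -phiL; try by apply: vnC => //; exact: vnA.
  by rewrite adj_lin.
- move=> u Mu; case: nphi => _ + _; have [k k0 uk] := vn_boundedP Mu.
  apply; last exact: square_interval uk.
    by apply: vnC => //; exact: vnA.
  exact: sqr_ge0.
Qed.

Lemma positive_CS a b : M a -> M b -> cabs (phi (b \o a)) ^+ 2 <=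
  complex.Re (phi (b \o adj ip b)) * complex.Re (phi (adj ip a \o a)).
Proof.
move=> Ma Mb; have := phi_form Ma (vnA Mb); rewrite adjK //.
by rewrite mulrC.
Qed.

Let phi1_ge0 : 0 <= complex.Re (phi id).
Proof.
apply: (@phi_ge0 1) => // x; split; first exact: ip_ge0.
by rewrite -(rnorm2E hip) mul1r.
Qed.

Lemma op_interval_id : op_interval ip 1 id.
Proof. by move=> x; split; [exact: ip_ge0|rewrite -(rnorm2E hip) mul1r]. Qed.

Let phi_square_le b k : M b -> 0 <= k -> bounded_by b k ->
  complex.Re (phi (adj ip b \o b)) <= k ^+ 2 * complex.Re (phi id).
Proof.
move=> Mb k0 bk.
have -> : k ^+ 2 * complex.Re (phi id) = complex.Re (phi ((k ^+ 2)%:C *: id)).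
  by rewrite phiZ // !ReImE /= mul0r subr0.
have ik := square_interval Mb k0 bk.
have Mbb : M (adj ip b \o b) by apply: vnC => //; exact: vnA.
apply: (@phi_le (k ^+ 2)) => //; [exact: (vnZ hM _ vnI)|exact: sqr_ge0|].
apply: op_interval_sub.
- move=> x; rewrite -[(_ *: id) x]/((k ^+ 2)%:C *: x) ipZl (ipxx hip) -rmorphM /=.
  by split => //; rewrite ler0c mulr_ge0 // sqr_ge0.
- exact: op_interval_pos ik.
- move=> x; rewrite op_subE ipBl -[(_ *: id) x]/((k ^+ 2)%:C *: x) ipZl (ipxx hip).
  have [/complex_ge0P[i0 _] r0] := ik x; rewrite -rmorphM /=.
  by apply/complex_ge0P; rewrite !ReImE /= i0 oppr0 addr0 subr_ge0.
Qed.

Let adj_bounded b k : M b -> 0 <= k -> bounded_by b k -> bounded_by (adj ip b) k.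
Proof. by move=> Mb; apply: adj_bounded_by => //; exact: (vn_bounded hM). Qed.

Lemma opos_square b : M b -> opos ip (adj ip b \o b).
Proof.
by move=> Mb x /=; rewrite ipC -adjE // -ipC; exact: ip_ge0.
Qed.

Lemma Re_square b (x : H) : M b ->
  complex.Re (ip ((adj ip b \o b) x) x) = rnorm (b x) ^+ 2.
Proof. by move=> Mb /=; rewrite ipC -adjE // -ipC (rnorm2E hip). Qed.

Lemma opos_Re a : (forall x, complex.Im (ip (a x) x) = 0) ->
  (forall x, 0 <= complex.Re (ip (a x) x)) -> opos ip a.
Proof. by move=> h1 h2 x; apply/complex_ge0P. Qed.

(** The left ideal of those [s] for which [phi (. s)] is a limit of vector
    functionals. *)
Let ideal s := M s /\ vector_limit (fun x => phi (x \o s)).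

Let ideal_lmul b s : M b -> ideal s -> ideal (b \o s).
Proof.
move=> Mb [Ms vs]; split; first exact: vnC.
exact: (vector_limit_rmul Mb vs).
Qed.

Let compDr b (s t : H -> H) : M b -> b \o (s + t) = (b \o s) + (b \o t).
Proof. by move=> Mb; apply/funext => x /=; exact: (linD (vn_lin Mb)). Qed.

Let compBr b (s t : H -> H) : M b -> b \o (s - t) = (b \o s) - (b \o t).
Proof. by move=> Mb; apply/funext => x /=; exact: (linB (vn_lin Mb)). Qed.

Let idealD s t : ideal s -> ideal t -> ideal (s + t).
Proof.
move=> [Ms vs] [Mt vt]; split; first exact: (vnD hM Ms Mt).
move=> e e0; have [l h] := vector_limitD vs vt e0.
exists l => b k Mb k0 bk; rewrite compDr // phiD ?h //; exact: vnC.
Qed.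

(** By Cauchy-Schwarz [phi (b (a - s))] is controlled by [phi ((a - s)^2)], which is
    at most [phi (a - s)]. *)
Let ideal_sup U a : UltraFilter U ->
  U [set s | op_interval ip 1 s /\ ideal s] -> M a ->
  op_interval ip 1 a -> vanishing ip M U (fun b => a - b) 1 -> ideal a.
Proof.
move=> UU Ui Ma ia va; split => //.
apply: vector_limit_closed => e e0.
have p1 : 0 < complex.Re (phi id) + 1 by rewrite ltr_wpDl.
have d0 : 0 < e ^+ 2 / (complex.Re (phi id) + 1) by rewrite divr_gt0 ?exprn_gt0.
have [_ _ /(_ U _ 1 UU ler01 va _ d0) small] := nphi.
case: (va) => va1 _ _.
have [s [/= [[is1 [Ms vs]] ds] [Mas ias]]] := filter_ex (filterI (filterI Ui small) va1).
exists (fun x => phi (x \o s)) => // b k Mb k0 bk.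
rewrite -phiB; try by apply: vnC.
rewrite -compBr //.
rewrite -(@ler_pXn2r _ 2) ?nnegrE ?mulr_ge0 ?rnorm_ge0 ?(ltW e0) //.
apply: le_trans (positive_CS Mas Mb) _.
have h1 := phi_square_le (vnA Mb) k0 (adj_bounded Mb k0 bk).
rewrite adjK // in h1.
have h2 : complex.Re (phi (adj ip (a - s) \o (a - s))) <=
    e ^+ 2 / (complex.Re (phi id) + 1).
  apply: le_trans (_ : complex.Re (phi (a - s)) <= _); last first.
    exact: le_trans (Re_cabs _) (ltW ds).
  have Msq : M (adj ip (a - s) \o (a - s)) by apply: vnC => //; exact: vnA.
  apply: (@phi_le 1) => //; apply: op_interval_sub => //.
    exact: opos_square.
  have isq := square_interval Mas ler01 (op_interval_bounded hip ler01 (vn_lin Mas) ias).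
  apply: opos_Re => x; rewrite op_subE ipBl !ReImE.
    have [/complex_ge0P[-> _] _] := ias x; have [/complex_ge0P[-> _] _] := isq x.
    by rewrite subrr.
  rewrite Re_square // subr_ge0.
  by have := op_interval_sqr hip x (vn_lin Mas) ias; rewrite mul1r.
have h3 : 0 <= complex.Re (phi (adj ip (a - s) \o (a - s))).
  have isq := square_interval Mas ler01 (op_interval_bounded hip ler01 (vn_lin Mas) ias).
  by apply: phi_ge0 isq; [apply: vnC => //; exact: vnA|exact: sqr_ge0].
have h4 : 0 <= complex.Re (phi (b \o adj ip b)).
  have := square_interval (vnA Mb) k0 (adj_bounded Mb k0 bk).
  rewrite adjK // => isq.
  by apply: phi_ge0 isq; [apply: vnC => //; exact: vnA|exact: sqr_ge0].
apply: le_trans (ler_pM h4 h3 h1 h2) _.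
have -> : k ^+ 2 * complex.Re (phi id) * (e ^+ 2 / (complex.Re (phi id) + 1)) =
    (e * k) ^+ 2 * (complex.Re (phi id) / (complex.Re (phi id) + 1)).
  by field; rewrite gt_eqF.
by rewrite ler_piMr ?sqr_ge0 // ler_pdivrMr // mul1r lerDl.
Qed.

Lemma op_interval_le k a b : op_interval ip k a -> opos ip b -> opos ip (a - b) ->
  op_interval ip k b.
Proof.
move=> ia pb pab x; split => //; have [_] := ia x; apply: le_trans.
by have /complex_ge0P[_] := pab x; rewrite op_subE ipBl !ReImE subr_ge0.
Qed.

Lemma oposD a b : opos ip a -> opos ip b -> opos ip (a + b).
Proof.
move=> pa pb x; rewrite -[(a + b) x]/(a x + b x) ipDl; exact: addr_ge0.
Qed.

Lemma op_interval_compl a : op_interval ip 1 a -> op_interval ip 1 (id - a).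
Proof.
move=> ia; apply: op_interval_sub; first exact: op_interval_id.
  exact: op_interval_pos ia.
apply: opos_Re => x; rewrite op_subE ipBl !ReImE (ipxx hip) /=; have [/complex_ge0P[i0 _] r0] := ia x.
  by rewrite i0 subrr.
by rewrite subr_ge0 -[_ ^+ 2]mul1r.
Qed.

Let ideal0 : ideal 0.
Proof.
split; first exact: (vn0 hM).
move=> e e0; exists [::] => b k Mb k0 _; rewrite /vector_sum big_nil subr0.
have -> : b \o (0 : H -> H) = (0 : H -> H) by apply/funext => x /=; exact: (lin0 (vn_lin Mb)).
by rewrite phi0 rnorm0 mulr_ge0 // ltW.
Qed.

Let phi_sandwich d a : M d -> adj ip d = d -> op_interval ip 1 d ->
  forall U (e : R), UltraFilter U -> vanishing ip M U (fun b => a - b) 1 -> 0 < e ->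
  U [set b | cabs (phi (d \o (a - b) \o d)) < e].
Proof.
move=> Md dd id1 U e UU va e0.
have bd : bounded_by (adj ip d) 1.
  by rewrite dd; exact: (op_interval_bounded hip ler01 (vn_lin Md) id1).
have vd := vanishing_conj hip hM UU Md ler01 bd va.
case: nphi => _ _ /(_ U _ _ UU _ vd e e0); rewrite dd; apply.
by rewrite mul1r sqr_ge0.
Qed.

(** Let [e] be a maximal contraction in the ideal, and suppose that [d = 1 - e] does
    not vanish. Then a multiple [psi] of a vector state exceeds [phi] at [d^2]. Let
    [c] be a maximal contraction with [psi (d c d) <= phi (d c d)]: below
    [g = 1 - c], [phi] is dominated by [psi], so that [phi (. g d)] is a vector
    functional by the Riesz lemma. Hence [g d] and [d g^2 d] lie in the ideal, and
    the maximality of [e] gives [g d = 0], which contradicts the choice of [c]. *)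
Theorem normal_positive_vector_limit : vector_limit phi.
Proof.
pose E1 := [set e | op_interval ip 1 e /\ ideal e].
have [||U a UU UE Ma ia va|e [ie [Me ve]] emax] := @maximal_contraction _ _ ip hip M hM E1.
- exists 0; split; last exact: ideal0.
  move=> x; rewrite -[(0 : H -> H) x]/(0 : H) ip0l; split => //.
  by rewrite mul1r sqr_ge0.
- by move=> a [ia [Ma _]].
- by split => //; exact: ideal_sup va.
pose d : H -> H := id - e.
have Md : M d by exact: vnBB.
have ld := vn_lin Md.
have id1 : op_interval ip 1 d by exact: op_interval_compl.
have dd : adj ip d = d by exact: adj_interval id1.
have [d0|/existsNP[xi dxi]] := pselect (forall x, d x = 0).
  have -> : phi = (fun x => phi (x \o e)) => //.
  apply/funext => x; congr (phi _); apply/funext => y /=.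
  by have /eqP := d0 y; rewrite -[d y]/(y - e y) subr_eq0 => /eqP <-.
have n0 : 0 < rnorm (d xi) ^+ 2 by rewrite exprn_gt0 // rnorm_gt0.
have Mdd : M (d \o d) by exact: vnC.
have pdd : 0 <= complex.Re (phi (d \o d)).
  have := square_interval Md ler01 (op_interval_bounded hip ler01 ld id1).
  by rewrite dd => h; apply: phi_ge0 h => //; exact: sqr_ge0.
(* This [t] gives [psi id] the value [phi (d^2) + 1]. *)
pose t := (complex.Re (phi (d \o d)) + 1) / rnorm (d xi) ^+ 2.
have t0 : 0 < t by rewrite divr_gt0 // ltr_wpDl.
pose psi (b : H -> H) := t * complex.Re (ip (b (d xi)) (d xi)).
pose E2 := [set c | [/\ M c, op_interval ip 1 c &
  psi c <= complex.Re (phi (d \o c \o d))]].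
have psiB a b : psi (a - b) = psi a - psi b.
  by rewrite /psi op_subE ipBl !ReImE mulrBr.
have sandB a b : M a -> M b ->
    complex.Re (phi (d \o (a - b) \o d)) =
    complex.Re (phi (d \o a \o d)) - complex.Re (phi (d \o b \o d)).
  move=> Ma Mb; rewrite -ReN -ReD -phiB; try by apply: (vnC _ Md); exact: vnC.
  congr (complex.Re (phi _)); apply/funext => x.
  by rewrite /= op_subE (linB ld).
have [||U a UU UE Ma ia va|c [Mc ic pc] cmax] := @maximal_contraction _ _ ip hip M hM E2.
- have h0 (x : H) : (0 : H -> H) x = 0 by [].
  exists 0; split; first exact: (vn0 hM).
    by move=> x; rewrite h0 ip0l; split => //; rewrite mul1r sqr_ge0.
  rewrite /psi h0 ip0l mulr0.
  have -> : d \o (0 : H -> H) \o d = (0 : H -> H) by apply/funext => x /=; rewrite h0 (lin0 ld).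
  by rewrite phi0.
- by move=> a [Ma ia _].
- split => //; apply/ler_addgt0Pr => del del0.
  have del2 : 0 < del / 2 by rewrite divr_gt0.
  have s1 := phi_sandwich Md dd id1 UU va del2.
  case: (va) => _ /(_ (d xi) (del / 2 / t)) s2 _.
  have [|b [/= [[Mb ib pb] hb1] hb2]] := filter_ex (filterI (filterI UE s1) (s2 _)).
    by rewrite divr_gt0.
  have := psiB a b; have := sandB a b Ma Mb.
  have : - complex.Re (phi (d \o (a - b) \o d)) < del / 2.
    by rewrite -ReN; apply: le_lt_trans (Re_cabs _) _; rewrite rnormN.
  have : psi (a - b) < del / 2 by rewrite /psi mulrC -ltr_pdivlMr.
  lra.
pose g : H -> H := id - c.
have Mg : M g by exact: vnBB.
have lg := vn_lin Mg.
have ig : op_interval ip 1 g by exact: op_interval_compl.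
have gg : adj ip g = g by exact: adj_interval ig.
(* Otherwise [c + b] would contradict the maximality of [c]. *)
have below b : M b -> opos ip b -> opos ip (g - b) ->
    complex.Re (phi (d \o b \o d)) <= psi b.
  move=> Mb pb pgb; apply: contrapT => /negP; rewrite -ltNge => lt.
  have Mcb := vnD hM Mc Mb.
  have Ecb : E2 (c + b).
    split => //.
      apply: (op_interval_le op_interval_id).
        by apply: oposD => //; exact: op_interval_pos ic.
      by rewrite opprD addrA.
    have := psiB (c + b) c; have := sandB _ _ Mcb Mc.
    by rewrite addrC addKr; lra.
  have := cmax _ Ecb; rewrite addrC addKr => /(_ pb) cb.
  have := psiB (c + b) c; have := sandB _ _ Mcb Mc.
  by rewrite addrC addKr addrC cb !subrr; lra.
(* By Cauchy-Schwarz the square of the left side is at most [phi id] times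
   [phi (d b d)] with [b] the square of [x g]; after scaling [x] to a contraction,
   [b] is below [g]. *)
have dominated x : M x ->
    cabs (phi (x \o (g \o d))) <= Num.sqrt (complex.Re (phi id) * t) * rnorm (x (g (d xi))).
  move=> Mx; have [k k0 xk] := vn_boundedP Mx.
  have Mgd := vnC Mg Md.
  have k1 : 0 < k + 1 by rewrite ltr_wpDl.
  pose y := (k + 1)^-1%:C *: x.
  have My : M y by exact: (vnZ hM _ Mx).
  have yE z : y z = (k + 1)^-1%:C *: x z by [].
  have y1 z : rnorm (y z) <= rnorm z.
    rewrite yE rnormZ cabsR gtr0_norm ?invr_gt0 // mulrC ler_pdivrMr // mulrC.
    by apply: le_trans (xk z) _; rewrite ler_wpM2r ?rnorm_ge0 // lerDl.
  have Myg := vnC My Mg.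
  have b1 := below (adj ip (y \o g) \o (y \o g)) (vnC (vnA Myg) Myg) (opos_square Myg).
  have {b1}/b1 : opos ip (g - (adj ip (y \o g) \o (y \o g))).
    have bg := op_interval_bounded hip ler01 lg ig.
    have byg : bounded_by (y \o g) 1.
      by move=> z /=; apply: le_trans (y1 _) _; exact: bg.
    have isq := square_interval Myg ler01 byg.
    apply: opos_Re => z; rewrite op_subE ipBl !ReImE.
      have [/complex_ge0P[-> _] _] := ig z; have [/complex_ge0P[-> _] _] := isq z.
      by rewrite subrr.
    rewrite Re_square // subr_ge0 /=.
    have := op_interval_sqr hip z lg ig; rewrite mul1r; apply: le_trans.
    by rewrite ler_pXn2r ?nnegrE ?rnorm_ge0.
  rewrite /psi Re_square // => b1.
  have h := @positive_CS (x \o (g \o d)) id (vnC Mx Mgd) vnI.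
  rewrite -(@ler_pXn2r _ 2) ?nnegrE ?mulr_ge0 ?rnorm_ge0 ?sqrtr_ge0 //.
  have pt : 0 <= complex.Re (phi id) * t by apply: mulr_ge0 => //; exact: ltW.
  rewrite exprMn sqr_sqrtr //.
  have idid : adj ip id = id by apply: adj_interval => //; exact: op_interval_id.
  move: h; rewrite idid /=; rewrite -[id \o _]/(x \o (g \o d)) => /le_trans; apply.
  rewrite -mulrA ler_wpM2l //.
  have -> : adj ip (x \o (g \o d)) \o (x \o (g \o d)) =
     ((k + 1) ^+ 2)%:C *: (d \o (adj ip (y \o g) \o (y \o g)) \o d).
    rewrite (adj_comp Mx Mgd) (adj_comp Mg Md) (adj_comp My Mg) gg dd.
    have -> : adj ip y = (k + 1)^-1%:C *: adj ip x.
      have := adj_lin (k + 1)^-1%:C Mx (vn0 hM).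
      rewrite addr0 conjc_real => ->.
      have -> : adj ip 0 = 0.
        by apply: adj_uniq => [|u v]; [exact: (vn0 hM)|rewrite ip0l ip0r].
      by rewrite addr0.
    apply/funext => z; rewrite /= -[RHS]/(((k + 1) ^+ 2)%:C *: d (g ((k + 1)^-1%:C *: adj ip x (y (g (d z)))))) yE.
    rewrite !(linZ (vn_lin (vnA Mx))) !(linZ lg) !(linZ ld) !scalerA.
    rewrite -!rmorphM /= [X in X%:C](_ : _ = 1) ?scale1r //.
    by field; rewrite gt_eqF.
  have Mbig : M (d \o (adj ip (y \o g) \o (y \o g)) \o d).
    by apply: vnC => //; apply: vnC => //; apply: vnC => //; exact: vnA.
  rewrite phiZ // !ReImE /= mul0r subr0.
  apply: le_trans (ler_wpM2l (sqr_ge0 _) b1) _.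
  rewrite /= yE rnormZ exprMn cabsR gtr0_norm ?invr_gt0 //.
  by rewrite le_eqVlt; apply/orP; left; apply/eqP; field; rewrite gt_eqF.
have Mgd := vnC Mg Md.
have igd : ideal (g \o d).
  split => //.
  have [||u Mu|eta [_ etaE]] := @riesz_variational _ _ ip hip (H -> H) M
    (fun x => x (g (d xi))) (fun x => phi (x \o (g \o d)))
    (Num.sqrt (complex.Re (phi id) * t)) (vn_subspace hM).
  - by [].
  - by move=> a u v Mu Mv; rewrite -phiL //; exact: vnC.
  - exact: dominated.
  move=> e' e'0; exists [:: (g (d xi), eta)] => b k Mb k0 _.
  by rewrite /vector_sum big_seq1 /= etaE // subrr rnorm0 mulr_ge0 // ltW.
pose h := d \o (g \o (g \o d)).
have ih : ideal h by apply: ideal_lmul => //; exact: ideal_lmul.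
have hE x : ip (h x) x = (rnorm (g (d x)) ^+ 2)%:C.
  by rewrite /h /= (adjE _ _ Md) dd (adjE _ _ Mg) gg (ipxx hip).
have ph : opos ip h by move=> x; rewrite hE ler0c sqr_ge0.
have pdh : opos ip (d - h).
  apply: opos_Re => x; rewrite op_subE ipBl !ReImE hE /=; have [/complex_ge0P[i0 _] _] := id1 x.
    by rewrite i0 subrr.
  rewrite subr_ge0.
  have := op_interval_sqr hip x ld id1; rewrite mul1r; apply: le_trans.
  rewrite ler_pXn2r ?nnegrE ?rnorm_ge0 //.
  by have := op_interval_bounded hip ler01 lg ig (d x); rewrite mul1r.
have Eeh : E1 (e + h).
  split; last exact: idealD.
  apply: (op_interval_le op_interval_id).
    by apply: oposD => //; exact: op_interval_pos ie.
  by rewrite opprD addrA.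
have := emax _ Eeh; rewrite addrC addKr => /(_ ph) eh.
have h0 : h = 0 by apply: (@addrI _ e); rewrite eh addr0.
have gd0 x : g (d x) = 0.
  have := hE x; rewrite h0 ip0l => /(congr1 (@complex.Re _)) /= /eqP.
  by rewrite eq_sym sqrf_eq0 => /eqP/rnorm_eq0.
(* Now [c d = d], so that [psi c = psi id], too large for [c]. *)
exfalso.
have cd x : c (d x) = d x.
  by have /eqP := gd0 x; rewrite -[g (d x)]/(d x - c (d x)) subr_eq0 => /eqP <-.
move: pc; rewrite /psi cd -(rnorm2E hip) /t divfK ?gt_eqF //.
have -> : d \o c \o d = d \o d by apply/funext => x /=; rewrite cd.
lra.
Qed.

End PositiveFunctional.

End NormalFunctionals.

(** * Normality of the elements of a predual *)

Section Predual.
Variables (R : realType) (H : completeNormedModType R[i]).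
Local Notation C := R[i].
Variable ip : {dot H for conjC}.
Hypothesis hip : hilbert_inner_product ip.
Variable M : set (H -> H).
Hypothesis hM : von_Neumann_algebra ip M.
Variable X : completeNormedModType C.
Let vn_lin := vn_linear hM.
Let vnA := vn_adj hip hM.
Let vnC := vn_comp hM.
Let vnBB := vnB hM.
Let vnI := vn_id hM.

(** An isometric identification of M with the dual of [X], read as a pairing; it says
    nothing about operators outside M. *)
Definition dual_pairing (pr : (H -> H) -> X -> C^o) :=
  [/\ forall b, M b -> dual (pr b),
      forall c a b, M a -> M b -> pr (c *: a + b) = c *: pr a + pr b,
      forall b k, M b -> 0 <= k -> bounded_by b k <-> bounded_by (pr b) k &
      forall f, dual f -> exists2 b, M b & pr b = f].

Lemma predual_pairing : predual M X -> exists pr, dual_pairing pr.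
Proof.
move=> [Phi [[Phifun Phiinj Phisurj] PhiL Phin]].
pose pr b := xget (fun=> 0) [set f | dual f /\ Phi f = b].
have prP b : M b -> dual (pr b) /\ Phi (pr b) = b.
  move=> /Phisurj[f df fb]; rewrite /pr.
  apply: (@xgetPex _ (fun=> 0) [set f | dual f /\ Phi f = b]); by exists f.
have prE f : dual f -> pr (Phi f) = f.
  move=> df; have [d1 e1] := prP _ (Phifun _ df).
  exact: (Phiinj _ _ (mem_set d1) (mem_set df) e1).
exists pr; split.
- by move=> b /prP[].
- move=> c a b Ma Mb; have [da ea] := prP _ Ma; have [db eb] := prP _ Mb.
  have <- : Phi (c *: pr a + pr b) = c *: a + b by rewrite PhiL // ea eb.
  have dab : dual (c *: pr a + pr b).
    by have [_ dP] := @dual_subspace R X; exact: (dP c (pr a) (pr b) da db).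
  exact: prE.
- move=> b k Mb k0; have [db eb] := prP _ Mb.
  have nE : opnorm (pr b) = opnorm b by rewrite -(Phin _ db) eb.
  split=> [/(opnorm_leP k0 (vn_bounded hM Mb)) h|/(opnorm_leP k0 db) h].
    by apply/(opnorm_leP k0 db); rewrite nE.
  by apply/(opnorm_leP k0 (vn_bounded hM Mb)); rewrite -nE.
- by move=> f df; exists (Phi f); [exact: Phifun|exact: prE].
Qed.

Variable pr : (H -> H) -> X -> C^o.
Hypothesis hpr : dual_pairing pr.

Lemma pr_dual b : M b -> dual (pr b).
Proof. by case: hpr => h _ _ _; exact: h. Qed.

Lemma pr_lin c a b x : M a -> M b -> pr (c *: a + b) x = c * pr a x + pr b x.
Proof. by move=> Ma Mb; case: hpr => _ h _ _; rewrite h. Qed.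

Lemma pr_normP b k : M b -> 0 <= k -> bounded_by b k <-> bounded_by (pr b) k.
Proof. by case: hpr => _ _ h _; exact: h. Qed.

Lemma pr_surj f : dual f -> exists2 b, M b & pr b = f.
Proof. by case: hpr => _ _ _; apply. Qed.

Lemma pr_le b k x : M b -> 0 <= k -> bounded_by b k ->
  cabs (pr b x) <= k * rnorm x.
Proof. by move=> Mb k0 /(pr_normP Mb k0); exact. Qed.

Lemma pr_linear b : M b -> linear (pr b).
Proof. by move=> /pr_dual[]. Qed.

Lemma pr0 x : pr 0 x = 0.
Proof.
have := pr_lin (-1) x (vn0 hM) (vn0 hM).
by rewrite scaler0 addr0 mulN1r addNr.
Qed.

Lemma prZ c a x : M a -> pr (c *: a) x = c * pr a x.
Proof. by move=> Ma; have := pr_lin c x Ma (vn0 hM); rewrite !addr0 pr0 addr0. Qed.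

Lemma prD a b x : M a -> M b -> pr (a + b) x = pr a x + pr b x.
Proof. by move=> Ma Mb; have := pr_lin 1 x Ma Mb; rewrite scale1r mul1r. Qed.

Lemma prB a b x : M a -> M b -> pr (a - b) x = pr a x - pr b x.
Proof.
by move=> Ma Mb; rewrite -scaleN1r addrC pr_lin // mulN1r addrC.
Qed.

Lemma pr_eq0 b : M b -> (forall x, pr b x = 0) -> b = 0.
Proof.
move=> Mb b0; apply/funext => h; apply: rnorm_eq0; apply/eqP.
have /(pr_normP Mb (lexx 0)) b1 : bounded_by (pr b) 0.
  by move=> x; rewrite b0 rnorm0 mul0r.
by rewrite eq_le rnorm_ge0 andbT; have := b1 h; rewrite mul0r.
Qed.

Lemma bounded_by0 : bounded_by (0 : H -> H) 1.
Proof. by move=> h; rewrite rnorm0 mul1r rnorm_ge0. Qed.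

Lemma norming_element x :
  exists u, [/\ M u, bounded_by u 1 & pr u x = (rnorm x)%:C].
Proof.
have [->|x0] := pselect (x = 0).
  exists 0; split; [exact: (vn0 hM)|exact: bounded_by0|].
  by rewrite pr0 rnorm0.
have nx := rnorm_gt0 x0.
have s0 : linear_subspace [set (0 : X)].
  by split=> [//|a u v -> ->]; rewrite scaler0 addr0.
have [//|_ ->|g [dg gp _ gx]] := @dual_separation R X [set 0] x (rnorm x) s0.
  by rewrite subr0.
pose f : X -> C^o := (rnorm x)%:C *: g.
have fE y : f y = (rnorm x)%:C * g y by [].
have df : dual f by exact: (subspaceZ _ (@dual_subspace R X) dg).
have [u Mu uf] := pr_surj df.
exists u; split => //; last by rewrite uf fE gx mulr1.
apply/(pr_normP Mu ler01); rewrite uf => y.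
by rewrite fE mul1r cabsM cabsR gtr0_norm.
Qed.

(** By [op_interval_normP] an order interval corresponds to an intersection of balls
    of the dual of [X], and those are closed for pointwise limits. *)
Lemma interval_pr_lim (U : set_system (H -> H)) (UU : UltraFilter U)
    (g : (H -> H) -> H -> H) b k : 0 <= k -> M b ->
  U [set t | M (g t) /\ op_interval ip k (g t)] ->
  (forall x (e : R), 0 < e -> U [set t | cabs (pr (g t) x - pr b x) < e]) ->
  op_interval ip k b.
Proof.
move=> k0 Mb Ug gb; apply/(op_interval_normP hip k0 (vn_lin Mb)) => n.
have shiftE a : (fun x => a x + shift k n *: x) = shift k n *: (id : H -> H) + a.
  by apply/funext => x; rewrite addrC.
have Msh a : M a -> M (shift k n *: (id : H -> H) + a).
  by move=> Ma; apply: (vn_subspace hM).2.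
rewrite shiftE; apply/(pr_normP (Msh _ Mb) (rnorm_ge0 _)) => x.
rewrite pr_lin // addrC.
apply: (ultra_lim_le UU (gb x)); apply: filterS Ug => t [Mg ig] /=.
rewrite addrC -pr_lin //; apply: pr_le (Msh _ Mg) (rnorm_ge0 _) _.
rewrite -shiftE; exact: (op_interval_normP hip k0 (vn_lin Mg)).1.
Qed.

(** By compactness of the dual ball [pr (d t)] has a pointwise limit [pr b]. As order
    intervals are closed, [b] is positive and below almost every [d t], hence 0:
    the elements of the predual are normal. *)
Lemma vanishing_pr (U : set_system (H -> H)) (d : (H -> H) -> H -> H) k :
  UltraFilter U -> 0 <= k -> vanishing ip M U d k ->
  forall x e, 0 < e -> U [set t | cabs (pr (d t) x) < e].
Proof.
move=> UU k0 [d1 d2 d3].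
have bnd x : U [set t | cabs (pr (d t) x) <= k * rnorm x].
  apply: filterS d1 => t [Mt it]; apply: pr_le => //.
  exact: (op_interval_bounded hip k0 (vn_lin Mt) it).
have [f fP] := choice (fun x => ultra_lim UU (bnd x)).
have lf : linear (f : X -> C^o).
  move=> a u v; apply: (@ultra_lim_uniq _ _ _ UU C^o _ _ _ (fP _)) => e e0.
  apply: filterS2 d1 (@ultra_lim_linear _ _ _ UU C^o _ _ _ _ a (fP u) (fP v) e e0).
  by move=> t [Mt _] /=; rewrite (pr_linear Mt).
have df : dual (f : X -> C^o).
  apply/bounded_operatorsP; split => //; exists k => // x.
  rewrite -[f x]addr0; apply: (@ultra_lim_le _ _ _ UU C^o _ _ _ _ (fP x)).
  by apply: filterS (bnd x) => t /=; rewrite addr0.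
have [b Mb bf] := pr_surj df.
have ib : op_interval ip k b.
  by apply: interval_pr_lim d1 _ => // x e e0; rewrite bf; exact: fP.
have U3 : U [set s | op_interval ip k (d s - b)].
  apply: filterS (filterI d1 d3) => s [[Ms _] Us].
  apply: (@interval_pr_lim U UU (fun t => d s - d t)) => //; first exact: vnBB.
    by apply: filterS (filterI d1 Us) => t [[Mt _] ist]; split => //; exact: vnBB.
  move=> x e e0; apply: filterS (filterI d1 (fP x e e0)) => t [[Mt _]] /= h.
  by rewrite !prB // bf opprB addrC subrKA rnormBC.
have b0 : b = 0.
  apply/funext => x; apply: (op_interval_eq0 hip (vn_lin Mb) ib).
  apply/ler_addgt0Pr => e e0; rewrite add0r.
  have [s [/= s3 s2]] := filter_ex (filterI U3 (d2 x e e0)).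
  have [/complex_ge0P[_]] := s3 x; rewrite op_subE ipBl !ReImE; lra.
move=> x e e0; apply: filterS (fP x e e0) => t /=.
by rewrite -bf b0 pr0 subr0.
Qed.

(** The vector on the left is [z + u (h - w)] with [w] the image of [z] under the
    adjoint of [u]. *)
Lemma contraction_coisometry u h z : M u -> bounded_by u 1 ->
  rnorm (u h + (z - u (adj ip u z))) ^+ 2 <= rnorm h ^+ 2 + rnorm z ^+ 2.
Proof.
move=> Mu u1; set w := adj ip u z.
have -> : u h + (z - u w) = z + u (h - w).
  by rewrite (linB (vn_lin Mu)) addrCA.
have E : ip z (u (h - w)) = ip w (h - w) by rewrite (adj_vnE' hip hM _ _ Mu).
rewrite (rnormD2 hip) E ipBr !ReImE -(rnorm2E hip).
have : rnorm (u (h - w)) ^+ 2 <= rnorm (h - w) ^+ 2.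
  by rewrite ler_pXn2r ?nnegrE ?rnorm_ge0 //; have := u1 (h - w); rewrite mul1r.
rewrite (rnormB2 hip) (ipC _ w h) ReJ.
have := sqr_ge0 (rnorm w); lra.
Qed.

(** Let [c] be the difference of the two operators. By [contraction_coisometry] the
    norm of [u + t c] is [1 + O(t^2)], so a nonzero value of [pr c x] would make
    [pr (u + t c) x] larger than the norm of [x] allows, for small [t]. *)
Lemma norming_range x u b : M u -> bounded_by u 1 -> pr u x = (rnorm x)%:C ->
  M b -> pr b x = pr (u \o (adj ip u \o b)) x.
Proof.
move=> Mu u1 ux Mb.
have Muub : M (u \o (adj ip u \o b)) by apply: vnC => //; apply: vnC => //; exact: vnA.
apply/eqP; rewrite -subr_eq0 -prB //; apply/eqP.
set c := (b - _); have Mc : M c by exact: vnBB.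
have [x0|x0] := pselect (x = 0); first by rewrite x0 (lin0 (pr_linear Mc)).
have k0 := rnorm_gt0 x0; set k := rnorm x in ux k0.
have [l l0 bl] := vn_boundedP hM Mb.
have bound (t : C) : cabs (k%:C + t * pr c x) ^+ 2 <= (1 + cabs t ^+ 2 * l ^+ 2) * k ^+ 2.
  have r0 : 0 <= 1 + cabs t ^+ 2 * l ^+ 2 by apply: addr_ge0 => //; apply: mulr_ge0; exact: sqr_ge0.
  rewrite -(sqr_sqrtr r0) -exprMn ler_pXn2r ?nnegrE ?rnorm_ge0 //; last first.
    by rewrite mulr_ge0 ?sqrtr_ge0 ?ltW.
  rewrite -ux addrC -pr_lin //; apply: pr_le; rewrite ?sqrtr_ge0 //.
    by apply: (vn_subspace hM).2.
  move=> h; rewrite -(@ler_pXn2r _ 2) ?nnegrE ?mulr_ge0 ?rnorm_ge0 ?sqrtr_ge0 //.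
  rewrite exprMn sqr_sqrtr //.
  have -> : (t *: c + u) h = u h + (t *: b h - u (adj ip u (t *: b h))).
    rewrite (linZ (vn_lin (vnA Mu))) (linZ (vn_lin Mu)) -scalerBr.
    by rewrite -[LHS]/(t *: c h + u h) addrC.
  apply: le_trans (contraction_coisometry _ _ Mu u1) _.
  rewrite mulrDl mul1r lerD2l rnormZ exprMn -[leRHS]mulrA -[X in _ <= _ * X]exprMn.
  rewrite ler_wpM2l ?sqr_ge0 //.
  by rewrite ler_pXn2r ?nnegrE ?mulr_ge0 ?rnorm_ge0.
set z := pr c x in bound *; set n := cabs z ^+ 2.
apply: (@rnorm_eq0 _ C^o); apply/eqP; rewrite -sqrf_eq0 -/n eq_le sqr_ge0 andbT.
rewrite leNgt; apply/negP => n0.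
pose q := l ^+ 2 * k ^+ 2 + 1.
have q0 : 0 < q by apply: ltr_wpDl => //; apply: mulr_ge0; exact: sqr_ge0.
pose s := k / q.
have s0 : 0 < s by rewrite divr_gt0.
have := bound (s%:C * (z^*)%C).
rewrite -mulrA [_^*%C * _]mulrC -cabs_mulJ -/n -rmorphM -rmorphD cabsR /=.
rewrite real_normK ?num_real // cabsM cabs_conj exprMn -/n cabsR real_normK ?num_real //.
move=> h.
have : s * n * (2 * k + s * n) <= s * n * (s * (l ^+ 2 * k ^+ 2)).
  move: h; lra.
have sn : 0 < s * n by rewrite mulr_gt0.
rewrite (ler_pM2l sn).
have : s * (l ^+ 2 * k ^+ 2) <= k.
  by rewrite /s mulrAC ler_pdivrMr // ler_wpM2l ?(ltW k0) // /q lerDl.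
lra.
Qed.

End Predual.

(** * Uniqueness of the predual *)

Section PredualUnique.
Variables (R : realType) (H : completeNormedModType R[i]).
Local Notation C := R[i].
Variable ip : {dot H for conjC}.
Hypothesis hip : hilbert_inner_product ip.
Variable M : set (H -> H).
Hypothesis hM : von_Neumann_algebra ip M.
Variable X : completeNormedModType C.
Variable pr : (H -> H) -> X -> C^o.
Hypothesis hpr : dual_pairing M pr.
Let vn_lin := vn_linear hM.
Let vnA := vn_adj hip hM.
Let vnC := vn_comp hM.
Let vnI := vn_id hM.

(** The scalar counterpart of [op_interval_normP]. *)
Lemma scalar_interval_ge0 (z : C) (k K : R) : 0 <= k -> 0 <= K ->
  (forall n, cabs (z + shift k n * K%:C) <= cabs (shift k n) * K) -> 0 <= z.
Proof.
move=> k0 K0 h.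
have {}h n : (complex.Re z ^+ 2 - k * K * complex.Re z + complex.Im z ^+ 2) +
   n * (2 * K * complex.Im z) <= 0.
  have := h n; rewrite -(@ler_pXn2r _ 2) ?nnegrE ?mulr_ge0 ?rnorm_ge0 //.
  rewrite exprMn cabs_shift cabs_sqr !ReImE /shift /=; lra.
have [im h1] := affine_le0 h.
have im0 : complex.Im z = 0.
  apply/eqP; apply: contrapT => /negP iz.
  move: im => /eqP; rewrite !mulf_eq0 (negPf iz) pnatr_eq0 /= orbF => /eqP K1.
  move: h1; rewrite K1 mulr0 mul0r subr0.
  have : 0 < complex.Im z ^+ 2 by rewrite lt_def sqrf_eq0 iz sqr_ge0.
  have := sqr_ge0 (complex.Re z); lra.
apply/complex_ge0P; split => //; rewrite leNgt; apply/negP => rz.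
have r2 : 0 < complex.Re z ^+ 2 by rewrite lt_def sqrf_eq0 lt_eqF // sqr_ge0.
have : k * K * complex.Re z <= 0 by rewrite mulr_ge0_le0 ?mulr_ge0 // ltW.
by have := sqr_ge0 (complex.Im z); lra.
Qed.

Let polar u w : H -> H := u + w *: (id : H -> H).

Let polarM u w : M u -> M (polar u w).
Proof. by move=> Mu; exact: (vnD hM Mu (vnZ hM w vnI)). Qed.

Let polar_adj u w : M u -> adj ip (polar u w) = adj ip u + (w^*)%C *: (id : H -> H).
Proof.
move=> Mu; rewrite /polar addrC (adj_lin hip hM _ vnI Mu) addrC.
by rewrite (adj_interval hip hM vnI (op_interval_id hip)).
Qed.

(** The polarisation identity
    [4 u d = sum_w w (u + w) d (u + w)^*], with [w] over the fourth roots of 1. *)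
Lemma polarization u d x : M u -> M d ->
  4 * pr (u \o d) x =
    pr (polar u 1 \o d \o adj ip (polar u 1)) x
    + 'i * pr (polar u 'i \o d \o adj ip (polar u 'i)) x
    - pr (polar u (-1) \o d \o adj ip (polar u (-1))) x
    - 'i * pr (polar u (- 'i) \o d \o adj ip (polar u (- 'i))) x.
Proof.
move=> Mu Md; have Mu' := vnA Mu.
have M1 := vnC Mu (vnC Md Mu'); have M2 := vnC Mu Md; have M3 := vnC Md Mu'.
have E w : pr (polar u w \o d \o adj ip (polar u w)) x =
    pr (u \o (d \o adj ip u)) x + (w^*)%C * pr (u \o d) x
    + (w * pr (d \o adj ip u) x + w * (w^*)%C * pr d x).
  have -> : polar u w \o d \o adj ip (polar u w) =
      ((w^*)%C *: (u \o d) + (u \o (d \o adj ip u))) +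
      (w *: (d \o adj ip u) + (w * (w^*)%C) *: d).
    rewrite polar_adj //; apply/funext => h.
    rewrite -[LHS]/(u (d (adj ip u h + (w^*)%C *: h)) + w *: d (adj ip u h + (w^*)%C *: h)).
    rewrite (linD (vn_lin Md)) (linZ (vn_lin Md)) (linD (vn_lin Mu)) (linZ (vn_lin Mu)).
    by rewrite scalerDr scalerA (addrC (u (d (adj ip u h)))).
  have M4 : M ((w^*)%C *: (u \o d) + (u \o (d \o adj ip u))) by apply: (vn_subspace hM).2.
  have M5 := vnZ hM (w * (w^*)%C) Md; have M6 := vnZ hM w M3.
  have M7 := vnD hM M6 M5.
  rewrite (prD hpr) // (prD hpr _ M6 M5) !(prZ hM hpr) // (pr_lin hpr) //.
  by rewrite [_ * pr _ x + pr _ x]addrC.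
have c1 : ((1 : C)^*)%C = 1 by rewrite conjc1.
have c2 : (('i : C)^*)%C = - 'i by apply: complex_ext; rewrite /= ?oppr0.
have c3 : ((- 1 : C)^*)%C = - 1 by apply: complex_ext; rewrite /= ?oppr0 ?opprK.
have c4 : ((- 'i : C)^*)%C = 'i by apply: complex_ext; rewrite /= ?oppr0 ?opprK.
rewrite !E c1 c2 c3 c4.
have gen (i A B D E' : C) : i * i = -1 -> 4 * B =
    A + 1 * B + (1 * D + 1 * 1 * E') + i * (A + - i * B + (i * D + i * - i * E'))
    - (A + - 1 * B + (- 1 * D + - 1 * - 1 * E'))
    - i * (A + i * B + (- i * D + - i * i * E')).
  by move=> ii; ring: ii.
by apply: gen; rewrite -expr2 sqr_i.
Qed.

(** At a contraction [u] where [x] attains its norm, [x (u .)] attains its norm at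
    the identity, hence is positive; it is normal by polarisation. *)
Lemma norming_normal_positive x u : M u -> bounded_by u 1 ->
  pr u x = (rnorm x)%:C -> normal_positive ip M (fun b => pr (u \o b) x).
Proof.
move=> Mu u1 ux; split.
- move=> c a b Ma Mb.
  have -> : u \o (c *: a + b) = c *: (u \o a) + (u \o b).
    by apply/funext => h; exact: (vn_lin Mu).
  by rewrite (pr_lin hpr) //; exact: vnC.
- move=> a k Ma k0 ia; apply: (scalar_interval_ge0 k0 (rnorm_ge0 x)) => n.
  have Ms : M (shift k n *: (id : H -> H) + a) by apply: (vn_subspace hM).2.
  have Mua := vnC Mu Ma.
  have bs : bounded_by (shift k n *: (id : H -> H) + a) (cabs (shift k n)).
    move=> h; rewrite -[(_ + a) h]/(shift k n *: h + a h) addrC.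
    exact: (op_interval_normP hip k0 (vn_lin Ma)).1.
  rewrite -ux addrC -(pr_lin hpr) //.
  apply: (pr_le hpr); rewrite ?rnorm_ge0 //.
    by apply: (vn_subspace hM).2.
  have -> : shift k n *: u + (u \o a) = u \o (shift k n *: (id : H -> H) + a).
    by apply/funext => h; rewrite /= (vn_lin Mu).
  move=> h /=; apply: le_trans (u1 _) _; rewrite mul1r; exact: bs.
- move=> U d k UU k0 vd e e0.
  have term w : U [set t | cabs (pr (polar u w \o d t \o adj ip (polar u w)) x) < e / 2].
    have Mw := polarM w Mu.
    have [c c0 wc] := vn_boundedP hM (vnA Mw).
    have vw := vanishing_conj hip hM UU Mw k0 wc vd.
    apply: (vanishing_pr hip hM hpr UU _ vw); last by rewrite divr_gt0.
    by rewrite mulr_ge0 ?sqr_ge0.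
  case: (vd) => d1 _ _.
  apply: filterS (filterI d1 (filterI (filterI (term 1) (term 'i))
    (filterI (term (- 1)) (term (- 'i))))) => t [[Mt _] [[t1 t2] [t3 t4]]] /=.
  have p := polarization x Mu Mt.
  have : 4 * cabs (pr (u \o d t) x) < 4 * e; last by lra.
  have -> : 4 * cabs (pr (u \o d t) x) = cabs (4 * pr (u \o d t) x).
    by rewrite cabsM -(rmorph_nat (real_complex R)) /= cabsR ger0_norm.
  rewrite p.
  have ci (z : C) : cabs ('i * z) = cabs z by rewrite cabsM cabs_i mul1r.
  apply: le_lt_trans (rnormB _ _) _; rewrite ci.
  have h1 := rnormB (pr (polar u 1 \o d t \o adj ip (polar u 1)) x
    + 'i * pr (polar u 'i \o d t \o adj ip (polar u 'i)) x : C^o)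
    (pr (polar u (-1) \o d t \o adj ip (polar u (-1))) x).
  have h2 := rnormD (pr (polar u 1 \o d t \o adj ip (polar u 1)) x : C^o)
    ('i * pr (polar u 'i \o d t \o adj ip (polar u 'i)) x).
  rewrite ci in h2.
  apply: le_lt_trans (lerD h1 (lexx _)) _.
  apply: le_lt_trans (lerD (lerD h2 (lexx _)) (lexx _)) _.
  move: t1 t2 t3 t4 => /=; lra.
Qed.

(** By [norming_range] every element of the predual is a translate of a normal
    positive functional. *)
Theorem predual_vector_limit x : vector_limit ip M (fun b => pr b x).
Proof.
have [u [Mu u1 ux]] := norming_element hM hpr x.
have nphi := norming_normal_positive Mu u1 ux.
have vphi := normal_positive_vector_limit hip hM nphi.
have vu := vector_limit_lmul hip hM (vnA Mu) vphi.
move=> e /vu[s hs]; exists s => b k Mb k0 bk.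
by rewrite (norming_range hip hM hpr Mu u1 ux Mb); exact: hs.
Qed.

Section VectorFunctionals.

Let W : lmodType C := (H -> H) -> C^o.
(** [p] is the norm of functionals on M, as a seminorm on the functions that are
    bounded on the unit ball of M. *)
Let D : set W := [set F | exists k, forall b, M b -> bounded_by b 1 -> cabs (F b) <= k].
Let p (F : W) : R := sup [set cabs (F b) | b in [set b | M b /\ bounded_by b 1]].
Let omega (h k : H) : W := fun b => ip (b h) k.

Let p_le F k : (forall b, M b -> bounded_by b 1 -> cabs (F b) <= k) -> p F <= k.
Proof.
move=> Fk; apply: ge_sup.
  by exists (cabs (F 0)), 0 => //; split; [exact: (vn0 hM)|exact: bounded_by0].
by move=> _ [b [Mb b1] <-]; exact: Fk.
Qed.

Let le_p F b : D F -> M b -> bounded_by b 1 -> cabs (F b) <= p F.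
Proof.
move=> [k Fk] Mb b1; apply: ub_le_sup; last by exists b.
by exists k => _ [c [Mc c1] <-]; exact: Fk.
Qed.

Let p_ge0 F : D F -> 0 <= p F.
Proof.
move=> DF; apply: le_trans (rnorm_ge0 (F 0)) _.
by apply: le_p => //; [exact: (vn0 hM)|exact: bounded_by0].
Qed.

Let subD : linear_subspace D.
Proof.
split; first by exists 0 => b _ _; rewrite rnorm0.
move=> a F G [k Fk] [l Gl]; exists (cabs a * k + l) => b Mb b1.
apply: le_trans (rnormD _ _) _; apply: lerD; last exact: Gl.
by rewrite rnormZ ler_wpM2l ?rnorm_ge0 //; exact: Fk.
Qed.

Let pD F G : D F -> D G -> p (F + G) <= p F + p G.
Proof.
move=> DF DG; apply: p_le => b Mb b1; apply: le_trans (rnormD _ _) _.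
by apply: lerD; exact: le_p.
Qed.

Let pZ a F : D F -> p (a *: F) = cabs a * p F.
Proof.
move=> DF.
have le c G : D G -> p (c *: G) <= cabs c * p G.
  move=> DG; apply: p_le => b Mb b1; rewrite -[(c *: G) b]/(c *: G b) rnormZ.
  by rewrite ler_wpM2l ?rnorm_ge0 //; exact: le_p.
apply/eqP; rewrite eq_le le //=.
have [->|a0] := eqVneq a 0.
  by rewrite rnorm0 mul0r p_ge0 //; exact: (subspaceZ 0 subD DF).
have n0 : 0 < cabs a by apply: rnorm_gt0; exact/eqP.
have := le a^-1 _ (subspaceZ a subD DF); rewrite scalerA mulVf // scale1r.
have -> : cabs a^-1 = (cabs a)^-1.
  apply: (@mulfI _ (cabs a)); first by rewrite gt_eqF.
  by rewrite -cabsM !mulfV ?cabs1 // gt_eqF.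
by rewrite mulrC ler_pdivlMr // mulrC.
Qed.

Let pB F G : D F -> D G -> p (F - G) <= p F + p G.
Proof.
move=> DF DG; rewrite -scaleN1r.
have := pD DF (subspaceZ (-1) subD DG).
by rewrite (pZ _ DG) rnormN cabs1 mul1r.
Qed.

Let omegaD h k : D (omega h k).
Proof.
exists (rnorm h * rnorm k) => b Mb b1.
apply: le_trans (cauchy_schwarz hip _ _) _; rewrite ler_wpM2r ?rnorm_ge0 //.
by have := b1 h; rewrite mul1r.
Qed.

Let p_omega h k : p (omega h k) <= rnorm h * rnorm k.
Proof.
apply: p_le => b Mb b1.
apply: le_trans (cauchy_schwarz hip _ _) _; rewrite ler_wpM2r ?rnorm_ge0 //.
by have := b1 h; rewrite mul1r.
Qed.

Let J (x : X) : W := fun b => pr b x.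

Let JD x : D (J x).
Proof. by exists (1 * rnorm x) => b Mb b1; exact: (pr_le hpr). Qed.

Let J_norm x F : D F -> (forall b, M b -> F b = pr b x) -> rnorm x <= p F.
Proof.
move=> DF FE; have [u [Mu u1 ux]] := norming_element hM hpr x.
have := le_p DF Mu u1; rewrite FE // ux cabsR ger0_norm //.
exact: rnorm_ge0.
Qed.

(** The elements of the predual form a complete, hence closed, subspace. If it did not
    contain this vector functional, some bounded functional would vanish on it and
    not on the vector functional. Restricted to vector functionals it is given by
    an operator T, which commutes with the commutant and so lies in M. By
    [predual_vector_limit] the values of T on the predual are those of the
    functional, namely 0; hence T = 0, a contradiction. *)
Theorem vector_functional_in_predual h k :
  exists x, forall b, M b -> pr b x = ip (b h) k.
Proof.
apply: contrapT => /forallNP nx.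
pose Y : set W := [set F | exists x, forall b, M b -> F b = pr b x].
have subY : linear_subspace Y.
  split.
    by exists 0 => b Mb; rewrite (lin0 (pr_linear hpr Mb)).
  move=> a F G [x Fx] [y Gy]; exists (a *: x + y) => b Mb.
  by rewrite (pr_linear hpr Mb) -Fx // -Gy.
have YD : Y `<=` D.
  move=> F [x Fx]; exists (1 * rnorm x) => b Mb b1.
  by rewrite Fx //; exact: (pr_le hpr).
have [d d0 dY] : exists2 d, 0 < d & forall F, Y F -> d <= p (omega h k - F).
  apply: contrapT => nd.
  have near (n : nat) : exists x, p (omega h k - J x) < n.+1%:R^-1.
    apply: contrapT => /forallNP nn; apply: nd; exists (n.+1%:R^-1).
      exact: inv_succ_gt0.
    move=> F [x Fx]; rewrite leNgt; apply/negP => lt; apply: (nn x).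
    apply: le_lt_trans lt; apply: p_le => b Mb b1.
    have -> : (omega h k - J x) b = (omega h k - F) b.
      by rewrite -[LHS]/(omega h k b - pr b x) -Fx.
    apply: le_p => //; apply: (subspaceB subD) => //.
    by apply: YD; exists x.
  have [x xn] := choice near.
  have DoJ y : D (omega h k - J y) by exact: (subspaceB subD).
  have [|l xl] := @complete_filter _ X nat \oo x _.
    move=> e e0; have e20 : 0 < e / 2 by rewrite divr_gt0.
    have [N Ne] := inv_succ_small e20.
    have small n : (N <= n)%N -> p (omega h k - J (x n)) < e / 2.
      move=> Nn; apply: lt_trans (xn n) _; apply: le_lt_trans Ne.
      by rewrite lef_pV2 ?posrE ?ltr0n // ler_nat ltnS.
    exists [set n | (N <= n)%N]; split; first by exists N.
    move=> m n /small hm /small hn.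
    apply: le_lt_trans (_ : p ((omega h k - J (x n)) - (omega h k - J (x m))) < _).
      apply: J_norm; first exact: (subspaceB subD).
      move=> b Mb; rewrite -[LHS]/((omega h k b - pr b (x n)) - (omega h k b - pr b (x m))).
      by rewrite opprB addrC subrKA (linB (pr_linear hpr Mb)).
    apply: le_lt_trans (_ : p (omega h k - J (x n)) + p (omega h k - J (x m)) < _); last by lra.
    exact: pB.
  have eq1 b : M b -> bounded_by b 1 -> pr b l = ip (b h) k.
    move=> Mb b1; apply/eqP; rewrite -subr_eq0; apply/eqP.
    apply: (@rnorm_eq0 _ C^o); apply/eqP; rewrite eq_le rnorm_ge0 andbT.
    apply/ler_addgt0Pr => e e0; rewrite add0r.
    have e20 : 0 < e / 2 by rewrite divr_gt0.
    have [N Ne] := inv_succ_small e20.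
    have oN : \oo [set n | (N <= n)%N] by exists N.
    have [n [/= n1 n2]] := filter_ex (filterI (xl _ e20) oN).
    have h1 : cabs (omega h k b - pr b (x n)) <= e / 2.
      apply: le_trans (le_p (DoJ (x n)) Mb b1) _; apply: ltW.
      apply: lt_trans (xn n) _; apply: le_lt_trans Ne.
      by rewrite lef_pV2 ?posrE ?ltr0n // ler_nat ltnS.
    have h2 : cabs (pr b (x n - l)) <= e / 2.
      apply: le_trans (pr_le hpr _ Mb ler01 b1) _; rewrite mul1r; exact: ltW.
    rewrite rnormBC.
    have -> : ip (b h) k - pr b l = (omega h k b - pr b (x n)) + pr b (x n - l).
      by rewrite (linB (pr_linear hpr Mb)) subrKA.
    apply: le_trans (rnormD _ _) _; lra.
  apply: (nx l) => b Mb; have [c c0 bc] := vn_boundedP hM Mb.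
  have c1 : 0 < c + 1 by rewrite ltr_wpDl.
  have cn0 : (c + 1)^-1%:C != 0 :> C by rewrite eq_complex /= eqxx andbT invr_eq0 gt_eqF.
  have Mcb := vnZ hM (c + 1)^-1%:C Mb.
  apply: (@mulfI _ (c + 1)^-1%:C) => //.
  rewrite -(prZ hM hpr) // eq1 // -?ipZl // => z.
  rewrite -[(_ *: b) z]/((c + 1)^-1%:C *: b z) rnormZ cabsR gtr0_norm ?invr_gt0 //.
  rewrite mul1r mulrC ler_pdivrMr // mulrC; apply: le_trans (bc z) _.
  by rewrite ler_wpM2r ?rnorm_ge0 // lerDl.
have [g [gL gp gY gw]] := hahn_banach_separation subD pD pZ subY YD (omegaD h k) d0 dY.
have gE F G : D F -> D G -> (forall b, M b -> F b = G b) -> g F = g G.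
  move=> DF DG FG; have DB := subspaceB subD DF DG.
  have gB : g (F - G) = g F - g G.
    by rewrite -scaleN1r addrC gL // mulN1r addrC.
  apply/eqP; rewrite -subr_eq0 -gB; apply/eqP; apply: (@rnorm_eq0 _ C^o).
  apply/eqP; rewrite eq_le rnorm_ge0 andbT -(ler_pM2l d0) mulr0.
  apply: le_trans (gp _ DB) _; apply: p_le => b Mb b1.
  by rewrite -[(F - G) b]/(F b - G b) FG // subrr rnorm0.
have riesz v : exists y, forall z, g (omega v z) = ip y z.
  have sH : linear_subspace [set: H] by split.
  have idL a (u u' : H) : setT u -> setT u' -> id (a *: u + u') = a *: id u + id u' by [].
  pose L z : C := (g (omega v z))^*%C.
  have LL a u u' : setT u -> setT u' -> L (a *: u + u') = a * L u + L u'.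
    move=> _ _; rewrite /L.
    have -> : omega v (a *: u + u') = (a^*)%C *: omega v u + omega v u'.
      by apply/funext => b; rewrite /omega ipDr ipZr.
    by rewrite gL // rmorphD rmorphM /= conjcK.
  have [u _|y [_ yE]] := riesz_variational hip (k := rnorm v / d) sH idL LL.
    rewrite /L cabs_conj mulrAC ler_pdivlMr // mulrC.
    by apply: le_trans (gp _ (omegaD v u)) _; exact: p_omega.
  by exists y => z; rewrite (ipC _ y) -yE // conjcK.
have [T TE] := choice riesz.
have bT : bounded_operators T.
  apply/bounded_operatorsP; split.
    move=> a u v; apply/eqP; rewrite -subr_eq0; apply/eqP; apply: (ip_eq0 hip) => z.
    rewrite ipBl ipDl ipZl -!TE -gL //; apply/eqP; rewrite subr_eq0; apply/eqP.
    apply: gE => //; first by apply: subD.2.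
    by move=> b Mb; rewrite /omega (vn_lin Mb) ipDl ipZl.
  exists d^-1; first by rewrite invr_ge0 ltW.
  move=> v; have [->|Tv0] := pselect (T v = 0).
    by rewrite rnorm0 mulr_ge0 ?rnorm_ge0 // invr_ge0 ltW.
  have n0 := rnorm_gt0 Tv0.
  rewrite mulrC ler_pdivlMr // -(ler_pM2r n0).
  apply: le_trans (p_omega v (T v)); apply: le_trans (gp _ (omegaD v (T v))).
  rewrite TE (ipxx hip) cabsR ger0_norm ?sqr_ge0 //.
  by rewrite expr2 mulrAC mulrC.
have MT : M T.
  apply: (vn_bicommutant hM) => // b Kb; apply/funext => v /=.
  have [b' Kb' bb'] := commutant_adj hip hM Kb.
  apply/eqP; rewrite -subr_eq0; apply/eqP; apply: (ip_eq0 hip) => z.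
  rewrite ipBl bb' -!TE; apply/eqP; rewrite subr_eq0; apply/eqP.
  apply: gE => // m Mm; rewrite /omega -bb'; congr (ip _ z).
  by case: Kb => _ /(_ _ Mm) /(congr1 (fun f => f v)) /=.
have T0 : T = 0.
  apply: (pr_eq0 hpr) => // x.
  have [c c0 Tc] := vn_boundedP hM MT.
  apply: (@rnorm_eq0 _ C^o); apply/eqP; rewrite eq_le rnorm_ge0 andbT.
  apply/ler_addgt0Pr => e e0; rewrite add0r.
  have q0 : 0 < d^-1 + c by rewrite ltr_pwDl ?invr_gt0.
  have e1 : 0 < e / (d^-1 + c) by rewrite divr_gt0.
  have [s hs] := @predual_vector_limit x _ e1.
  have gs : g (vector_sum ip s : W) = vector_sum ip s T /\ D (vector_sum ip s : W).
    rewrite /vector_sum; elim: (s) => [|[v z] s' [IH1 IH2]].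
      have -> : (fun b => \sum_(z <- [::]) ip (b z.1) z.2) = (0 : W).
        by apply/funext => b; rewrite big_nil.
      rewrite big_nil; split; last exact: subD.1.
      by apply: gY; exists 0 => b Mb; rewrite (lin0 (pr_linear hpr Mb)).
    have -> : (fun b => \sum_(z <- (v, z) :: s') ip (b z.1) z.2) =
       1 *: omega v z + (fun b => \sum_(z <- s') ip (b z.1) z.2).
      by apply/funext => b; rewrite big_cons scale1r.
    by split; [rewrite gL // mul1r IH1 big_cons /= TE|apply: subD.2].
  have [gs1 Ds] := gs.
  have gJ : g (J x) = 0 by apply: gY; exists x.
  have gB : g (J x - (vector_sum ip s : W)) = - vector_sum ip s T.
    by rewrite -scaleN1r addrC gL // mulN1r gJ addr0 gs1.
  have DB := subspaceB subD (JD x) Ds.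
  have h1 : cabs (vector_sum ip s T) <= e / (d^-1 + c) * d^-1.
    rewrite ler_pdivlMr // mulrC -[vector_sum ip s T]opprK rnormN -gB.
    apply: le_trans (gp _ DB) _; apply: p_le => b Mb b1.
    by have := hs b 1 Mb ler01 b1; rewrite mulr1.
  have h2 := hs T c MT c0 Tc.
  rewrite -[pr T x](subrK (vector_sum ip s T)).
  apply: le_trans (rnormD _ _) _.
  have -> : e = e / (d^-1 + c) * c + e / (d^-1 + c) * d^-1.
    by rewrite -mulrDr [c + _]addrC divfK // gt_eqF.
  exact: lerD.
have := TE h k; rewrite gw T0 -[(0 : H -> H) h]/(0 : H) ip0l => /eqP.
by rewrite oner_eq0.
Qed.

End VectorFunctionals.
End PredualUnique.

(** * Weak compactness and Sigma-subspaces *)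

Section WeakCompactness.
Variables (R : realType) (X : completeNormedModType R[i]).
Local Notation C := R[i].

(** Every weak neighbourhood of 0 contains all but finitely many points of [K]. *)
Lemma weakly_compact_null (K : set X) : K 0 ->
  (forall f : X -> C^o, dual f -> forall e : R, 0 < e ->
     finite_set [set m | K m /\ e <= rnorm (f m)]) ->
  weakly_compact K.
Proof.
move=> K0 Kf.
pose W := initial_topology (@evaluation R X).
pose G : set_system X := [set B | finite_set (K `\` B)].
have FG : Filter G.
  split=> [|A B|A B AB]; rewrite /G /=.
  - by rewrite setDT.
  - by rewrite setDIr finite_setU.
  - by apply: sub_finite_set => x [Kx nBx]; split => // /AB.
have evG : (@evaluation R X) @ G --> (@evaluation R X 0 : {ptws {f | @dual R X f} -> C^o}).
  apply/cvg_sup => i B /= [_ [[A oA <-] A0 AB]].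
  have : (fun k => sval i k) @ G --> sval i 0.
    apply/cvgrPdist_lt => e e0.
    have re0 : 0 < complex.Re e by move: e0; rewrite ltcE => /andP[_].
    have ee : e = (complex.Re e)%:C by rewrite RRe_real // gtr0_real.
    have di : dual (sval i) by exact: svalP.
    suff : finite_set (K `\` [set k | `|sval i 0 - sval i k| < e]) by [].
    apply: sub_finite_set; last exact: (Kf _ di _ re0).
    move=> m [Km /= nm]; split => //.
    rewrite leNgt; apply/negP => lt; apply: nm.
    by rewrite (lin0 di.1) sub0r normrN ee -rnormE ltcR.
  move=> /(_ A); have nA : nbhs (sval i 0) A by apply: open_nbhs_nbhs; split.
  move=> /(_ nA) GA; suff : G ((@evaluation R X) @^-1` B) by [].
  by apply: (@filterS _ G FG _ _ _ GA) => k Ak; apply: AB.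
have finW (B : set W) : nbhs (0 : W) B -> finite_set (K `\` B).
  rewrite nbhsE => -[_ [[A oA <-] A0] AB].
  have nA : nbhs (@evaluation R X 0 : {ptws {f | @dual R X f} -> C^o}) A.
    by apply: open_nbhs_nbhs; split.
  apply: sub_finite_set; last exact: (evG _ nA).
  move=> x [Kx nBx]; split => // Ax.
  by apply: nBx; exact: AB.
move=> F PF FK.
have [c0|] := pselect (cluster F (0 : W)); first by exists 0.
move=> /existsNP[A /existsNP[B /not_implyP[FA /not_implyP[nB AB]]]].
have fAK : finite_set (K `\` B) by exact: finW.
have FKB : F (K `\` B).
  apply: filterS (filterI FK FA) => x [Kx Ax]; split => // Bx.
  by apply: AB; exists x.
have [x [[Kx _] cx]] := @finite_compact W _ fAK F PF FKB.
by exists x.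
Qed.

End WeakCompactness.

Section Countability.

Lemma countable_closure (T : Type) (r : T -> T -> Prop) (A : set T) :
  countable A -> (forall x, countable [set y | r x y]) ->
  exists B, [/\ countable B, A `<=` B & forall x y, B x -> r x y -> B y].
Proof.
move=> cA cr.
pose step n := iter n (fun B : set T => \bigcup_(x in B) [set y | r x y]) A.
exists (\bigcup_n step n); split.
- apply: countable_bigcup_nat; elim=> [|n IHn] //=.
  exact: bigcup_countable.
- by move=> x Ax; exists 0%N.
- by move=> x y [n _ Bx] rxy; exists n.+1 => //; exists x.
Qed.

End Countability.

Section SigmaSubspaces.
Variables (R : realType) (X : completeNormedModType R[i]).
Local Notation C := R[i].

Definition countably_supported (N : set X) : set (X -> C^o) :=
  [set f | dual f /\ countable [set m | N m /\ f m <> 0]].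

Lemma countably_supported_subspace (N : set X) :
  linear_subspace (countably_supported N).
Proof.
split.
  split; first by have [d0 _] := @dual_subspace R X; exact: d0.
  rewrite (_ : [set m | _] = set0); first exact: countable0.
  by apply/seteqP; split=> // m [].
move=> a f g [df cf] [dg cg].
have dfg : dual (a *: f + g).
  by have [_ dP] := @dual_subspace R X; exact: (dP a f g df dg).
split; first exact: dfg.
apply: (@countable_subset _ _ ([set m | N m /\ f m <> 0] `|` [set m | N m /\ g m <> 0])).
  move=> m [Nm]; rewrite -[(a *: f + g) m]/(a *: f m + g m) => fg.
  have [f0|f0] := pselect (f m = 0); last by left.
  right; split => // g0; apply: fg; by rewrite f0 g0 scaler0 addr0.
by rewrite -bigcup2E; apply: bigcup_countable => // -[|[|n]] _ //=.
Qed.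

Lemma norm_from_le (D : set (X -> C^o)) (x : X) : D `<=` @dual R X ->
  has_ubound [set rnorm (f x) | f in [set f | D f /\ opnorm f <= 1]] /\
  norm_from D x <= rnorm x.
Proof.
move=> Dd.
have ub : ubound [set rnorm (f x) | f in [set f | D f /\ opnorm f <= 1]] (rnorm x).
  move=> _ [f [Df f1] <-].
  apply: le_trans (bounded_by_opnorm (Dd _ Df) x) _.
  by rewrite ler_piMl ?rnorm_ge0.
split; first by exists (rnorm x).
rewrite /norm_from; have [A0|/set0P/negP/negbNE/eqP ->] :=
    pselect ([set rnorm (f x) | f in [set f | D f /\ opnorm f <= 1]] !=set0).
  exact: ge_sup.
by rewrite sup0 rnorm_ge0.
Qed.

Lemma one_norming_approx (D : set (X -> C^o)) : D `<=` @dual R X ->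
  (forall x (e : R), 0 < e -> exists f, [/\ D f, bounded_by f 1 &
     rnorm x - e <= rnorm (f x)]) ->
  one_norming D.
Proof.
move=> Dd Dn x; have [ub le] := norm_from_le x Dd.
apply/eqP; rewrite eq_le le /=; apply/ler_addgt0Pr => e e0.
have [f [Df f1 fe]] := Dn x e e0.
rewrite -lerBlDr; apply: le_trans fe _; apply: ub_le_sup => //.
by exists f => //; split => //; exact: opnorm_le.
Qed.

Lemma Sigma_subspace_one_norming (N : set X) : linearly_dense N ->
  one_norming (countably_supported N) -> Sigma_subspace (countably_supported N).
Proof.
move=> dN oN; split.
- by move=> f [].
- exact: countably_supported_subspace.
- by exists 1, 1; split => // x; rewrite oN !mul1r lexx.
- by exists N.
Qed.

Lemma closure_distance (E : set X) (w : X) : ~ closure E w ->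
  exists2 d : R, 0 < d & forall y, E y -> d <= rnorm (w - y).
Proof.
move=> nEw; apply: contrapT => nd; apply: nEw; apply/closure_rnormP => e e0.
apply: contrapT => ne; apply: nd; exists e => // y Ey; rewrite leNgt.
by apply/negP => lt; apply: ne; exists y.
Qed.

Lemma linearly_dense_separating (N : set X) :
  (forall f : X -> C^o, dual f -> (forall m, N m -> f m = 0) -> forall x, f x = 0) ->
  linearly_dense N.
Proof.
move=> sN; apply/seteqP; split => // w _; apply: contrapT => /closure_distance[d d0 dE].
have [//|//|f [df _ fY fw]] :=
    @dual_separation R X (linear_span N) w d (linear_span_subspace N).
have /eqP := sN _ df (fun m Nm => fY m (sub_linear_span Nm)) w.
by rewrite fw oner_eq0.
Qed.

Lemma separating_linearly_dense (N : set X) (f : X -> C^o) :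
  linearly_dense N -> dual f -> (forall m, N m -> f m = 0) -> forall x, f x = 0.
Proof.
move=> dN /bounded_operatorsP[lf [k k0 fk]] fN x.
have f0 : forall y, linear_span N y -> f y = 0.
  apply: (linear_span_min (B := [set y | f y = 0])) => //; split=> [|a u v /= fu fv].
    exact: lin0.
  by rewrite lf fu fv scaler0 addr0.
have : closure (linear_span N) x by rewrite dN.
move=> /closure_rnormP cx; apply: rnorm_eq0; apply/eqP; rewrite eq_le rnorm_ge0 andbT.
apply/ler_addgt0Pr => e e0; rewrite add0r.
have k1 : 0 < k + 1 by rewrite ltr_wpDl.
have [y Ny ye] := cx (e / (k + 1)) ltac:(by rewrite divr_gt0).
rewrite -[f x]subr0 -(f0 _ Ny) -(linB lf); apply: le_trans (fk _) _.
move: ye; rewrite ltr_pdivlMr // mulrC => /ltW; apply: le_trans.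
by rewrite ler_wpM2r ?rnorm_ge0 // lerDl.
Qed.

End SigmaSubspaces.

(** * Compressions by projections *)

Section Compressions.
Variables (R : realType) (H : completeNormedModType R[i]).
Local Notation C := R[i].
Variable ip : {dot H for conjC}.
Hypothesis hip : hilbert_inner_product ip.
Variable M : set (H -> H).
Hypothesis hM : von_Neumann_algebra ip M.
Variable X : completeNormedModType C.
Variable pr : (H -> H) -> X -> C^o.
Hypothesis hpr : dual_pairing M pr.
Let vnC := vn_comp hM.
Let K := commutant M.

Lemma commutant_comp a b : K a -> K b -> K (a \o b).
Proof.
move=> [ba aM] [bb bM]; split.
  have [la [k k0 ak]] := (bounded_operatorsP a).1 ba.
  have [lb [l l0 bl]] := (bounded_operatorsP b).1 bb.
  apply/bounded_operatorsP; split; first by move=> c u v /=; rewrite lb la.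
  exists (k * l) => [|x /=]; first exact: mulr_ge0.
  by apply: le_trans (ak _) _; rewrite -mulrA ler_wpM2l.
move=> m Mm; apply/funext => x /=.
have /(congr1 (fun f => f (b x))) /= -> := aM _ Mm.
by have /(congr1 (fun f => f x)) /= -> := bM _ Mm.
Qed.

Lemma proj_setU (E F : set H) : (forall x y, E x -> F y -> ip x y = 0) ->
  proj ip (E `|` F) = proj ip E + proj ip F.
Proof.
move=> EF; apply/funext => v; apply: (proj_uniq hip).
  have cl := closure_subspace (linear_span_subspace (E `|` F)).
  apply: (subspaceD cl).
    have := @proj_in _ _ ip hip E v.
    by apply: closure_subset; apply: linear_span_mono; exact: subsetUl.
  have := @proj_in _ _ ip hip F v.
  by apply: closure_subset; apply: linear_span_mono; exact: subsetUr.
have FE x y : F y -> E x -> ip y x = 0 by move=> Fy Ex; rewrite ipC EF // conjc0.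
have oE y : E y -> ip (proj ip F v) y = 0.
  move=> Ey; rewrite ipC (@orth_closure_span _ _ ip hip F y) ?conjc0 //.
    by move=> z Fz; rewrite EF.
  exact: proj_in.
have oF y : F y -> ip (proj ip E v) y = 0.
  move=> Fy; rewrite ipC (@orth_closure_span _ _ ip hip E y) ?conjc0 //.
    by move=> z Ez; rewrite FE.
  exact: proj_in.
move=> z; rewrite -[(_ + _) v]/(proj ip E v + proj ip F v) => -[Ez|Fz].
  by rewrite opprD addrA ipBl (projP hip E v).2 // oE // subr0.
by rewrite opprD addrCA addrC ipBl (projP hip F v).2 // oF // subr0.
Qed.

(** [x] is nearly a finite sum of vector functionals, and each of the finitely many
    vectors involved is, once projected, nearly in the span of finitely many members
    of the family. *)
Lemma predual_proj_approx (I : Type) (S : set I) (E : I -> set H) x b (e : R) :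
  (forall J, J `<=` S -> M (proj ip (\bigcup_(i in J) E i))) ->
  M b -> bounded_by b 1 -> 0 < e ->
  exists J, [/\ finite_set J, J `<=` S &
    cabs (pr (proj ip (\bigcup_(i in S) E i) \o b) x -
          pr (proj ip (\bigcup_(i in J) E i) \o b) x) <= e].
Proof.
move=> ME Mb b1 e0.
pose q J := proj ip (\bigcup_(i in J) E i).
have e3 : 0 < e / 3 by rewrite divr_gt0.
have [s hs] := @predual_vector_limit _ _ ip hip M hM X pr hpr x _ e3.
pose N := \sum_(z <- s) rnorm z.1.
have N0 : 0 <= N by apply: sumr_ge0 => z _; exact: rnorm_ge0.
have N1 : 0 < N + 1 by rewrite ltr_wpDl.
have d0 : 0 < e / 3 / (N + 1) by rewrite divr_gt0.
have [J [fJ JS Js]] : exists J, [/\ finite_set J, J `<=` S &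
    forall z, z \in s -> rnorm (q S z.2 - q J z.2) <= e / 3 / (N + 1)].
  have qJS J v : J `<=` S -> q J v = q J (q S v).
    move=> JS; apply/eqP; rewrite -subr_eq0 -(linB (proj_linear hip _)); apply/eqP.
    apply: (proj_eq0 hip) => z [i Ji Ei]; apply: (projP hip _ v).2.
    by exists i => //; exact: JS.
  elim: (s) => [|z s' [J [fJ JS Js]]].
    by exists set0; split=> // ? [].
  have [J' [fJ' JS' [y yJ ye]]] :=
    @closure_span_finite _ _ _ S E (q S z.2) _ (@proj_in _ _ ip hip _ z.2) d0.
  exists (J `|` J'); split; first by rewrite finite_setU.
    by rewrite subUset.
  have sub : J `|` J' `<=` S by rewrite subUset.
  have best y' v : linear_span (\bigcup_(i in J `|` J') E i) y' ->
      rnorm (q S v - q (J `|` J') v) <= rnorm (q S v - y').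
    by move=> hy; rewrite (qJS _ _ sub); apply: (proj_best hip); exact: subset_closure.
  have clb y' v : closure (linear_span (\bigcup_(i in J `|` J') E i)) y' ->
      rnorm (q S v - q (J `|` J') v) <= rnorm (q S v - y').
    by move=> hy; rewrite (qJS _ _ sub); apply: (proj_best hip).
  move=> w; rewrite inE => /predU1P[->|ws].
    apply: le_trans (ltW ye); apply: best.
    by apply: linear_span_mono yJ => h [i Ji Eh]; exists i => //; right.
  apply: le_trans (Js w ws); apply: clb.
  have := @proj_in _ _ ip hip (\bigcup_(i in J) E i) w.2.
  apply: closure_subset; apply: linear_span_mono => h [i Ji Eh].
  by exists i => //; left.
exists J; split => //.
have MS := vnC (ME S (@subset_refl _ S)) Mb; have MJ := vnC (ME J JS) Mb.
have q1 A : bounded_by (q A \o b) 1.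
  move=> h /=; apply: le_trans (@proj_contraction _ _ ip hip _ _) _.
  by rewrite mul1r; have := b1 h; rewrite mul1r.
have h1 := hs _ 1 MS ler01 (q1 S); have h2 := hs _ 1 MJ ler01 (q1 J).
rewrite mulr1 in h1; rewrite mulr1 in h2.
have h3 : cabs (vector_sum ip s (q S \o b) - vector_sum ip s (q J \o b)) <= e / 3.
  rewrite /vector_sum -sumrB.
  apply: (@le_trans _ _ (\sum_(z <- s) rnorm z.1 * (e / 3 / (N + 1)))); last first.
    rewrite -mulr_suml -/N mulrCA ler_piMr ?(ltW e3) // ler_pdivrMr // mul1r.
    by rewrite lerDl.
  rewrite big_seq [leRHS]big_seq.
  apply: (big_ind2 (fun (u : C) v => cabs u <= v)) => [|u v u' v' h h'|z zs].
  - by rewrite rnorm0.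
  - by apply: le_trans (rnormD _ _) _; exact: lerD.
  - rewrite /= (proj_selfadjoint hip) (proj_selfadjoint hip) -ipBr.
    apply: le_trans (cauchy_schwarz hip _ _) _; apply: ler_pM; rewrite ?rnorm_ge0 //.
      by have := b1 z.1; rewrite mul1r.
    exact: Js.
set A1 := pr _ x in h1 *; set A2 := pr _ x in h2 *.
set V1 := vector_sum _ _ _ in h1 h3; set V2 := vector_sum _ _ _ in h2 h3.
have -> : A1 - A2 = (A1 - V1) + (V1 - V2) - (A2 - V2).
  by rewrite subrKA opprB addrA subrK.
apply: le_trans (rnormB _ _) _.
apply: le_trans (lerD (rnormD _ _) (lexx _)) _; lra.
Qed.

End Compressions.

(** * Cyclic decompositions *)

Section Assembly.
Variables (R : realType) (H : completeNormedModType R[i]).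
Local Notation C := R[i].
Variable ip : {dot H for conjC}.
Hypothesis hip : hilbert_inner_product ip.
Variable M : set (H -> H).
Hypothesis hM : von_Neumann_algebra ip M.
Variable X : completeNormedModType C.
Variable pr : (H -> H) -> X -> C^o.
Hypothesis hpr : dual_pairing M pr.
Let vn_lin := vn_linear hM.
Let adjE := adj_vnE hip hM.
Let vnA := vn_adj hip hM.
Let vnC := vn_comp hM.
Let K := commutant M.

Let orb (s : H) : set H := [set a s | a in K].

Section CyclicDecomposition.
Variables (B S : set H) (xv : H -> H -> X).
Hypothesis oB : orbit_orthogonal ip [set id] B.
Hypothesis tB : orbit_total ip [set id] B.
Hypothesis oS : orbit_orthogonal ip K S.
Hypothesis tS : orbit_total ip K S.
Hypothesis xvE : forall h k b, M b -> pr b (xv h k) = ip (b h) k.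

Let gens : set X := [set m | exists e s, [/\ B e, S s & m = xv e s]].

Let basis_total z : (forall e, B e -> ip e z = 0) -> z = 0.
Proof. by move=> zB; apply: tB => e a Be ->; exact: zB. Qed.

Let basis_orthogonal e e' : B e -> B e' -> e <> e' -> ip e e' = 0.
Proof. by move=> Be Be' ee'; exact: (oB.2 e e' id Be Be' ee' erefl). Qed.

Let basis_countable z : countable [set e | B e /\ ip e z <> 0].
Proof. exact: (bessel_countable hip oB.1 basis_orthogonal). Qed.

Let basis_finite z (e : R) : 0 < e ->
  finite_set [set h | B h /\ e <= cabs (ip h z)].
Proof. exact: (bessel_finite hip oB.1 basis_orthogonal). Qed.

Let gensE e s b : M b -> pr b (xv e s) = ip e (adj ip b s).
Proof. by move=> Mb; rewrite xvE // adjE. Qed.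

(** The adjoint of [b] vanishes on S, hence on the orbits of S, with which it commutes. *)
Let scaled_gens_separating (c : H -> C) b : M b ->
  (forall s, S s -> c s != 0) ->
  (forall e s, B e -> S s -> pr b (c s *: xv e s) = 0) -> b = 0.
Proof.
move=> Mb c0 b0.
have bs s : S s -> adj ip b s = 0.
  move=> Ss; apply: basis_total => e Be; rewrite -gensE //.
  have /eqP := b0 e s Be Ss; rewrite (linZ (pr_linear hpr Mb)).
  by rewrite scaler_eq0 (negPf (c0 s Ss)) /= => /eqP.
apply/funext => y; apply: tS => s a Ss Ka.
rewrite (adj_vnE' hip hM _ _ Mb).
case: Ka => [[la _] aM].
have /(congr1 (fun f => f s)) /= -> := aM _ (vnA Mb).
by rewrite bs // (lin0 la) ip0l.
Qed.

Let scaled_gens_dense (c : H -> C) (N : set X) : (forall s, S s -> c s != 0) ->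
  (forall e s, B e -> S s -> N (c s *: xv e s)) -> linearly_dense N.
Proof.
move=> c0 NE; apply: linearly_dense_separating => f df fN x.
have [b Mb bf] := pr_surj hpr df.
suff -> : f = 0 by [].
rewrite -bf (_ : b = 0); first by apply/funext => y; exact: (pr0 hM hpr).
apply: (scaled_gens_separating Mb c0) => e s Be Ss.
by rewrite bf fN //; exact: NE.
Qed.

Let gens_dense : linearly_dense gens.
Proof.
apply: (@scaled_gens_dense (fun=> 1)) => [s _|e s Be Ss]; first exact: oner_neq0.
by rewrite scale1r; exists e, s.
Qed.

(** Each [s] contributes countably many generators, by Bessel's inequality. *)
Let support_countable b J : M b -> countable J ->
  (forall s, S s -> ~ J s -> adj ip b s = 0) ->
  countable [set m | gens m /\ pr b m <> 0].
Proof.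
move=> Mb cJ bJ.
apply: (@countable_subset _ _ (\bigcup_(s in J)
   ((fun e => xv e s) @` [set e | B e /\ ip e (adj ip b s) <> 0]))).
  move=> _ [[e [s [Be Ss ->]]]]; rewrite gensE // => es.
  exists s; last by exists e.
  apply: contrapT => nJ; apply: es; by rewrite bJ // ip0r.
apply: bigcup_countable => // s _; apply: countable_image; exact: basis_countable.
Qed.

Let orb_invariant J a x : K a -> (\bigcup_(s in J) orb s) x ->
  linear_span (\bigcup_(s in J) orb s) (a x).
Proof.
move=> Ka [s Js [a' Ka' <-]]; apply: sub_linear_span.
by exists s => //; exists (a \o a') => //; exact: commutant_comp.
Qed.

Let orb_proj J : M (proj ip (\bigcup_(s in J) orb s)).
Proof. by apply: (vn_proj hip hM) => a x; exact: orb_invariant. Qed.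

Let orb_proj_total : proj ip (\bigcup_(s in S) orb s) = id.
Proof.
apply/funext => v /=; apply/esym/eqP; rewrite -subr_eq0; apply/eqP.
apply: tS => s a Ss Ka; rewrite ipC (projP hip _ v).2 ?conjc0 //.
by exists s => //; exists a.
Qed.

(** Compressing a norming contraction to the span of finitely many orbits makes its
    support countable. *)
Let gens_one_norming : one_norming (countably_supported gens).
Proof.
apply: one_norming_approx => [f []//|x e e0].
have [u [Mu u1 ux]] := norming_element hM hpr x.
have [J [fJ JS]] := predual_proj_approx hip hM hpr (S := S) (E := orb) x
  (fun J _ => orb_proj J) Mu u1 e0.
rewrite orb_proj_total -[id \o u]/u => h.
set q := proj ip _ in h.
have Mq : M q by exact: orb_proj.
have Mqu : M (q \o u) by exact: vnC.
exists (pr (q \o u)); split.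
- split; first exact: (pr_dual hpr).
  apply: (support_countable Mqu (finite_set_countable fJ)) => s Ss nJs.
  rewrite (adj_comp hip hM Mq Mu) /= (adj_uniq hip hM Mq (proj_selfadjoint hip _)).
  rewrite (proj_eq0 hip) ?(lin0 (vn_lin (vnA Mu))) // => _ [s' Js' [a Ka <-]].
  rewrite ipC oS.2 ?conjc0 //; first exact: JS.
  by move=> ss'; apply: nJs; rewrite -ss'.
- apply/(pr_normP hpr Mqu ler01) => v /=.
  by apply: le_trans (@proj_contraction _ _ ip hip _ _) _; rewrite mul1r; exact: u1.
- move: h; rewrite ux => h.
  have h2 : rnorm x <= cabs ((rnorm x)%:C - pr (q \o u) x) + cabs (pr (q \o u) x).
    have := rnormD ((rnorm x)%:C - pr (q \o u) x : C^o) (pr (q \o u) x).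
    by rewrite subrK cabsR ger0_norm // rnorm_ge0.
  rewrite lerBlDl; apply: le_trans h2 _; by rewrite lerD2r.
Qed.

Lemma cyclic_one_Plichko : one_Plichko X.
Proof.
exists (countably_supported gens); split; last exact: gens_one_norming.
exact: Sigma_subspace_one_norming gens_dense gens_one_norming.
Qed.

(** The cyclic projections of the members of [S] are mutually orthogonal and nonzero. *)
Lemma cyclic_countable : sigma_finite_algebra ip M -> countable S.
Proof.
move=> sf; pose p s := proj ip (orb s).
have E1 s : orb s = \bigcup_(t in [set s]) orb t by rewrite bigcup_set1.
have Mp s : M (p s) by rewrite /p E1.
have ps s : p s s = s.
  apply: (proj_id hip); apply: subset_closure; apply: sub_linear_span.
  by exists id => //; exact: commutant_id.
have p0 s s' : S s -> S s' -> s <> s' -> p s \o p s' = 0.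
  move=> Ss Ss' ss'; apply/funext => v /=; apply: (proj_eq0 hip) => _ [a Ka <-].
  have orth y : orb s' y -> ip (a s) y = 0.
    move=> [a' Ka' <-]; have [b Kb ab] := commutant_adj hip hM Ka'.
    rewrite -(adjoint_pairC ab) -[b (a s)]/((b \o a) s); apply: oS.2 => //.
    exact: commutant_comp.
  rewrite ipC (orth_closure_span hip orth) ?conjc0 //; exact: proj_in.
have cP : countable [set p s | s in S].
  apply: sf => [_ [s Ss <-]|_ _ [s Ss <-] [s' Ss' <-] pp].
    split; first by apply: (proj_projection_in hip); exact: Mp.
    move=> /(congr1 (fun f => f s)) /=; rewrite ps -[(0 : H -> H) s]/(0 : H) => s0.
    by have := oS.1 s Ss; rewrite s0 rnorm0 => /eqP; rewrite eq_sym oner_eq0.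
  by apply: p0 => // ss'; apply: pp; rewrite ss'.
have /countable_injP[f finj] := cP.
apply/countable_injP; exists (f \o p) => s s' /set_mem Ss /set_mem Ss' /= fs.
have pss : p s = p s' by apply: finj => //; apply/mem_set; [exists s|exists s'].
apply: contrapT => ss'; have := p0 _ _ Ss Ss' ss'.
move=> /(congr1 (fun f => f s)) /=; rewrite -pss !ps -[(0 : H -> H) s]/(0 : H) => s0.
by have := oS.1 s Ss; rewrite s0 rnorm0 => /eqP; rewrite eq_sym oner_eq0.
Qed.

Lemma cyclic_WLD : countable S -> weakly_Lindelof_determined X.
Proof.
move=> cS; suff -> : weakly_Lindelof_determined X = Sigma_subspace (countably_supported gens).
  exact: Sigma_subspace_one_norming gens_dense gens_one_norming.
rewrite /weakly_Lindelof_determined; congr Sigma_subspace.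
apply/seteqP; split=> [f df|f [] //]; split => //.
have [b Mb <-] := pr_surj hpr df.
by apply: (support_countable Mb cS) => s Ss /(_ Ss).
Qed.

(** With the generators of the [n]-th orbit divided by [n + 1], every functional is
    small at all but finitely many of them. *)
Lemma cyclic_WCG : countable S -> weakly_compactly_generated X.
Proof.
move=> /countable_injP[n ninj].
pose c s : C := (n s).+1%:R^-1%:C.
have c0 s : c s != 0 by rewrite /c eq_complex /= eqxx andbT invr_eq0 pnatr_eq0.
pose N : set X := [set m | m = 0 \/ exists e s, [/\ B e, S s & m = c s *: xv e s]].
exists N; split; last first.
  by apply: (@scaled_gens_dense c) => // e s Be Ss; right; exists e, s.
apply: weakly_compact_null; first by left.
move=> f df eps eps0; have [b Mb bf] := pr_surj hpr df.
have [k k0 bk] := vn_boundedP hM (vnA Mb).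
have small : finite_set [set s | S s /\ (n s).+1%:R * eps <= k].
  pose g j := xget 0 [set s | S s /\ n s = j].
  apply: (@sub_finite_set _ _ (g @` `I_(archi_bound (k / eps)))); last first.
    by apply: finite_image; exact: finite_II.
  move=> s [Ss sk]; exists (n s) => /=.
    have h : (n s).+1%:R < (archi_bound (k / eps))%:R :> R.
      apply: le_lt_trans (archi_boundP _); first by rewrite ler_pdivlMr.
      by rewrite divr_ge0 // ltW.
    by move: h; rewrite ltr_nat => /ltnW.
  have [Sg ng] : S (g (n s)) /\ n (g (n s)) = n s.
    by apply: (@xgetPex _ 0 [set t | S t /\ n t = n s]); exists s.
  by apply: ninj => //; exact/mem_set.
apply: (@sub_finite_set _ _ (\bigcup_(s in [set s | S s /\ (n s).+1%:R * eps <= k])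
   ((fun e => c s *: xv e s) @` [set e | B e /\ eps <= cabs (ip e (adj ip b s))]))).
  move=> m [[->|[e [s [Be Ss ->]]]]].
    by rewrite (lin0 df.1) rnorm0 => /(lt_le_trans eps0); rewrite ltxx.
  rewrite -bf (linZ (pr_linear hpr Mb)) gensE // rnormZ /c cabsR.
  have n0 : 0 < (n s).+1%:R :> R by rewrite ltr0n.
  rewrite gtr0_norm ?invr_gt0 // mulrC ler_pdivlMr // => le.
  have ek : cabs (ip e (adj ip b s)) <= k.
    apply: le_trans (cauchy_schwarz hip _ _) _; rewrite oB.1 // mul1r.
    by apply: le_trans (bk s) _; rewrite oS.1 // mulr1.
  exists s.
    by split => //; rewrite mulrC; exact: le_trans le ek.
  exists e => //; split => //; apply: le_trans le.
  by rewrite ler_peMr ?(ltW eps0) // ler1n.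
by apply: bigcup_finite => // s _; apply: finite_image; exact: basis_finite.
Qed.

End CyclicDecomposition.
End Assembly.

(** * Orthogonal families of projections *)

Section SigmaFinite.
Variables (R : realType) (H : completeNormedModType R[i]).
Local Notation C := R[i].
Variable ip : {dot H for conjC}.
Hypothesis hip : hilbert_inner_product ip.
Variable M : set (H -> H).
Hypothesis hM : von_Neumann_algebra ip M.
Variable X : completeNormedModType C.
Variable pr : (H -> H) -> X -> C^o.
Hypothesis hpr : dual_pairing M pr.
Let vn_lin := vn_linear hM.
Let vnI := vn_id hM.

Variable P : set (H -> H).
Hypothesis projP : forall p, P p -> projection_in ip M p /\ p <> 0.
Hypothesis orthP : forall p q, P p -> P q -> p <> q -> p \o q = 0.

Let PM p : P p -> M p.
Proof. by move=> /projP[[]]. Qed.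

Let Psa p x y : P p -> ip (p x) y = ip x (p y).
Proof. by move=> /projP[[_ h _] _]; exact: h. Qed.

Let Pid p x : P p -> p (p x) = p x.
Proof. by move=> /projP[[_ _ /(congr1 (fun f => f x))]]. Qed.

Let Porth p q x y : P p -> P q -> p <> q -> ip (p x) (q y) = 0.
Proof.
move=> Pp Pq pq; rewrite Psa //.
have /(congr1 (fun f => f y)) /= -> := orthP Pp Pq pq.
exact: ip0r.
Qed.

Let q (A : set (H -> H)) := proj ip (\bigcup_(p in A) range p).

Let qM A : A `<=` P -> M (q A).
Proof.
move=> AP; apply: (vn_proj hip hM) => a _ Ka [p Ap [x _ <-]].
apply: sub_linear_span; exists p => //; exists (a x) => //.
by case: Ka => _ /(_ _ (PM (AP _ Ap))) /(congr1 (fun f => f x)).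
Qed.

Let qU A A' : A `<=` P -> A' `<=` P -> (forall p, A p -> ~ A' p) ->
  q (A `|` A') = q A + q A'.
Proof.
move=> AP A'P dAA; rewrite /q bigcup_setU; apply: (proj_setU hip).
move=> _ _ [p Ap [x _ <-]] [p' Ap' [y _ <-]].
apply: Porth; [exact: AP|exact: A'P|].
by move=> pp; apply: (dAA p) => //; rewrite pp.
Qed.

Let q_id A p x : A p -> q A (p x) = p x.
Proof.
move=> Ap; apply: (proj_id hip); apply: subset_closure; apply: sub_linear_span.
by exists p => //; exists x.
Qed.

Let q1 p : P p -> q [set p] = p.
Proof.
move=> Pp; apply/funext => x; rewrite /q bigcup_set1; apply: (proj_uniq hip).
  by apply: subset_closure; apply: sub_linear_span; exists x.
by move=> _ [y _ <-]; rewrite -Psa // (linB (vn_lin (PM Pp))) Pid // subrr ip0l.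
Qed.

Let q0 : q set0 = 0.
Proof.
apply/funext => x; rewrite /q bigcup_set0; exact: (proj_eq0 hip).
Qed.

Let pr_q_finite A x : finite_set A -> A `<=` P -> (forall p, A p -> pr p x = 0) ->
  pr (q A) x = 0.
Proof.
move=> /finite_seqP[s ->] {A}; elim: s => [|p s IHs] sP s0.
  rewrite (_ : [set` [::]] = set0) ?q0 ?(pr0 hM hpr) //.
  by apply/seteqP; split.
have pE : [set` p :: s] = [set p] `|` [set` s].
  apply/seteqP; split=> r /=; rewrite inE; first by move=> /predU1P.
  by move=> [->|->]; rewrite ?eqxx ?orbT.
have sP' : [set` s] `<=` P by move=> r rs; apply: sP; rewrite pE; right.
have s0' r : [set` s] r -> pr r x = 0 by move=> rs; apply: s0; rewrite pE; right.
have Pp : P p by apply: sP; rewrite pE; left.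
have [ps|ps] := boolP (p \in s).
  suff -> : [set` p :: s] = [set` s] by exact: IHs.
  by rewrite pE; apply/setUidPr => _ ->.
have hp : [set p] `<=` P by move=> _ ->.
have ds r : [set p] r -> ~ [set` s] r by move=> -> rs; move: ps; rewrite rs.
rewrite pE (qU hp sP' ds) (prD hpr _ (qM hp) (qM sP')) (q1 Pp).
by rewrite s0 ?IHs ?addr0 // pE; left.
Qed.

(** Complete additivity of the elements of the predual. *)
Let pr_q A x : A `<=` P -> (forall p, A p -> pr p x = 0) -> pr (q A) x = 0.
Proof.
move=> AP A0; apply: (@rnorm_eq0 _ C^o); apply/eqP; rewrite eq_le rnorm_ge0 andbT.
apply/ler_addgt0Pr => e e0; rewrite add0r.
have id1 : bounded_by (@id H) 1 by move=> h; rewrite mul1r.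
have [J [fJ JA]] := predual_proj_approx hip hM hpr (S := A) (E := fun p => range p) x
  (fun J JA => qM (subset_trans JA AP)) vnI id1 e0.
rewrite -[_ \o id]/(q A) -[_ \o id]/(q J).
by rewrite (pr_q_finite fJ (subset_trans JA AP)) ?subr0 // => p /JA; exact: A0.
Qed.

Let range_countable h : countable [set p | P p /\ p h <> 0].
Proof.
pose A := [set p | P p /\ p h <> 0].
pose v (p : H -> H) := (rnorm (p h))^-1%:C *: p h.
have v1 p : A p -> rnorm (v p) = 1.
  move=> [Pp /rnorm_gt0 n0].
  by rewrite rnormZ cabsR gtr0_norm ?invr_gt0 // mulVf // gt_eqF.
have vo p p' : A p -> A p' -> p <> p' -> ip (v p) (v p') = 0.
  by move=> [Pp _] [Pp' _] pp; rewrite ipZl ipZr Porth // !mulr0.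
apply: countable_subset (bessel_countable hip v1 vo h) => p [Pp ph].
split => //; rewrite ipZl.
have -> : ip (p h) h = ip (p h) (p h) by rewrite -{1}(Pid h Pp) Psa.
rewrite (ipxx hip) -rmorphM => /(congr1 (@complex.Re _)) /= /eqP.
rewrite mulf_eq0 invr_eq0 sqrf_eq0 orbb => /eqP n0.
by apply: ph; exact: rnorm_eq0.
Qed.

(** A vector is killed by all but countably many members of [P], and [x] is a limit of
    functionals that involve countably many vectors altogether. *)
Let fibre_countable x : countable [set p | P p /\ pr p x <> 0].
Proof.
have hs (n : nat) := @predual_vector_limit _ _ ip hip M hM X pr hpr x _ (inv_succ_gt0 R n).
have [s sE] := choice hs.
apply: (@countable_subset _ _ (\bigcup_n \bigcup_(z in [set` s n])
  [set p | P p /\ p z.1 <> 0])); last first.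
  apply: countable_bigcup_nat => n; apply: bigcup_countable => [|z _].
    exact/finite_set_countable/finite_seq.
  exact: range_countable.
move=> p [Pp px]; apply: contrapT => np; apply: px.
apply: (@rnorm_eq0 _ C^o); apply/eqP; rewrite eq_le rnorm_ge0 andbT.
apply/ler_addgt0Pr => e e0; rewrite add0r.
have [n ne] := inv_succ_small e0.
have p1 : bounded_by p 1 by rewrite -(q1 Pp); exact: proj_contraction.
have := sE n p 1 (PM Pp) ler01 p1; rewrite mulr1.
suff -> : vector_sum ip (s n) p = 0 by rewrite subr0 => /le_trans; apply; exact: ltW.
rewrite /vector_sum big_seq big1 // => z zs.
suff -> : p z.1 = 0 by exact: ip0l.
by apply: contrapT => pz; apply: np; exists n => //; exists z.
Qed.

(** Let [N] be the dense set of the Sigma-subspace, and say that [b] sees [m] in [N] if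
    [pr b m <> 0]. Both directions of this relation have countable fibres, so there
    is a countable [J] that contains all members of [P] seeing an element of [N] that
    is also seen by [q P] or by a member of [J]. The supremum of [P] minus [J] then
    sees no element of [N], so it is 0. *)
Lemma WLD_countable : weakly_Lindelof_determined X -> countable P.
Proof.
move=> [_ _ _ [N [dN dualE]]].
have supp b : M b -> countable [set m | N m /\ pr b m <> 0].
  by move=> Mb; have := pr_dual hpr Mb; rewrite dualE => -[].
pose A := \bigcup_(m in [set m | N m /\ pr (q P) m <> 0]) [set p | P p /\ pr p m <> 0].
pose r p p' := P p /\ (exists m, [/\ N m, pr p m <> 0, P p' & pr p' m <> 0]).
have MP := qM (@subset_refl _ P).
have cA : countable A by apply: bigcup_countable => [|m _]; [exact: supp|exact: fibre_countable].
have cr p : countable [set p' | r p p'].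
  have [Pp|nPp] := pselect (P p); last first.
    by apply: countable_subset (@countable0 (H -> H)) => p' [].
  apply: (@countable_subset _ _ (\bigcup_(m in [set m | N m /\ pr p m <> 0])
     [set p | P p /\ pr p m <> 0])).
    by move=> p' [_ [m [Nm pm Pp' pm']]]; exists m.
  apply: bigcup_countable => [|m _]; last exact: fibre_countable.
  exact/supp/PM.
have [J [cJ AJ Jr]] := countable_closure cA cr.
pose J1 := P `&` J; pose J2 := P `\` J.
have J1P : J1 `<=` P by move=> p [].
have J2P : J2 `<=` P by move=> p [].
have PE : P = J1 `|` J2 by rewrite setUIDK.
have q2 m : N m -> pr (q J2) m = 0.
  move=> Nm; have [h|/existsNP[p' /not_implyP[[Pp' nJ] pm']]] :=
    pselect (forall p, J2 p -> pr p m = 0); first exact: pr_q.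
  have h1 : pr (q P) m = 0.
    by apply: contrapT => qm; apply: nJ; apply: AJ; exists m.
  have h2 : pr (q J1) m = 0.
    apply: pr_q => // p [Pp Jp]; apply: contrapT => pm; apply: nJ.
    by apply: (Jr p) => //; split => //; exists m.
  have : pr (q P) m = pr (q J1) m + pr (q J2) m.
    rewrite {1}PE qU // ?(prD hpr) //; try exact: qM.
    by move=> p [_ Jp] [_ /(_ Jp)].
  by rewrite h1 h2 add0r => <-.
have M2 := qM J2P.
have q20 : q J2 = 0.
  apply: (pr_eq0 hpr M2).
  exact: (separating_linearly_dense dN (pr_dual hpr M2) q2).
apply: countable_subset cJ => p Pp; apply: contrapT => nJp.
have [_] := projP Pp; apply; apply/funext => x.
by rewrite -(@q_id J2) // q20.
Qed.

End SigmaFinite.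

(** * Preduals of von Neumann algebras *)

Theorem theorem1p1 (R : realType) (H : completeNormedModType R[i]%C)
    (ip : {dot H for Num.conj}%R) (M : set (H -> H))
    (M_pre : completeNormedModType R[i]%C) :
  hilbert_inner_product ip ->
  von_Neumann_algebra ip M ->
  predual M M_pre ->
  [/\ one_Plichko M_pre,
      weakly_Lindelof_determined M_pre <-> sigma_finite_algebra ip M &
      sigma_finite_algebra ip M -> weakly_compactly_generated M_pre].
Proof.
move=> hip hM /(predual_pairing hM)[pr hpr].
have id_adj a : [set id] a -> exists2 b : H -> H, [set id] b & adjoint_pair ip a b.
  by move=> ->; exists id.
have [B [oB tB]] := maximal_family hip (erefl : [set id] (@id H)) id_adj.
have [S [oS tS]] := maximal_family hip (commutant_id M) (commutant_adj hip hM).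
have hxv (z : H * H) : exists x, forall b, M b -> pr b x = ip (b z.1) z.2.
  exact: (vector_functional_in_predual hip hM hpr).
have [xv xvE] := choice hxv.
have xvE' h k b : M b -> pr b (xv (h, k)) = ip (b h) k by move=> Mb; rewrite xvE.
split.
- exact: (cyclic_one_Plichko hip hM hpr oB tB oS tS xvE').
- split=> [wld P projP orthP|sf].
    exact: (WLD_countable hip hM hpr projP orthP wld).
  apply: (cyclic_WLD hip hM hpr oB tB oS tS xvE').
  exact: (cyclic_countable hip hM oS sf).
- move=> sf; apply: (cyclic_WCG hip hM hpr oB tB oS tS xvE').
  exact: (cyclic_countable hip hM oS sf).
Qed.
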